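(* Let $p\ge2$ be fixed, let $H_N$ be a $p$-uniform Erdős–Rényi hypergraph on $\{1,\dots,N\}$ with parameter $\alpha_N=c_N/N^{p-1}\in(0,1)$, and let $\mu_N$ be the empirical spectral distribution of the normalized pair-adjacency matrix $\tilde A_N$ of $H_N$. Then, as $N\to\infty$: (i) if $c_N\to\infty$ and $N^{p-1}(1-\alpha_N)\to\infty$, then $\mu_N\to\mu_{\mathrm{sc}}$ weakly in probability, where $\mu_{\mathrm{sc}}$ is the semicircular law supported on $[-2,2]$; (ii) if $c_N\to c>0$, then $\mu_N\to\mu_c$ weakly in probability, where $\mu_c$ is a probability measure uniquely characterized by its moments, depending only on $c$ (for the fixed $p$), and with unbounded support. Moreover, up to normalization (dilation) by some constant depending on $c,p$, the measure $\mu_c$ is the expectation of the spectral measure, at the root, of the adjacency operator of the clique expansion of the uniform Galton–Watson hypertree with reproduction law $\mathrm{Poi}(c/(p-1)!)$.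
   Context: The $p$-uniform Erdős–Rényi hypergraph on $\{1,\dots,N\}$ with parameter $\alpha$ is the random simple hypergraph in which each subset $\{i_1<\cdots<i_p\}$ is a hyperedge with probability $\alpha$, independently. With $E(H_N)$ its set of hyperedges, the pair-adjacency matrix is $(A_N)_{i,j}=\mathbf{1}\{i\ne j\}\sum_{e\in E(H_N)}\mathbf{1}\{i,j\in e\}$, $1\le i,j\le N$, and its normalized version is $$\tilde A_N=\frac{A_N-\mathbb{E}[A_N]}{\sqrt{N\,\mathrm{Var}((A_N)_{1,2})}}.$$ The empirical spectral distribution of a real symmetric $N\times N$ matrix is the uniform probability measure on its $N$ eigenvalues (with multiplicity). The uniform Galton–Watson hypertree with reproduction law $\mathrm{Poi}(\lambda)$ is the random rooted $p$-uniform hypertree in which the root $o$ has a $\mathrm{Poi}(\lambda)$ number of offspring hyperedges, each offspring hyperedge contains $p-1$ new vertices besides its parent vertex, and each new vertex independently has a $\mathrm{Poi}(\lambda)$ number of offspring hyperedges, recursively. The clique expansion of a hypergraph is the graph on the same vertex set in which two distinct vertices are adjacent iff they belong to a common hyperedge. If $\mathcal{A}'$ is the adjacency operator of the clique expansion of this random hypertree, the expectation of its spectral measure at the root is the probability measure $\mathbb{E}\mu^{o,o}_{\mathcal{A}'}$ with moments $\int t^k\,d\mathbb{E}\mu^{o,o}_{\mathcal{A}'}(t)=\mathbb{E}\langle\delta_o,(\mathcal{A}')^k\delta_o\rangle$, i.e. the expected number of closed walks of length $k$ from $o$. *)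

(* Defs.v *)
From HB Require Import structures.
From mathcomp Require Import all_boot all_order all_algebra.
From mathcomp Require Import all_classical all_reals all_analysis.
From mathcomp Require Import measurable_realfun polyrcf.

Set Implicit Arguments.
Unset Strict Implicit.
Unset Printing Implicit Defensive.

Import Order.TTheory GRing.Theory Num.Theory.
Import numFieldNormedType.Exports.

Local Open Scope classical_set_scope.
Local Open Scope ring_scope.

Section measures_on_the_line.
Context {R : realType}.
Implicit Types mu nu : probability (measurableTypeR R) R.

Definition moments_finite mu : Prop :=
  forall k, mu.-integrable setT (fun x : R => (x ^+ k)%:E).

Definition moment (mu : {measure set (measurableTypeR R) -> \bar R}) (k : nat) :
  \bar R := (\int[mu]_x (x ^+ k)%:E)%E.

Definition moment_determinate mu : Prop :=
  moments_finite mu /\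
  forall nu, moments_finite nu -> (forall k, moment nu k = moment mu k) ->
    forall A, measurable A -> nu A = mu A.

Definition measure_support mu : set R :=
  [set x | forall U : set R, open U -> U x -> (0 < mu U)%E].

Definition dilation (a : R) (x : measurableTypeR R) : measurableTypeR R :=
  (a : R) * x.

Lemma measurable_dilation a : measurable_fun setT (dilation a).
Proof. exact: measurable_funM. Qed.

HB.instance Definition _ a :=
  @isMeasurableFun.Build _ _ _ _ (dilation a) (measurable_dilation a).

Definition dilate (a : R) mu : probability (measurableTypeR R) R :=
  distribution mu (dilation a).

(* Num.sqrt vanishes on negative reals, so this density is zero off [-2, 2] *)
Definition semicircle_pdf (x : R) : R := Num.sqrt (4 - x ^+ 2) / (2 * pi).

Lemma semicircle_pdf_ge0 x : 0 <= semicircle_pdf x.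
Proof. by rewrite divr_ge0 ?sqrtr_ge0// mulr_ge0// pi_ge0. Qed.

Lemma measurable_semicircle_pdf :
  @measurable_fun _ _ (measurableTypeR R) (measurableTypeR R)
    setT semicircle_pdf.
Proof.
apply: continuous_measurable_fun => x; rewrite /semicircle_pdf.
apply: cvgM; last exact: cvg_cst.
apply: (cvg_comp _ Num.sqrt); last exact: sqrt_continuous.
by apply: cvgB; [exact: cvg_cst|exact: sqr_continuous].
Qed.

Definition semicircle : set (measurableTypeR R) -> \bar R :=
  fun A => (\int[lebesgue_measure]_(x in A) (semicircle_pdf x)%:E)%E.

Let semicircle0 : semicircle set0 = 0%E.
Proof. by rewrite /semicircle integral_set0. Qed.

Let semicircle_ge0 A : (0 <= semicircle A)%E.
Proof. by apply: integral_ge0 => x _; rewrite lee_fin semicircle_pdf_ge0. Qed.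

Let semicircle_sigma_additive : semi_sigma_additive semicircle.
Proof.
move=> /= F mF tF mUF; rewrite /semicircle; apply: cvg_toP.
  apply: ereal_nondecreasing_is_cvgn => m n mn.
  apply: lee_sum_nneg_natr => // k _ _.
  by apply: integral_ge0 => /= x _; rewrite lee_fin semicircle_pdf_ge0.
rewrite ge0_integral_bigcup//=.
- apply: measurable_funTS; apply: measurableT_comp => //.
  exact: measurable_semicircle_pdf.
- by move=> x _; rewrite lee_fin semicircle_pdf_ge0.
Qed.

HB.instance Definition _ := isMeasure.Build _ _ _
  semicircle semicircle0 semicircle_ge0 semicircle_sigma_additive.

End measures_on_the_line.

Section spectral_distribution.
Context {R : realType}.

(* repeated according to their multiplicity in the characteristic polynomial *)
Definition eigenvalues N (A : 'M[R]_N) : seq R :=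
  flatten [seq nseq (mup x (char_poly A)) x | x <- rootsR (char_poly A)].

Definition esd N (A : 'M[R]_N) : {measure set (measurableTypeR R) -> \bar R} :=
  mscale (N%:R^-1)%:nng
    (msum (fun k => \d_((eigenvalues A)`_k : measurableTypeR R)) N).

Definition weak_cvg_in_probability (d : nat -> measure_display)
    (Omega : forall n, measurableType (d n))
    (P : forall n, probability (Omega n) R)
    (mu_ : forall n, Omega n -> {measure set (measurableTypeR R) -> \bar R})
    (mu : {measure set (measurableTypeR R) -> \bar R}) : Prop :=
  forall f : R -> R, continuous f -> bounded_fun f ->
  forall eps : R, 0 < eps ->
    P n [set w | eps < `| \int[mu_ n w]_x f x - \int[mu]_x f x |]
      @[n --> \oo] --> 0%E.

End spectral_distribution.

Definition mutually_independent d (Omega : measurableType d) (R : realType)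
    (P : probability Omega R) (I : choiceType) (D : set I)
    (A : I -> set Omega) : Prop :=
  forall s : seq I, uniq s -> [set` s] `<=` D ->
    P (\bigcap_(i in [set` s]) A i) = (\prod_(i <- s) P (A i))%E.

Section erdos_renyi.
Context {R : realType}.

Definition is_erdos_renyi d (Omega : measurableType d)
    (P : probability Omega R) (p N : nat) (alpha : R)
    (H : Omega -> {set {set 'I_N}}) : Prop :=
  let hyperedge (e : {set 'I_N}) := [set w | e \in H w] in
  [/\ forall w e, e \in H w -> #|e| = p,
      forall e, measurable (hyperedge e),
      forall e : {set 'I_N}, #|e| = p -> P (hyperedge e) = alpha%:E
    & mutually_independent P [set e : {set 'I_N} | #|e| = p] hyperedge].

Definition pair_adjacency N (H : {set {set 'I_N}}) : 'M[R]_N :=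
  \matrix_(i, j) ((i != j)%:R * \sum_(e in H) ((i \in e) && (j \in e))%:R).

(* N = n.+2, so that the entry (1, 2) exists; it is indexed by ord0 and 1. *)
Definition normalized_pair_adjacency d (Omega : measurableType d)
    (P : probability Omega R) n (H : Omega -> {set {set 'I_n.+2}})
    (w : Omega) : 'M[R]_n.+2 :=
  let A v := pair_adjacency (H v) in
  let mean := \matrix_(i, j) fine 'E_P[fun v => A v i j] in
  let var12 := fine 'V_P[fun v => A v ord0 1] in
  (Num.sqrt (n.+2%:R * var12))^-1 *: (A w - mean).

End erdos_renyi.

Section clique_expansion.
Context {V : choiceType}.

Definition clique_adj (E : set (set V)) (u v : V) : Prop :=
  u <> v /\ exists2 e, E e & e u /\ e v.

Definition adjacency_operator (R : realType) (E : set (set V)) (f : V -> R) :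
  V -> R := fun u => \sum_(v \in [set v | clique_adj E u v]) f v.

(* < delta_o, A^k delta_o >: the number of closed walks of length k from o *)
Definition root_moment (R : realType) (E : set (set V)) (o : V) (k : nat) : R :=
  iter k (adjacency_operator E) (fun v => (v == o)%:R) o.

(* The expected spectral measure at the root is specified by its moments;
   determinacy makes it the only probability measure with these moments. *)
Definition is_expected_spectral_measure d (Omega : measurableType d)
    (R : realType) (P : probability Omega R) (E : Omega -> set (set V)) (o : V)
    (nu : probability (measurableTypeR R) R) : Prop :=
  moment_determinate nu /\
  forall k, moment nu k = 'E_P[fun w => root_moment R (E w) o k]%E.

End clique_expansion.

Section galton_watson.
Context {q : nat}.

(* Ulam-Harris labels: [::] is the root and (j, i) :: u is the i-th of the q
   new vertices in the j-th offspring hyperedge of u. *)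
Definition label : Type := seq (nat * 'I_q).

Fixpoint gw_vertex (X : label -> nat) (v : label) : bool :=
  if v is (j, _) :: u then (j < X u)%N && gw_vertex X u else true.

Definition gw_hyperedges (X : label -> nat) : set (set label) :=
  [set e | exists u j, [/\ gw_vertex X u, (j < X u)%N &
    e = u |` [set (j, i) :: u | i in [set: 'I_q]]]].

Definition poisson_reproduction d (Omega : measurableType d) (R : realType)
    (P : probability Omega R) (lambda : R) (X : label -> {RV P >-> nat}) :
  Prop :=
  (forall v k, P (X v @^-1` [set k]) = (poisson_pmf lambda k)%:E) /\
  (forall k : label -> nat,
    mutually_independent P setT (fun v => X v @^-1` [set k v])).

End galton_watson.

(* Main.v *)
(* The trace of the k-th power of the centred adjacency matrix is a sum over the
   closed walks in which every step moves inside a hyperedge chosen through the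
   current vertex.  After averaging, each hyperedge must be used at least twice,
   and counting free vertices shows that only the walks whose hyperedges form a
   hypertree, discovered one hyperedge at a time, survive.  Each use of a
   hyperedge beyond the second costs a factor eta = lim 1/rho, where rho^2 is N times the variance
   of an entry: if eta = 0 the limiting moments count ballot paths and are those
   of the semicircle, while for eta = 1/a with a^2 = c/(p-2)! they are, up to the
   dilation by a, the expected numbers of closed walks in the Galton-Watson
   hypertree.  A pair of walks that share no hyperedge dominates the second
   moment, so the empirical moments concentrate.

   The even moments are bounded by B^k times Touchard numbers, which are
   o(t^k k!) for every t > 0.  Hence the Taylor polynomials of cos and sin, with
   the Weierstrass theorem, trap every bounded continuous f as |f - Q| <= K with
   the moments of K as small as we please.  This gives the weak convergence from
   that of the moments, the determinacy of the limit and, with a Riesz-type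
   representation of the limiting functional, its existence.

   For the hypertree, the number of closed walks from the root is a sum over
   hypertrees T of the number of embeddings of T in the random hypertree; peeling
   off the hyperedges of T, the factorial moments of the Poisson law give
   lambda^|T| for the mean of this number. *)

Require Import Defs.
From HB Require Import structures.
From mathcomp Require Import all_boot all_order all_algebra.
From mathcomp Require Import polyrcf complex spectral.
From mathcomp Require Import ring lra zify.

Set Implicit Arguments.
Unset Strict Implicit.
Unset Printing Implicit Defensive.

Import Order.TTheory GRing.Theory Num.Theory.

Local Open Scope ring_scope.

(** * Walks along hyperedges and their hypertrees *)

(** No isomorphism classes of closed walks are enumerated. The whole comparison is an induction on
    the remaining steps of a walk caught midway, with errors measured by the potential [mult_bound]:
    a factor s = alpha (1 - alpha) for each hyperedge used and 1/rho for each used exactly once. A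
    new hyperedge multiplies it by s/rho but leaves about rho^2/s choices of a step; a second use
    multiplies it by rho; a later use leaves it unchanged. So each step costs O(rho) in both
    regimes, and the missing factor of the later uses is the origin of eta. For the second moment
    the second walk starts from the multiplicities left by the first; hence the spectators [M'] and
    [U] in the induction.

    No nonconstant polynomial stays close to a bounded function on the whole line, so f is compared
    with P(sin(t x)): sin(t x)/t is close to x on a long interval, the error is bounded elsewhere,
    and P(sin(t x)) is a trigonometric polynomial, within reach of Taylor expansion.

    The same squeezing by continuous ramps identifies the measure built from the limiting functional
    and computes integrals against the semicircle law. *)

Ltac nonneg := repeat first [done | exact: ler0n | apply: addr_ge0 | apply: mulr_ge0 | apply: exprn_ge0 | rewrite invr_ge0].

Section hyperwalks.
Variables (R : realFieldType) (V : finType) (q : nat).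
Implicit Types (e U : {set V}) (x y : V) (M : {ffun {set V} -> nat}).

Definition incr_mult M e : {ffun {set V} -> nat} :=
  [ffun f => (M f + (f == e))%N].

(* [walk_sum k x y G M] sums [G] over the multiplicity functions obtained by
   adding to [M] the hyperedges used by a walk of length [k] from [x] to [y]. *)
Fixpoint walk_sum k x y (G : {ffun {set V} -> nat} -> R) M : R :=
  if k is k'.+1 then
    \sum_(e : {set V} | (#|e| == q.+1) && (x \in e)) \sum_(x' in e :\ x)
       walk_sum k' x' y G (incr_mult M e)
  else (x == y)%:R * G M.

Definition mult_supp M : {set {set V}} := [set e | M e != 0%N].
Definition mult_single M : {set {set V}} := [set e | M e == 1%N].

Lemma walk_sum_ext k x y G G' M : G =1 G' -> walk_sum k x y G M = walk_sum k x y G' M.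
Proof.
move=> GG'; elim: k x M => [|k IH] x M /=; first by rewrite GG'.
by apply: eq_bigr => e _; apply: eq_bigr => x' _; exact: IH.
Qed.

Lemma walk_sumZ k x y G M c :
  walk_sum k x y (fun M => c * G M) M = c * walk_sum k x y G M.
Proof.
elim: k x M => [|k IH] x M /=; first by rewrite mulrCA.
rewrite mulr_sumr; apply: eq_bigr => e _; rewrite mulr_sumr.
by apply: eq_bigr => x' _; exact: IH.
Qed.

Lemma walk_sum_sum (I : Type) (r : seq I) k x y (G : I -> {ffun {set V} -> nat} -> R) M :
  walk_sum k x y (fun M => \sum_(i <- r) G i M) M =
  \sum_(i <- r) walk_sum k x y (G i) M.
Proof.
elim: k x M => [|k IH] x M /=; first by rewrite mulr_sumr.
under eq_bigr do under eq_bigr do rewrite IH.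
under eq_bigr do rewrite exchange_big /=.
by rewrite exchange_big.
Qed.

Lemma walk_sumD k x y G G' M :
  walk_sum k x y (fun M => G M + G' M) M = walk_sum k x y G M + walk_sum k x y G' M.
Proof.
elim: k x M => [|k IH] x M /=; first by rewrite mulrDr.
rewrite -big_split /=; apply: eq_bigr => e _; rewrite -big_split /=.
by apply: eq_bigr => x' _; exact: IH.
Qed.

(** Removing [x] identifies these hyperedges with the [q]-subsets of the complement of [U]. *)
Lemma card_fresh_edges U x : x \in U ->
  #|[set e : {set V} | (#|e| == q.+1) && (e :&: U == [set x])]| = 'C(#|V| - #|U|, q).
Proof.
move=> xU; have -> : (#|V| - #|U| = #|~: U|)%N by have := cardsC U; lia.
  rewrite -cards_draws.
rewrite -(@card_in_imset _ _ (fun e => e :\ x) [set e | _ & _]).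
  apply: eq_card => B; rewrite inE; apply/imsetP/andP => [[e]|[BU /eqP cB]].
    rewrite inE => /andP[/eqP ce /eqP eU] ->.
    have xe : x \in e by have := set11 x; rewrite -eU inE => /andP[].
    split; last by have := cardsD1 x e; rewrite xe ce add1n => -[<-].
    apply/subsetP => y; rewrite !inE => /andP[yx ye]; apply: contra yx => yU.
    have : y \in [set x] by rewrite -eU inE ye.
    by rewrite inE.
  have xB : x \notin B by apply/negP => /(subsetP BU); rewrite inE xU.
  exists (x |: B); last by rewrite setU1K.
  rewrite inE cardsU1 xB cB add1n eqxx /=; apply/eqP/setP => y.
  rewrite !inE; case: eqVneq => [->|] //=.
  by move=> _; apply/negP => /andP[/(subsetP BU)]; rewrite inE => /negP.
move=> e e'; rewrite !inE => /andP[_ /eqP eU] /andP[_ /eqP e'U] ee'.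
have xe : x \in e by have := set11 x; rewrite -eU inE => /andP[].
have xe' : x \in e' by have := set11 x; rewrite -e'U inE => /andP[].
by rewrite -(setD1K xe) ee' setD1K.
Qed.

Lemma card_edges_at x :
  #|[set e : {set V} | (#|e| == q.+1) && (x \in e)]| = 'C(#|V|.-1, q).
Proof.
have := card_fresh_edges (set11 x); rewrite cards1 subn1 => <-.
apply: eq_card => e; rewrite !inE; congr (_ && _).
apply/idP/eqP => [xe|]; last by move/setP/(_ x); rewrite !inE eqxx andbT.
by apply/setP => y; rewrite !inE; case: eqVneq => [->|]; rewrite ?andbT ?andbF.
Qed.

Lemma mult_supp_incr M e : mult_supp (incr_mult M e) = e |: mult_supp M.
Proof. by apply/setP => f; rewrite !inE ffunE; case: eqVneq; lia. Qed.

(** * A bound for sums over walks, one step at a time *)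

Section crude_bound.
Variables (s rho K0 : R).
Hypothesis s_gt0 : 0 < s.
Hypothesis rho_gt0 : 0 < rho.
(** Dividing by [rho] at the first use and restoring it at the second makes every step cost about
    [rho]. The penalty is harmless at the end, since a hyperedge left with multiplicity 1 gives
    weight zero. *)
Definition mult_bound M : R := s ^+ #|mult_supp M| / rho ^+ #|mult_single M|.

Lemma mult_bound_gt0 M : 0 < mult_bound M.
Proof. by rewrite divr_gt0 ?exprn_gt0. Qed.

Lemma mult_bound_new M e : M e = 0%N ->
  mult_bound (incr_mult M e) = mult_bound M * (s / rho).
Proof.
move=> Me; rewrite /mult_bound mult_supp_incr cardsU1 inE Me /=.
have -> : mult_single (incr_mult M e) = e |: mult_single M.
  by apply/setP => f; rewrite !inE ffunE; case: (eqVneq f e) => [->|]; lia.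
rewrite cardsU1 inE Me /= !add1n !exprS.
by rewrite mulf_div (mulrC s) (mulrC rho).
Qed.

Lemma mult_bound_single M e : M e = 1%N ->
  mult_bound (incr_mult M e) = mult_bound M * rho.
Proof.
move=> Me; rewrite /mult_bound mult_supp_incr cardsU1 inE Me /= add0n.
have -> : mult_single (incr_mult M e) = mult_single M :\ e.
  by apply/setP => f; rewrite !inE ffunE; case: (eqVneq f e) => [->|]; lia.
rewrite (cardsD1 e (mult_single M)) inE Me eqxx add1n exprS invfM.
by rewrite -mulrA mulrAC mulVf ?gt_eqF// mul1r.
Qed.

Lemma mult_bound_multi M e : (1 < M e)%N ->
  mult_bound (incr_mult M e) = mult_bound M.
Proof.
move=> Me; rewrite /mult_bound mult_supp_incr cardsU1 inE.
have -> : (M e != 0%N) by lia.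
have -> // : mult_single (incr_mult M e) = mult_single M.
by apply/setP => f; rewrite !inE ffunE; case: (eqVneq f e) => [->|]; lia.
Qed.

Hypothesis K0_ge1 : 1 <= K0.
Hypothesis K0_rho : 1 <= K0 * rho.
Hypothesis edges_rho : (q * 'C(#|V|.-1, q))%:R * s <= rho ^+ 2.

(** [K0] is there for the third and later uses, which do not gain the factor [rho], in case [rho] is
    less than 1. *)
Lemma mult_bound_old M e : (0 < M e)%N ->
  mult_bound (incr_mult M e) <= mult_bound M * (K0 * rho).
Proof.
move=> Me; have := mult_bound_gt0 M => b0.
case: (ltnP 1 (M e)) => [/mult_bound_multi ->|Me1].
  by rewrite ler_pMr.
rewrite mult_bound_single; last by lia.
by rewrite ler_pM2l// ler_peMl// ltW.
Qed.

(** [m] counts the hyperedges already used. A step into a new one raises [m]; a step into an old one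
    has at most [m * q] targets, each costing at most [K0 * rho]. The power [rho ^+ k] is factored
    out. *)
Fixpoint walk_const k m : R :=
  if k is k'.+1 then
    walk_const k' m.+1 + (m * q)%:R * K0 * walk_const k' m
  else 1.

Lemma walk_const_ge0 k m : 0 <= walk_const k m.
Proof.
elim: k m => //= k IH m; rewrite addr_ge0 ?IH// !mulr_ge0 ?IH ?ler0n//.
by rewrite (le_trans _ K0_ge1).
Qed.

Lemma card_edge_setD1 e x : #|e| == q.+1 -> x \in e -> #|e :\ x| = q.
Proof. by move=> /eqP ce xe; have := cardsD1 x e; rewrite xe ce add1n => -[]. Qed.

(** [G] is arbitrary, and bounded only on supports that [k] steps can produce, because the second
    moment takes for [G] the error made on another walk. *)
Lemma walk_sum_bound k x y G M (D : R) : 0 <= D ->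
  (forall M', (#|mult_supp M'| <= #|mult_supp M| + k)%N -> `|G M'| <= D * mult_bound M') ->
  `|walk_sum k x y G M| <= D * walk_const k #|mult_supp M| * rho ^+ k * mult_bound M.
Proof.
move=> D0; elim: k x M => [|k IH] x M GD /=.
  rewrite expr0 !mulr1 normrM (le_trans _ (GD M _)) ?addn0//.
  by rewrite normr_nat ler_piMl//; case: (x == y).
rewrite (bigID (fun e => M e == 0%N)) /=.
set m := #|mult_supp M|.
have b0 := ltW (mult_bound_gt0 M); have s0 := ltW s_gt0; have r0 := ltW rho_gt0.
have inn e x' : (#|e| == q.+1) && (x \in e) ->
    `|walk_sum k x' y G (incr_mult M e)| <=
    D * walk_const k #|mult_supp (incr_mult M e)| * rho ^+ k * mult_bound (incr_mult M e).
  move=> _; apply: IH => M' M'le; apply: GD; apply: (leq_trans M'le).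
  by rewrite mult_supp_incr cardsU1; case: (_ \notin _); rewrite /= ?add1n ?add0n ?addSnnS// addnS leqW.
rewrite (le_trans (ler_normD _ _))//.
rewrite mulrDr !mulrDl lerD//.
  apply: (@le_trans _ _ (\sum_(e : {set V} | (#|e| == q.+1) && (x \in e))
     q%:R * (D * walk_const k m.+1 * rho ^+ k * (mult_bound M * (s / rho))))).
    apply: (@le_trans _ _ (\sum_(e : {set V} | (#|e| == q.+1) && (x \in e) && (M e == 0%N))
     q%:R * (D * walk_const k m.+1 * rho ^+ k * (mult_bound M * (s / rho))))).
      rewrite (le_trans (ler_norm_sum _ _ _))//; apply: ler_sum => e /andP[exe /eqP Me].
      rewrite (le_trans (ler_norm_sum _ _ _))//.
      rewrite -[in q%:R](card_edge_setD1 (proj1 (andP exe)) (proj2 (andP exe))).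
      rewrite mulr_natl -sumr_const; apply: ler_sum => x' _.
      rewrite (le_trans (inn _ _ _))// mult_bound_new//.
      by rewrite mult_supp_incr cardsU1 inE Me add1n.
    rewrite big_mkcondr /=; apply: ler_sum => e _; case: ifP => // _.
    by nonneg; exact: walk_const_ge0.
  rewrite sumr_const.
  have -> : #|[pred e : {set V} | (#|e| == q.+1) && (x \in e)]| = 'C(#|V|.-1, q).
    by rewrite -(card_edges_at x); apply: eq_card => e; rewrite !inE.
  rewrite -[leLHS]mulr_natl exprS.
  (* Each step into a new hyperedge weighs [s / rho]; by [edges_rho] all of them together weigh at
     most [rho]. *)
  rewrite [leLHS](_ : _ = D * walk_const k m.+1 * rho ^+ k * mult_bound M *
     (((q * 'C(#|V|.-1, q))%:R * s) / rho)); last first.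
    by rewrite natrM; field; rewrite gt_eqF.
  rewrite [leRHS](_ : _ = D * walk_const k m.+1 * rho ^+ k * mult_bound M * rho); last by ring.
  apply: ler_wpM2l; first by nonneg; exact: walk_const_ge0.
  by rewrite ler_pdivrMr// -expr2.
apply: (@le_trans _ _ (\sum_(e in mult_supp M)
     q%:R * (D * walk_const k m * rho ^+ k * (mult_bound M * (K0 * rho))))).
  apply: (@le_trans _ _ (\sum_(e : {set V} | (#|e| == q.+1) && (x \in e) && (M e != 0%N))
     q%:R * (D * walk_const k m * rho ^+ k * (mult_bound M * (K0 * rho))))).
    rewrite (le_trans (ler_norm_sum _ _ _))//; apply: ler_sum => e /andP[exe Me].
    rewrite (le_trans (ler_norm_sum _ _ _))//.
    rewrite -[in q%:R](card_edge_setD1 (proj1 (andP exe)) (proj2 (andP exe))).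
    rewrite mulr_natl -sumr_const; apply: ler_sum => x' _.
    rewrite (le_trans (inn _ _ _))// mult_supp_incr cardsU1 inE Me add0n.
    apply: ler_wpM2l; last by rewrite mult_bound_old// lt0n.
    by nonneg; exact: walk_const_ge0.
  rewrite [leRHS](eq_bigl (fun e => M e != 0%N)); last by move=> e; rewrite inE.
  rewrite big_mkcondl /=; apply: ler_sum => e _; case: ifP => // _.
  have K0' : 0 <= K0 by rewrite (le_trans _ K0_ge1).
  by nonneg; exact: walk_const_ge0.
rewrite sumr_const -mulr_natl natrM exprS le_eqVlt; apply/orP; left; apply/eqP.
by rewrite /m; ring.
Qed.

End crude_bound.
End hyperwalks.

(** * Explored hypertrees and their embeddings *)

Section hypertree.
Variable q : nat.
Local Notation vtx := (option (nat * 'I_q)).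
Implicit Types (T : seq vtx) (l : nat) (x y v : vtx).

(* A rooted hypertree is the sequence of the parent vertices of its hyperedges:
   [None] is the root and [Some (l, i)] is the [i]-th new vertex of the
   [l]-th hyperedge. *)
Definition hedge T l : seq vtx :=
  nth None T l :: [seq Some (l, i) | i <- enum 'I_q].

Definition is_vtx (m : nat) v := if v is Some (l, _) then (l < m)%N else true.

Definition hypertree T := forall l, (l < size T)%N -> is_vtx l (nth None T l).

Lemma is_vtxS m m' v : (m <= m')%N -> is_vtx m v -> is_vtx m' v.
Proof. by case: v => [[l i]|] //= mm' /leq_trans; exact. Qed.

Lemma mem_hedge T l v : (v \in hedge T l) =
  (v == nth None T l) || (if v is Some (l', _) then l' == l else false).
Proof.
rewrite inE; congr (_ || _); apply/mapP/idP => [[i _ ->] //=|].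
by case: v => [[l' i]|//] /eqP ->; exists i; rewrite // mem_enum.
Qed.

Lemma hedge_vtx T l v : hypertree T -> (l < size T)%N -> v \in hedge T l ->
  is_vtx (size T) v.
Proof.
move=> hT lT; rewrite mem_hedge => /orP[/eqP ->|].
  exact: is_vtxS (ltnW lT) (hT _ lT).
by case: v => [[l' i]|//] /eqP ->.
Qed.

Lemma uniq_hedge T l : hypertree T -> (l < size T)%N -> uniq (hedge T l).
Proof.
move=> hT lT /=; rewrite map_inj_uniq ?enum_uniq ?andbT; last by move=> i j [].
apply/negP => /mapP[i _ E]; have := hT _ lT; rewrite E /=.
by rewrite ltnn.
Qed.

Lemma size_hedge T l : size (hedge T l) = q.+1.
Proof. by rewrite /= size_map size_enum_ord. Qed.

Lemma hedge_rcons T x l : (l < size T)%N -> hedge (rcons T x) l = hedge T l.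
Proof. by move=> lT; rewrite /hedge nth_rcons lT. Qed.

Lemma hypertree_rcons T x : hypertree T -> is_vtx (size T) x -> hypertree (rcons T x).
Proof.
move=> hT hx l; rewrite size_rcons ltnS leq_eqVlt nth_rcons => /orP[/eqP ->|lT].
  by rewrite ltnn eqxx.
by rewrite lT; apply: hT.
Qed.

Section limit_walks.
Variables (R : realFieldType) (eta : R).

(* Limiting contribution of the closed walks that still have [k] steps to make,
   when the hyperedges of [T] have been explored with multiplicities [mu] and
   the walk is at [x]; reusing a hyperedge already used twice costs [eta]. *)
Fixpoint tree_walks (k : nat) T (mu : seq nat) x : R :=
  if k is k'.+1 then
    q%:R^-1 * (\sum_(i < q) tree_walks k' (rcons T x) (rcons mu 1%N) (Some (size T, i)))
    + \sum_(l < size T | x \in hedge T l) \sum_(y <- hedge T l | y != x)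
        eta ^+ (1 < nth 0%N mu l)%N * tree_walks k' T (incr_nth mu l) y
  else ((x == None) && all (leq 2) mu)%:R.

(** Uniformity over all states with [m] hyperedges is what lets the actual proportion of fresh
    hyperedges be replaced by 1 at a cost of order [delta]. *)
Lemma tree_walks_bounded k m : exists2 C : R, 0 <= C &
  forall T mu x, size T = m -> `|tree_walks k T mu x| <= C.
Proof.
elim: k m => [|k IH] m /=.
  by exists 1 => // T mu x _; rewrite normr_nat lern1; case: (_ && _).
have [C1 C10 H1] := IH m.+1; have [C2 C20 H2] := IH m.
have [e0] : exists2 e0 : R, 0 <= e0 & forall b : bool, `|eta ^+ b| <= e0.
  exists (1 + `|eta|) => [|[]]; first by rewrite addr_ge0.
    by rewrite expr1 lerDr.
  by rewrite expr0 normr1 lerDl.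
move=> e00 He.
exists (C1 + (m * q.+1)%:R * (e0 * C2)); first by nonneg.
move=> T mu x sT; apply: (le_trans (ler_normD _ _)); apply: lerD.
  rewrite normrM normfV normr_nat.
  have [q0|q0] := posnP q; first by rewrite {1}q0 invr0 mul0r.
  rewrite mulrC ler_pdivrMr ?ltr0n// mulr_natr.
  rewrite [leRHS](_ : _ = \sum_(i < q) C1); last by rewrite sumr_const card_ord.
  apply: (le_trans (ler_norm_sum _ _ _)); apply: ler_sum => i _.
  by apply: H1; rewrite size_rcons sT.
apply: (le_trans (ler_norm_sum _ _ _)).
rewrite natrM -mulrA -sT.
rewrite [leRHS](_ : _ = \sum_(l < size T) q.+1%:R * (e0 * C2)); last first.
  by rewrite sumr_const card_ord mulr_natl.
rewrite big_mkcond; apply: ler_sum => l _; case: ifP => _; last by nonneg.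
apply: (le_trans (ler_norm_sum _ _ _)).
rewrite [leRHS](_ : _ = \sum_(y <- hedge T l) e0 * C2); last first.
  by rewrite big_const_seq count_predT size_hedge iter_addr_0 mulr_natl.
rewrite big_mkcond; apply: ler_sum => y _; case: ifP => _; last by nonneg.
by rewrite normrM ler_pM// H2.
Qed.
End limit_walks.

Section embedding.
Variables (V : finType) (psi : vtx -> V).

Definition edge_img T l : {set V} := [set u in map psi (hedge T l)].

Definition vtx_img T : {set V} :=
  [set u in psi None :: [seq psi (Some (l, i)) | l <- iota 0 (size T), i <- enum 'I_q]].

Lemma vtx_imgP T u : reflect (exists2 v, is_vtx (size T) v & u = psi v) (u \in vtx_img T).
Proof.
rewrite !inE; apply: (iffP orP) => [[/eqP ->|/allpairsP[[l i] /= [lT _ ->]]]|[[[l i]|] /= lT ->]].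
- by exists None.
- by exists (Some (l, i)) => //=; rewrite mem_iota in lT.
- by right; apply/allpairsP; exists (l, i); rewrite /= mem_iota mem_enum.
- by left.
Qed.

Lemma card_vtx_img T : (#|vtx_img T| <= (size T * q).+1)%N.
Proof.
rewrite cardsE (leq_trans (card_size _))//= size_allpairs size_iota.
by rewrite size_enum_ord.
Qed.

(** [psi] is a total function; its values off the vertices of [T] are arbitrary until [extend]
    overwrites them. *)
Definition embedding T := {in is_vtx (size T) &, injective psi}.

Section embedded.
Variable T : seq vtx.
Hypotheses (q_gt0 : (0 < q)%N) (hT : hypertree T) (psiT : embedding T).

Lemma mem_edge_img l v : (l < size T)%N -> is_vtx (size T) v ->
  (psi v \in edge_img T l) = (v \in hedge T l).
Proof.
move=> lT hv; rewrite inE; apply/mapP/idP => [[w wl /psiT E]|vl]; last by exists v.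
by rewrite E//; exact: hedge_vtx wl.
Qed.

Lemma edge_img_sub l : (l < size T)%N -> edge_img T l \subset vtx_img T.
Proof.
move=> lT; apply/subsetP => u; rewrite inE => /mapP[v vl ->].
by apply/vtx_imgP; exists v => //; exact: hedge_vtx vl.
Qed.

Lemma edge_img_uniq l : (l < size T)%N -> uniq (map psi (hedge T l)).
Proof.
move=> lT; rewrite map_inj_in_uniq ?uniq_hedge// => v w vl wl; apply: psiT.
  exact: hedge_vtx vl.
exact: hedge_vtx wl.
Qed.

Lemma card_edge_img l : (l < size T)%N -> #|edge_img T l| = q.+1.
Proof.
by move=> lT; rewrite cardsE (card_uniqP (edge_img_uniq lT)) size_map size_hedge.
Qed.

(** Every hyperedge has a new vertex since [0 < q]. If two images agreed for different indices, the
    new vertex of either would be the parent vertex of the other, and each index would be smaller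
    than the other. *)
Lemma edge_img_inj l l' : (l < size T)%N -> (l' < size T)%N ->
  edge_img T l = edge_img T l' -> l = l'.
Proof.
move=> lT l'T E; pose i0 : 'I_q := Ordinal q_gt0.
have H l1 l2 : (l1 < size T)%N -> (l2 < size T)%N -> edge_img T l1 = edge_img T l2 ->
    l1 = l2 \/ nth None T l2 = Some (l1, i0).
  move=> l1T l2T E12.
  have : psi (Some (l1, i0)) \in edge_img T l2.
    by rewrite -E12 mem_edge_img// mem_hedge eqxx orbT.
  by rewrite mem_edge_img// mem_hedge => /orP[/eqP <-|/eqP ->]; [right|left].
case: (H _ _ lT l'T E) => // E1; case: (H _ _ l'T lT (esym E)) => // E2.
have := hT l'T; rewrite E1 /= => h1; have := hT lT; rewrite E2 /= => h2.
by move: h1 h2; lia.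
Qed.

Lemma sum_edge_img (R : nmodType) l v (f : V -> R) : (l < size T)%N -> is_vtx (size T) v ->
  \sum_(u in edge_img T l :\ psi v) f u = \sum_(w <- hedge T l | w != v) f (psi w).
Proof.
move=> lT hv; rewrite (eq_bigl (fun u => (u \in edge_img T l) && (u != psi v))); last first.
  by move=> u; rewrite !inE andbC.
rewrite big_mkcondr /= (eq_bigl (fun u => u \in map psi (hedge T l))); last first.
  by move=> u; rewrite inE.
rewrite -big_uniq ?edge_img_uniq// big_map -big_mkcondr /= big_seq_cond [RHS]big_seq_cond.
apply: eq_bigl => w; case: (boolP (w \in _)) => //= wl.
congr negb; apply/eqP/eqP => [/psiT|->//]; apply => //; exact: hedge_vtx wl.
Qed.

Lemma sum_edges_img (R : nmodType) v (f : {set V} -> R) : is_vtx (size T) v ->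
  \sum_(e | e \in [set edge_img T l | l : 'I_(size T) & v \in hedge T l]) f e =
  \sum_(l < size T | v \in hedge T l) f (edge_img T l).
Proof.
move=> hv; rewrite big_imset /=; last first.
  by move=> l l' _ _ E; apply: val_inj; apply: edge_img_inj E.
by apply: eq_bigl => l; rewrite inE.
Qed.

(** [M'] records the hyperedges of another walk, away from the tree; [mu] adds the multiplicities
    inside the tree. *)
Definition tree_mult (M' : {ffun {set V} -> nat}) (mu : seq nat) : {ffun {set V} -> nat} :=
  [ffun e => (M' e + \sum_(l < size T) (e == edge_img T l) * nth 0 mu l)%N].

Lemma tree_mult_edge M' mu l : (l < size T)%N ->
  tree_mult M' mu (edge_img T l) = (M' (edge_img T l) + nth 0 mu l)%N.
Proof.
move=> lT; rewrite ffunE; congr (_ + _)%N.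
rewrite (bigD1 (Ordinal lT)) //= eqxx mul1n big1 ?addn0// => l' l'l.
case: eqVneq => // /edge_img_inj E; case/negP: l'l; apply/eqP/val_inj.
by rewrite /= E.
Qed.

Lemma tree_mult_notin M' mu e : (forall l, (l < size T)%N -> e != edge_img T l) ->
  tree_mult M' mu e = M' e.
Proof.
move=> eT; rewrite ffunE big1 ?addn0// => l _.
by rewrite (negbTE (eT _ _)).
Qed.

Lemma tree_mult_incr M' mu l : (l < size T)%N ->
  incr_mult (tree_mult M' mu) (edge_img T l) = tree_mult M' (incr_nth mu l).
Proof.
move=> lT; apply/ffunP => e; rewrite !ffunE -addnA; congr (_ + _)%N.
rewrite (bigD1 (Ordinal lT)) //= [in RHS](bigD1 (Ordinal lT)) //=.
rewrite nth_incr_nth eqxx addnAC; congr (_ + _)%N.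
  by case: eqVneq => _ /=; lia.
apply: eq_bigr => l' l'l; rewrite nth_incr_nth.
by rewrite (_ : (l == l' :> nat) = false)//; apply/negbTE; rewrite eq_sym.
Qed.

Lemma prod_tree_mult (R : comRingType) (f : nat -> R) (M' : {ffun {set V} -> nat}) (mu : seq nat) : f 0%N = 1 -> size mu = size T ->
  (forall l, (l < size T)%N -> M' (edge_img T l) = 0%N) ->
  \prod_(e : {set V}) f (tree_mult M' mu e) = (\prod_(e : {set V}) f (M' e)) * \prod_(j <- mu) f j.
Proof.
move=> f0 smu M'0.
pose I := [set edge_img T l | l : 'I_(size T)].
rewrite (bigID (mem I)) /= [X in _ = X * _](bigID (mem I)) /= mulrAC; congr (_ * _).
  rewrite [X in _ = X * _]big1 => [|e /imsetP[l _ ->]]; last by rewrite M'0.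
  rewrite mul1r big_imset /=; last first.
    by move=> l l' _ _ E; apply: val_inj; apply: edge_img_inj E.
  rewrite (big_nth 0%N) smu big_mkord; apply: eq_big => // l _.
  by rewrite tree_mult_edge// M'0.
apply: eq_bigr => e eI; congr f; apply: tree_mult_notin => l lT.
by apply: contra eI => /eqP ->; apply/imsetP; exists (Ordinal lT).
Qed.

End embedded.
End embedding.

Section extension.
Variables (V : finType) (psi : vtx -> V) (T : seq vtx) (x : vtx) (e U : {set V}).
Hypotheses (q_gt0 : (0 < q)%N) (hT : hypertree T) (psiT : embedding psi T).
Hypotheses (hx : is_vtx (size T) x) (cardE : #|e| = q.+1).
Hypothesis eU : e :&: (U :|: vtx_img psi T) = [set psi x].

Lemma fresh_mem : psi x \in e.
Proof. by have := set11 (psi x); rewrite -eU inE => /andP[]. Qed.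

(** The new vertices are labelled in the enumeration order of [e :\ psi x], so that a fresh
    hyperedge has exactly one extension and the sum over its vertices becomes a sum over ['I_q]. *)
Definition extend (v : vtx) : V :=
  if v is Some (l, i) then
    if l == size T then nth (psi x) (enum (e :\ psi x)) i else psi v
  else psi v.

Lemma size_new_vtx : size (enum (e :\ psi x)) = q.
Proof. rewrite -fintype.cardE; by have := cardsD1 (psi x) e; rewrite fresh_mem cardE add1n => -[]. Qed.

Lemma extend_new i : extend (Some (size T, i)) = nth (psi x) (enum (e :\ psi x)) i.
Proof. by rewrite /= eqxx. Qed.

Lemma extend_old v : is_vtx (size T) v -> extend v = psi v.
Proof. by case: v => [[l i]|] //= lT; rewrite ltn_eqF. Qed.

Lemma extend_new_mem i : extend (Some (size T, i)) \in e :\ psi x.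
Proof. by rewrite extend_new -mem_enum mem_nth ?size_new_vtx. Qed.

Lemma new_vtx_fresh u : u \in e :\ psi x -> u \notin U :|: vtx_img psi T.
Proof.
rewrite !inE => /andP[ux ue]; apply/negP => uU; case/negP: ux.
by rewrite -in_set1 -eU !inE ue.
Qed.

Lemma map_extend_new : [seq extend (Some (size T, i)) | i <- enum 'I_q] = enum (e :\ psi x).
Proof.
apply: (@eq_from_nth _ (psi x)); first by rewrite size_map size_enum_ord size_new_vtx.
rewrite size_map size_enum_ord => i iq.
rewrite (nth_map (Ordinal iq)) ?size_enum_ord// extend_new.
by rewrite nth_enum_ord.
Qed.

Lemma embedding_extend : embedding extend (rcons T x).
Proof.
move=> v w; rewrite /in_mem /= size_rcons => hv hw.
have new v' : is_vtx (size T).+1 v' -> ~~ is_vtx (size T) v' ->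
    exists i, v' = Some (size T, i).
  case: v' => [[l i]|] //=; rewrite ltnS -leqNgt => h1 h2; exists i.
  by congr (Some (_, _)); apply/eqP; rewrite eqn_leq h1 h2.
have oldnew v' i : is_vtx (size T) v' -> extend v' <> extend (Some (size T, i)).
  move=> hv' E; have := new_vtx_fresh (extend_new_mem i).
  rewrite -E extend_old// inE negb_or => /andP[_ /negP]; apply.
  by apply/vtx_imgP; exists v'.
case: (boolP (is_vtx (size T) v)) => [hv'|/(new _ hv)[i ->]];
  case: (boolP (is_vtx (size T) w)) => [hw'|/(new _ hw)[j ->]].
- by rewrite !extend_old//; apply: psiT.
- by move/oldnew => /(_ hv').
- by move/esym/oldnew => /(_ hw').
rewrite !extend_new => /eqP; rewrite nth_uniq ?enum_uniq ?size_new_vtx// => /eqP ij.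
by congr (Some (_, _)); apply: val_inj.
Qed.

Lemma edge_img_extend_old l : (l < size T)%N ->
  edge_img extend (rcons T x) l = edge_img psi T l.
Proof.
move=> lT; rewrite /edge_img hedge_rcons//.
have /eq_in_map -> // : {in hedge T l, extend =1 psi}.
by move=> v vl; apply: extend_old; exact: hedge_vtx vl.
Qed.

Lemma edge_img_extend_new : edge_img extend (rcons T x) (size T) = e.
Proof.
rewrite /edge_img /hedge nth_rcons ltnn eqxx map_cons -map_comp extend_old//.
apply/setP => u; rewrite !inE (_ : [seq _ | _ <- _] = enum (e :\ psi x)).
  by rewrite mem_enum !inE; case: eqVneq => [->|//]; rewrite fresh_mem.
exact: map_extend_new.
Qed.

Lemma vtx_img_extend : vtx_img extend (rcons T x) = e :|: vtx_img psi T.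
Proof.
apply/setP => u; rewrite in_setU; apply/vtx_imgP/orP => [[v]|[ue|/vtx_imgP[v hv ->]]].
- rewrite size_rcons => hv ->; case: (boolP (is_vtx (size T) v)) => hv'.
    by right; rewrite extend_old//; apply/vtx_imgP; exists v.
  left; case: v hv hv' => [[l i]|] //=; rewrite ltnS -leqNgt => h1 h2.
  have -> : l = size T by apply/eqP; rewrite eqn_leq h1 h2.
  by have := extend_new_mem i; rewrite inE => /andP[].
- case: (eqVneq u (psi x)) => [->|ux].
    by exists x; rewrite ?extend_old// size_rcons; exact: is_vtxS hx.
  have : u \in enum (e :\ psi x) by rewrite mem_enum !inE ux.
  rewrite -map_extend_new => /mapP[i _ ->].
  by exists (Some (size T, i)) => //=; rewrite size_rcons.
- by exists v; rewrite ?extend_old// size_rcons; exact: is_vtxS hv.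
Qed.

Lemma far_extend : [disjoint U & vtx_img psi T] -> [disjoint U & vtx_img extend (rcons T x)].
Proof.
move=> /pred0P dU; apply/pred0P => u; apply/negP => /andP[uU].
have uT : u \notin vtx_img psi T by have := dU u; rewrite /= [u \in U]uU => /negbT.
rewrite [X in is_true X -> _](_ : _ = (u \in vtx_img extend (rcons T x)))//.
rewrite vtx_img_extend in_setU (negbTE uT) orbF => ue.
have [ux|ux] := eqVneq u (psi x).
  by case/negP: uT; apply/vtx_imgP; exists x.
have : u \in e :\ psi x by rewrite !inE ux.
by move/new_vtx_fresh; rewrite in_setU [u \in U]uU.
Qed.

Lemma tree_mult_extend M' mu : size mu = size T ->
  incr_mult (tree_mult psi T M' mu) e = tree_mult extend (rcons T x) M' (rcons mu 1%N).
Proof.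
move=> smu; apply/ffunP => f; rewrite !ffunE -addnA; congr (_ + _)%N.
rewrite -[RHS](big_mkord xpredT (fun l => (f == edge_img extend (rcons T x) l) * nth 0 (rcons mu 1) l)%N).
rewrite size_rcons big_nat_recr //= edge_img_extend_new nth_rcons smu ltnn eqxx muln1.
congr (_ + _)%N; rewrite big_mkord; apply: eq_bigr => l _.
by rewrite edge_img_extend_old// nth_rcons smu ltn_ord.
Qed.

Lemma sum_fresh (R : nmodType) (f : V -> R) :
  \sum_(u in e :\ psi x) f u = \sum_(i < q) f (extend (Some (size T, i))).
Proof. by rewrite -big_enum -map_extend_new big_map big_enum. Qed.

End extension.
End hypertree.

Section weights.
Variables (R : realFieldType) (V : finType) (s rho : R) (kap : nat -> R).
Hypotheses (s_gt0 : 0 < s) (rho_gt0 : 0 < rho).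
Implicit Types M : {ffun {set V} -> nat}.

Definition mult_weight M : R := \prod_(e : {set V}) kap (M e).

Definition mult_factor (j : nat) : R :=
  if j == 0%N then 1 else if j == 1%N then s / rho else s.

Lemma mult_boundE M : mult_bound s rho M = \prod_(e : {set V}) mult_factor (M e).
Proof.
have -> : mult_bound s rho M =
    \prod_(e in mult_supp M) s * \prod_(e in mult_single M) rho^-1.
  by rewrite !prodr_const exprVn.
rewrite big_mkcond [X in _ * X]big_mkcond -big_split /=.
apply: eq_bigr => e _; rewrite /mult_factor !inE.
by case: (M e) => [|[|j]] //=; rewrite ?mulr1.
Qed.

Hypotheses (kap0 : kap 0 = 1) (kap1 : kap 1 = 0).
Hypothesis kap_le : forall j, (1 < j)%N -> `|kap j| <= s.

Lemma mult_weight_le M : `|mult_weight M| <= mult_bound s rho M.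
Proof.
rewrite mult_boundE normr_prod; apply: ler_prod => e _; rewrite normr_ge0 /mult_factor /=.
case: (M e) => [|[|j]] /=; rewrite ?kap0 ?kap1 ?normr1 ?normr0 ?kap_le//.
by rewrite divr_ge0 ?ltW.
Qed.

(** The factors are exchanged one at a time, each with relative error [j%:R * delta], while the
    remaining factors [kap] are dominated by [s]. *)
Lemma prod_kap_approx (delta : R) (mu : seq nat) : 0 <= delta ->
  (forall j, (1 < j)%N -> `|kap j - s| <= j%:R * delta * s) -> all (leq 2) mu ->
  `|\prod_(j <- mu) kap j - \prod_(j <- mu) mult_factor j| <=
  (sumn mu)%:R * delta * \prod_(j <- mu) mult_factor j.
Proof.
move=> d0 Hk; elim: mu => [|j mu IH] /=; first by rewrite !big_nil subrr normr0 !mul0r.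
move=> /andP[j2 mu2]; rewrite !big_cons.
have -> : mult_factor j = s by rewrite /mult_factor; case: j j2 => [|[]].
set a := \prod_(_ <- _) kap _; set b := \prod_(_ <- _) mult_factor _.
have b0 : 0 <= b.
  apply: prodr_ge0 => i _; rewrite /mult_factor; case: ifP => // _.
  by case: ifP => // _; rewrite ?divr_ge0 ?ltW.
have -> : kap j * a - s * b = kap j * (a - b) + (kap j - s) * b by ring.
have -> : (j + sumn mu)%:R * delta * (s * b) =
  s * ((sumn mu)%:R * delta * b) + (j%:R * delta * s) * b by rewrite natrD; ring.
apply: (le_trans (ler_normD _ _)); rewrite !normrM (ger0_norm b0) lerD//.
  by rewrite ler_pM// ?kap_le ?IH.
by rewrite ler_wpM2r// Hk.
Qed.

End weights.

Lemma sumn_incr_nth (mu : seq nat) i : sumn (incr_nth mu i) = (sumn mu).+1.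
Proof.
elim: mu i => [|j mu IH] [|i] //=; last by rewrite IH addnS.
by elim: i.
Qed.

Section walk_const_mono.
Variables (R : realFieldType) (q : nat) (K0 : R).
Hypothesis K0_ge1 : 1 <= K0.

Lemma walk_const_le k m m' : (m <= m')%N -> walk_const q K0 k m <= walk_const q K0 k m'.
Proof.
have K00 : 0 <= K0 by rewrite (le_trans _ K0_ge1).
elim: k m m' => //= k IH m m' mm'; rewrite lerD ?IH// ler_pM//.
- by nonneg.
- exact: walk_const_ge0.
- by rewrite ler_wpM2r// ler_nat leq_mul2r mm' orbT.
- exact: IH.
Qed.
End walk_const_mono.

(** * Comparison of walk sums with the limiting recursion *)

Section main_bound.
Variables (R : realFieldType) (q : nat) (K0 eta : R).
Hypotheses (q_gt0 : (0 < q)%N) (K0_ge1 : 1 <= K0).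
Local Notation vtx := (option (nat * 'I_q)).

(* [eta] is the limit of [1 / rho]; when it vanishes only [kap 2] matters. *)
Record walk_params (V : finType) (s rho delta : R) (kap : nat -> R) (vmax : nat) : Prop := {
  wp_s : 0 < s;
  wp_rho : 0 < rho;
  wp_delta : 0 <= delta;
  wp_K0 : 1 <= K0 * rho;
  wp_edges : (q * 'C(#|V|.-1, q))%:R * s <= rho ^+ 2;
  wp_kap0 : kap 0%N = 1;
  wp_kap1 : kap 1%N = 0;
  wp_kap : forall j, (1 < j)%N -> `|kap j| <= s;
  wp_kap_lim : (eta = 0 /\ kap 2%N = s) \/
    (forall j, (1 < j)%N -> `|kap j - s| <= j%:R * delta * s);
  wp_eta : `|rho^-1 - eta| <= delta;
  wp_fresh : forall v, (v <= vmax)%N ->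
    (1 - delta) * rho ^+ 2 <= (q * 'C(#|V| - v, q))%:R * s }.

Lemma walk_params_le V s rho delta kap v v' : (v <= v')%N ->
  walk_params V s rho delta kap v' -> walk_params V s rho delta kap v.
Proof.
move=> vv' [*]; split=> // w wv; match goal with H : forall v, _ |- _ => apply: H end.
exact: leq_trans vv'.
Qed.

(** The state of a walk at [psi x] that has explored [T]. One [C] serves all [V] and all parameters.
    [u] bounds the trace of the other walk, [S] the total multiplicity, and [(u + (m + k) * q).+1]
    the number of vertices that a fresh hyperedge may have to avoid. If [eta] is 0, multiplicities
    above 2 are excluded, since only [kap 2] is then known precisely. *)
Definition tree_approx k m S u (C : R) : Prop :=
  forall (V : finType) s rho delta kap,
    walk_params V s rho delta kap (u + (m + k) * q).+1 ->
  forall (T : seq vtx) mu x psi (M' : {ffun {set V} -> nat}) (U : {set V}),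
    hypertree T -> size T = m -> size mu = m -> (sumn mu <= S)%N -> all (leq 1) mu ->
    eta != 0 \/ all (geq 2) mu -> is_vtx m x -> embedding psi T ->
    (forall e, M' e != 0%N -> e != set0 /\ e \subset U) ->
    (#|U| <= u)%N -> (#|mult_supp M'| <= u)%N -> [disjoint U & vtx_img psi T] ->
  `|walk_sum q k (psi x) (psi None) (mult_weight kap) (tree_mult psi T M' mu) -
    mult_weight kap M' / mult_bound s rho M' * mult_bound s rho (tree_mult psi T M' mu)
      * rho ^+ k * tree_walks eta k T mu x| <=
  delta * C * rho ^+ k * mult_bound s rho (tree_mult psi T M' mu).

Lemma tree_approx0 m S u : tree_approx 0 m S u S%:R.
Proof.
move=> V s rho delta kap [s0 r0 d0 _ _ k0 k1 k2 klim _ _] T mu x psi M' U hT sT smu sum mu1 mueta hx emb far _ _ dU.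
set M := tree_mult _ _ _ _.
rewrite /= expr0 !mulr1.
have [->|xN] := eqVneq x None; last first.
  have /negbTE -> : psi x != psi None.
    by apply: contra xN => /eqP/emb ->//; rewrite /in_mem /= sT.
  have Mb0 := ltW (mult_bound_gt0 s0 r0 M).
  by rewrite !mul0r mulr0 subrr normr0; nonneg.
have M'T l : (l < size T)%N -> M' (edge_img psi T l) = 0%N.
  move=> lT; apply/eqP/negPn/negP => /far[/set0Pn[w we] /subsetP/(_ _ we) wU].
  have /pred0P/(_ w) := dU; rewrite /= wU /= => /negP; apply.
  exact: (subsetP (edge_img_sub psi hT lT)).
have b0 := mult_bound_gt0 s0 r0 M'.
have -> : mult_bound s rho M = mult_bound s rho M' * \prod_(j <- mu) mult_factor s rho j.
  rewrite /M !mult_boundE//.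
  by apply: (@prod_tree_mult q V psi T) => //; rewrite smu sT.
have -> : mult_weight kap M = mult_weight kap M' * \prod_(j <- mu) kap j.
  by apply: (@prod_tree_mult q V psi T) => //; rewrite smu sT.
rewrite eqxx mul1r mulrA divfK ?gt_eqF//.
set a := \prod_(_ <- _) kap _; set b := \prod_(_ <- _) mult_factor _ _ _.
have bb0 : 0 <= b.
  apply: prodr_ge0 => i _; rewrite /mult_factor; case: ifP => // _.
  by case: ifP => // _; rewrite ?divr_ge0 ?ltW.
(* A hyperedge used once kills both sides: [kap 1] vanishes, and so does the boolean in
   [tree_walks]. *)
case: (boolP (all (leq 2) mu)) => [mu2|/allPn[j jmu]]; last first.
  rewrite -ltnNge ltnS => j1; have j1' : j = 1%N.
    by apply/eqP; rewrite eqn_leq j1; exact: (allP mu1).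
  have -> : a = 0.
    rewrite /a (big_rem j jmu) /= j1' k1 mul0r //.
  by rewrite mulr0 mulr0 subrr normr0; nonneg; exact: ltW.
rewrite mulr1 -mulrBr normrM.
have H : `|a - b| <= S%:R * delta * b.
  (* If [eta] is 0 all multiplicities equal 2 and the two products coincide. *)
  case: klim => [[e0 k2s]|klim].
    have E : a = b.
      rewrite /a /b !big_seq; apply: eq_bigr => j jmu.
      have -> : j = 2%N.
        case: mueta => [|/allP/(_ _ jmu) /= j2]; first by rewrite e0 eqxx.
        by apply/eqP; rewrite eqn_leq j2; exact: (allP mu2).
      by rewrite k2s.
    by rewrite E subrr normr0; nonneg.
  apply: (le_trans (prod_kap_approx s0 r0 k2 d0 klim mu2)).
  by rewrite ler_wpM2r// ler_wpM2r// ler_nat.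
rewrite (_ : _ * (_ * b) = mult_bound s rho M' * (S%:R * delta * b)); last by ring.
by rewrite ler_pM// mult_weight_le.
Qed.

Section step.
Variables (k m S u : nat) (C1 C2 Z1 Z2 : R).
Hypotheses (C1_ge0 : 0 <= C1) (C2_ge0 : 0 <= C2) (Z1_ge0 : 0 <= Z1) (Z2_ge0 : 0 <= Z2).
Hypothesis IH1 : tree_approx k m S.+1 u C1.
Hypothesis IH2 : tree_approx k m.+1 S.+1 u C2.
Hypothesis HZ1 : forall (T : seq vtx) mu x, size T = m -> `|tree_walks eta k T mu x| <= Z1.
Hypothesis HZ2 : forall (T : seq vtx) mu x, size T = m.+1 -> `|tree_walks eta k T mu x| <= Z2.
Let CR := walk_const q K0 k (u + m).+1.

Section fixed.
Variables (V : finType) (s rho delta : R) (kap : nat -> R).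
Hypothesis wp : walk_params V s rho delta kap (u + (m + k.+1) * q).+1.
Variables (T : seq vtx) (mu : seq nat) (x : vtx) (psi : vtx -> V).
Variables (M' : {ffun {set V} -> nat}) (U : {set V}).
Hypotheses (hT : hypertree T) (sT : size T = m) (smu : size mu = m).
Hypotheses (sum : (sumn mu <= S)%N) (mu1 : all (leq 1) mu).
Hypotheses (mueta : eta != 0 \/ all (geq 2) mu) (hx : is_vtx m x).
Hypotheses (emb : embedding psi T).
Hypothesis far : forall e, M' e != 0%N -> e != set0 /\ e \subset U.
Hypotheses (cU : (#|U| <= u)%N) (cM' : (#|mult_supp M'| <= u)%N).
Hypothesis dU : [disjoint U & vtx_img psi T].

Local Notation M := (tree_mult psi T M' mu).
Local Notation Bd := (mult_bound s rho M).
Local Notation r := (mult_weight kap M' / mult_bound s rho M').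

Let s0 := wp_s wp.
Let r0 := wp_rho wp.
Let d0 := wp_delta wp.
Let Bd0 : 0 < Bd. Proof. exact: mult_bound_gt0. Qed.

Lemma ratio_le1 : `|r| <= 1.
Proof.
have b0 := mult_bound_gt0 s0 r0 M'.
rewrite normrM normfV (gtr0_norm b0) ler_pdivrMr// mul1r.
by apply: mult_weight_le => //; case: wp.
Qed.

Lemma far_edge_img l : (l < size T)%N -> M' (edge_img psi T l) = 0%N.
Proof.
move=> lT; apply/eqP/negPn/negP => /far[/set0Pn[w we] /subsetP/(_ _ we) wU].
have /pred0P/(_ w) := dU; rewrite /= wU /= => /negP; apply.
exact: (subsetP (edge_img_sub psi hT lT)).
Qed.

Lemma card_tree_supp : (#|mult_supp M| <= u + m)%N.
Proof.
have sub : mult_supp M \subset mult_supp M' :|: [set edge_img psi T l | l : 'I_(size T)].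
  apply/subsetP => e; rewrite !inE => Me; apply/orP.
  case: (boolP (e \in [set edge_img psi T l | l : 'I_(size T)])) => [|eI]; [by right|left].
  rewrite -(tree_mult_notin M' mu (psi := psi) (T := T)) // => l lT.
  by apply: contra eI => /eqP ->; apply/imsetP; exists (Ordinal lT).
apply: (leq_trans (subset_leq_card sub)); apply: (leq_trans (leq_card_setU _ _)).
apply: leq_add => //; rewrite -sT -[X in (_ <= X)%N](card_ord (size T)).
exact: leq_imset_card.
Qed.

Lemma crude_step y e : `|walk_sum q k y (psi None) (mult_weight kap) (incr_mult M e)|
  <= CR * rho ^+ k * mult_bound s rho (incr_mult M e).
Proof.
have b0 := mult_bound_gt0 s0 r0 (incr_mult M e).
have := @walk_sum_bound R V q s rho K0 s0 r0 K0_ge1 (wp_K0 wp) (wp_edges wp) k y (psi None)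
  (mult_weight kap) (incr_mult M e) 1 ler01.
have H (N : {ffun {set V} -> nat}) : `|mult_weight kap N| <= 1 * mult_bound s rho N.
  by rewrite mul1r; apply: mult_weight_le => //; case: wp.
move=> /(_ (fun N _ => H N)) h; apply: (le_trans h); rewrite mul1r.
rewrite ler_wpM2r ?(ltW b0)// ler_wpM2r ?exprn_ge0 ?(ltW r0)// walk_const_le//.
rewrite mult_supp_incr cardsU1; have := card_tree_supp.
by case: (_ \notin _); rewrite /= ?add1n ?add0n ?ltnS// => /leqW.
Qed.

(** A second use multiplies the potential by [rho], exactly the cost of a step. A later use leaves
    it unchanged, so that relative to [rho] there remains a factor [rho^-1], which is [eta] up to
    [delta]. *)
Lemma tree_step l y : (l < size T)%N -> y \in hedge T l ->
  `|walk_sum q k (psi y) (psi None) (mult_weight kap) (incr_mult M (edge_img psi T l))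
    - r * Bd * rho ^+ k.+1 * (eta ^+ (1 < nth 0%N mu l)%N * tree_walks eta k T (incr_nth mu l) y)|
  <= delta * (K0 * C1 + Z1 + CR) * rho ^+ k.+1 * Bd.
Proof.
move=> lT yl.
have Me : M (edge_img psi T l) = nth 0%N mu l by rewrite tree_mult_edge// far_edge_img.
have mul0 : (0 < nth 0%N mu l)%N by apply: (allP mu1); rewrite mem_nth// smu -sT.
have hy : is_vtx m y by rewrite -sT; exact: hedge_vtx yl.
have K00 : 0 <= K0 by rewrite (le_trans _ K0_ge1).
have CR0 : 0 <= CR by exact: walk_const_ge0.
have lm : (l < size mu)%N by rewrite smu -sT.
have := crude_step (psi y) (edge_img psi T l).
have IHl : eta != 0 \/ all (geq 2) (incr_nth mu l) ->
    `|walk_sum q k (psi y) (psi None) (mult_weight kap) (incr_mult M (edge_img psi T l)) -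
    r * mult_bound s rho (incr_mult M (edge_img psi T l)) * rho ^+ k * tree_walks eta k T (incr_nth mu l) y|
    <= delta * C1 * rho ^+ k * mult_bound s rho (incr_mult M (edge_img psi T l)).
  move=> h; rewrite tree_mult_incr//; apply: (@IH1 V s rho delta kap _ T (incr_nth mu l) y psi M' U) => //.
  - by apply: walk_params_le wp; rewrite ltnS leq_add2l leq_mul2r leq_add2l leqnSn orbT.
  - by rewrite size_incr_nth lm.
  - by rewrite sumn_incr_nth.
  - apply/(all_nthP 0%N) => i; rewrite size_incr_nth lm => ilt; rewrite nth_incr_nth.
    by apply: ltn_addl; apply: (allP mu1); rewrite mem_nth.
have Z1y : `|tree_walks eta k T (incr_nth mu l) y| <= Z1 by exact: HZ1.
move: IHl Z1y.
set w := walk_sum _ _ _ _ _ _; set Z := tree_walks _ _ _ _ _ => IHl Z1y.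
have rk : 0 <= rho ^+ k by rewrite exprn_ge0// ltW.
have r1 := ratio_le1; move: r r1 IHl => r1 r1le IHl.
have Bd0' := ltW Bd0; have r0' := ltW r0.
have [mu2|mule1] := ltnP 1 (nth 0%N mu l).
  rewrite mult_bound_multi ?Me// in IHl *.
  move=> crude; rewrite expr1.
  have rhok : rho ^+ k = rho ^+ k.+1 * rho^-1 by rewrite exprS mulrC mulKf ?gt_eqF.
  (* A third use with [eta] equal to 0 leaves the scope of the induction hypothesis; the crude bound
     suffices, because [rho^-1] is at most [delta]. *)
  have [eta0|eta0] := eqVneq eta 0.
    rewrite eta0 !mul0r mulr0 subr0; apply: (le_trans crude).
    rewrite rhok; have := wp_eta wp; rewrite eta0 subr0 ger0_norm ?invr_ge0// => rd.
    rewrite (_ : CR * _ * _ = CR * rho ^+ k.+1 * Bd * rho^-1); last by ring.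
    rewrite (_ : delta * _ * _ * _ = (K0 * C1 + Z1 + CR) * rho ^+ k.+1 * Bd * delta); last by ring.
    apply: ler_pM; rewrite ?invr_ge0//; first by nonneg.
    rewrite ler_wpM2r// ler_wpM2r ?exprn_ge0// lerDr; nonneg.
  have {}IHl := IHl (or_introl eta0).
  have -> : w - r1 * Bd * rho ^+ k.+1 * (eta * Z) =
     (w - r1 * Bd * rho ^+ k * Z) + r1 * Bd * rho ^+ k.+1 * ((rho^-1 - eta) * Z).
    by rewrite rhok; ring.
  have [bd bdE] : exists b, b = Bd by eexists.
  rewrite -bdE in Bd0' IHl crude *.
  apply: (le_trans (ler_normD _ _)).
  apply: (@le_trans _ _ (delta * C1 * rho ^+ k * bd + 1 * bd * rho ^+ k.+1 * (delta * Z1))).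
    apply: lerD => //; rewrite !normrM.
    rewrite (ger0_norm Bd0') (ger0_norm (exprn_ge0 _ r0')).
    apply: ler_pM; [by nonneg|by nonneg| |].
      by rewrite ler_wpM2r ?exprn_ge0// ler_wpM2r.
    by rewrite ler_pM// (wp_eta wp).
  have h : rho ^+ k <= K0 * rho ^+ k.+1.
    by rewrite exprS mulrA ler_peMl// (wp_K0 wp).
  rewrite -subr_ge0.
  rewrite (_ : _ - _ = delta * C1 * bd * (K0 * rho ^+ k.+1 - rho ^+ k) + delta * CR * rho ^+ k.+1 * bd);
    last by ring.
  by rewrite -subr_ge0 in h; nonneg.
have m1 : nth 0%N mu l = 1%N by apply/eqP; rewrite eqn_leq mule1.
rewrite mult_bound_single ?Me// in IHl *.
move=> _; rewrite expr0 mul1r.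
have {}IHl : `|w - r1 * (Bd * rho) * rho ^+ k * Z| <= delta * C1 * rho ^+ k * (Bd * rho).
  apply: IHl; case: mueta => [|mu2]; [by left|right].
  apply/(all_nthP 0%N) => i; rewrite size_incr_nth lm => ilt; rewrite nth_incr_nth.
  have : (geq 2) (nth 0%N mu i) by apply: (allP mu2); rewrite mem_nth.
  by case: (eqVneq l i) => [<-|_] /=; rewrite ?m1.
rewrite (_ : r1 * Bd * _ * _ = r1 * (Bd * rho) * rho ^+ k * Z); last by rewrite exprS; ring.
apply: (le_trans IHl); rewrite -subr_ge0 exprS.
rewrite (_ : _ - _ = delta * rho * rho ^+ k * Bd * (C1 * (K0 - 1) + Z1 + CR)); last by ring.
have K01 : 0 <= K0 - 1 by rewrite subr_ge0.
by nonneg.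
Qed.

Lemma new_mult0 (e : {set V}) : psi x \in e -> (forall l, (l < size T)%N -> e != edge_img psi T l) ->
  M e = 0%N.
Proof.
move=> xe eT; rewrite tree_mult_notin//; apply/eqP/negPn/negP => /far[_ /subsetP/(_ _ xe) xU].
have /pred0P/(_ (psi x)) := dU; rewrite /= xU /= => /negP; apply.
by apply/vtx_imgP; exists x; rewrite ?sT.
Qed.

(** Hyperedges that meet everything explored, by either walk, at the current vertex only: those that
    keep the explored part a hypertree, apart from the other walk. *)
Let fresh (e : {set V}) := e :&: (U :|: vtx_img psi T) == [set psi x].

Lemma fresh_new (e : {set V}) : #|e| == q.+1 -> fresh e ->
  psi x \in e /\ (forall l, (l < size T)%N -> e != edge_img psi T l).
Proof.
move=> ce /eqP eU; split; first by have := set11 (psi x); rewrite -eU inE => /andP[].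
move=> l lT; apply/eqP => E; have : #|e :&: (U :|: vtx_img psi T)| = #|[set psi x]| by rewrite eU.
rewrite cards1 (setIidPl _); last first.
  by rewrite E (subset_trans (edge_img_sub psi hT lT)) ?subsetUr.
by rewrite (eqP ce) => -[q0]; move: q_gt0; rewrite q0.
Qed.

Local Notation Zsum := (\sum_(i < q) tree_walks eta k (rcons T x) (rcons mu 1%N) (Some (size T, i))).

Lemma fresh_step (e : {set V}) : #|e| == q.+1 -> fresh e ->
  `|\sum_(x' in e :\ psi x) walk_sum q k x' (psi None) (mult_weight kap) (incr_mult M e)
    - r * (Bd * (s / rho)) * rho ^+ k * Zsum| <= q%:R * (delta * C2 * rho ^+ k * (Bd * (s / rho))).
Proof.
move=> ce eU; have [xe eT] := fresh_new ce eU.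
have Me := new_mult0 xe eT.
have ce' := eqP ce; have eU' := eqP eU.
have hx' : is_vtx (size T) x by rewrite sT.
rewrite (sum_fresh ce' eU') mulr_sumr -sumrB.
rewrite -(mult_bound_new s0 r0 Me)//.
apply: (le_trans (ler_norm_sum _ _ _)).
rewrite [leRHS](_ : _ = \sum_(i < q) delta * C2 * rho ^+ k * mult_bound s rho (incr_mult M e));
  last by rewrite sumr_const card_ord mulr_natl.
apply: ler_sum => i _.
rewrite -[psi None]/(extend psi T x e None).
rewrite (@tree_mult_extend q V psi T x e U)// ?smu//.
apply: (@IH2 V s rho delta kap _ (rcons T x) (rcons mu 1%N) _ (extend psi T x e) M' U) => //.
- by apply: walk_params_le wp; rewrite addSnnS.
- exact: hypertree_rcons.
- by rewrite size_rcons sT.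
- by rewrite size_rcons smu.
- by rewrite -cats1 sumn_cat /= addn0 addn1 ltnS.
- by rewrite all_rcons /=.
- by case: mueta => [|mu2]; [left|right; rewrite all_rcons].
- by rewrite /= sT.
- exact: (embedding_extend (U := U)).
- exact: far_extend.
Qed.

(** Meant for hyperedges that close a cycle or touch the other walk: they get the crude estimate and
    are outnumbered by the fresh ones. *)
Lemma bad_step (e : {set V}) : psi x \in e -> #|e| == q.+1 -> (forall l, (l < size T)%N -> e != edge_img psi T l) ->
  `|\sum_(x' in e :\ psi x) walk_sum q k x' (psi None) (mult_weight kap) (incr_mult M e)|
   <= q%:R * (CR * rho ^+ k * (Bd * (s / rho))).
Proof.
move=> xe ce eT; have Me := new_mult0 xe eT.
rewrite -(mult_bound_new s0 r0 Me)// -[in q%:R](card_edge_setD1 ce xe) mulr_natl -sumr_const.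
apply: (le_trans (ler_norm_sum _ _ _)); apply: ler_sum => y _.
exact: crude_step.
Qed.

(** The hyperedges at [psi x] belong to the tree, are fresh or are bad. Measured by total weight and
    divided by [rho ^+ 2], the fresh ones amount to at least [1 - delta] by [wp_fresh], and the
    fresh and bad ones together to at most 1 by [wp_edges]; so the bad ones amount to at most
    [delta]. *)
Lemma tree_approx_fixed :
  `|walk_sum q k.+1 (psi x) (psi None) (mult_weight kap) M
    - r * Bd * rho ^+ k.+1 * tree_walks eta k.+1 T mu x| <=
  delta * ((m * q.+1)%:R * (K0 * C1 + Z1 + CR) + (C2 + Z2 + CR)) * rho ^+ k.+1 * Bd.
Proof.
rewrite /=.
set F := fun e : {set V} => \sum_(x' in e :\ psi x) walk_sum q k x' (psi None) (mult_weight kap) (incr_mult M e).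
rewrite -[X in `|X - _|]/(\sum_(e : {set V} | (#|e| == q.+1) && (psi x \in e)) F e).
have hx' : is_vtx (size T) x by rewrite sT.
pose I := [set edge_img psi T l | l : 'I_(size T) & x \in hedge T l].
rewrite (bigID (mem I)) /= [X in `|_ + X - _|](bigID fresh) /=.
have -> : \sum_(e : {set V} | (#|e| == q.+1) && (psi x \in e) && (e \in I)) F e =
    \sum_(l < size T | x \in hedge T l) \sum_(y <- hedge T l | y != x)
      walk_sum q k (psi y) (psi None) (mult_weight kap) (incr_mult M (edge_img psi T l)).
  transitivity (\sum_(e | e \in I) F e).
    apply: eq_bigl => e; case: (boolP (e \in I)) => [/imsetP[l]|]; rewrite ?andbF ?andbT//.
    rewrite inE => xl ->; rewrite card_edge_img// eqxx mem_edge_img//.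
  rewrite sum_edges_img//; apply: eq_bigr => l xl.
  by rewrite /F sum_edge_img.
set Ft := \sum_(l < _ | _) _; set Ff := \sum_(e | _ && fresh e) _; set Fb := \sum_(e | _ && ~~ fresh e) _.
set Zt := \sum_(l < size T | _) \sum_(y <- _ | _) _.
pose R1 := rho ^+ k.+1 * Bd.
have R10 : 0 <= R1 by rewrite mulr_ge0 ?exprn_ge0 ?ltW.
have Bd0' := ltW Bd0; have r0' := ltW r0; have s0' := ltW s0.
have K00 : 0 <= K0 by rewrite (le_trans _ K0_ge1).
have CR0 : 0 <= CR by exact: walk_const_ge0.
have Ht : `|Ft - r * Bd * rho ^+ k.+1 * Zt| <= (m * q.+1)%:R * (delta * (K0 * C1 + Z1 + CR) * R1).
  rewrite mulr_sumr -sumrB; apply: (le_trans (ler_norm_sum _ _ _)).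
  rewrite natrM -[leRHS]mulrA -sT.
  rewrite [leRHS](_ : _ = \sum_(l < size T) q.+1%:R * (delta * (K0 * C1 + Z1 + CR) * R1)); last first.
    by rewrite sumr_const card_ord mulr_natl.
  rewrite big_mkcond; apply: ler_sum => l _; case: ifP => _; last by nonneg.
  rewrite mulr_sumr -sumrB; apply: (le_trans (ler_norm_sum _ _ _)).
  rewrite [leRHS](_ : _ = \sum_(y <- hedge T l) delta * (K0 * C1 + Z1 + CR) * R1); last first.
    by rewrite big_const_seq count_predT size_hedge iter_addr_0 mulr_natl.
  rewrite big_mkcond big_seq [leRHS]big_seq; apply: ler_sum => y yl; case: ifP => _; last by nonneg.
  by rewrite /R1 [leRHS]mulrA; apply: tree_step.
pose f := 'C(#|V| - #|U :|: vtx_img psi T|, q).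
have fE : #|[set e : {set V} | (#|e| == q.+1) && fresh e]| = f.
  apply: card_fresh_edges; rewrite inE; apply/orP; right.
  by apply/vtx_imgP; exists x.
have FfE : Ff = \sum_(e in [set e : {set V} | (#|e| == q.+1) && fresh e]) F e.
  apply: eq_bigl => e; rewrite inE -!andbA.
  case: (boolP (#|e| == q.+1)) => //= ce; case: (boolP (fresh e)); rewrite ?andbF// => fe.
  have [-> eT] := fresh_new ce fe; rewrite andbT; apply/negP => /imsetP[l _ E].
  by have := eT l (ltn_ord l); rewrite E eqxx.
have Hf : `|Ff - f%:R * (r * (Bd * (s / rho)) * rho ^+ k * Zsum)| <=
    f%:R * (q%:R * (delta * C2 * rho ^+ k * (Bd * (s / rho)))).
  rewrite FfE ![f%:R * _]mulr_natl -fE -!sumr_const -sumrB.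
  apply: (le_trans (ler_norm_sum _ _ _)); apply: ler_sum => e; rewrite inE => /andP[ce fe].
  exact: fresh_step.
pose bad := [set e : {set V} | [&& #|e| == q.+1, psi x \in e, e \notin I & ~~ fresh e]].
have Hb : `|Fb| <= #|bad|%:R * (q%:R * (CR * rho ^+ k * (Bd * (s / rho)))).
  rewrite mulr_natl -sumr_const /Fb (eq_bigl (fun e => e \in bad)); last first.
    by move=> e; rewrite !inE -!andbA.
  apply: (le_trans (ler_norm_sum _ _ _)); apply: ler_sum => e; rewrite inE => /and4P[ce xe eI _].
  apply: bad_step => // l lT; apply: contra eI => /eqP E; apply/imsetP; exists (Ordinal lT) => //.
  by rewrite inE -(mem_edge_img hT emb lT hx') -E.
have cbad : (#|bad| + f <= 'C(#|V|.-1, q))%N.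
  rewrite -fE -(card_edges_at q (psi x)).
  rewrite -cardsUI (_ : _ :&: _ = set0) ?cards0 ?addn0; last first.
    by apply/setP => e; rewrite !inE; case: (fresh e); rewrite ?andbF.
  apply: subset_leq_card; apply/subsetP => e; rewrite !inE => /orP[/and4P[-> ->]//|/andP[ce fe]].
  by rewrite ce; case: (fresh_new ce fe).
have vle : (#|U :|: vtx_img psi T| <= (u + (m + k.+1) * q).+1)%N.
  apply: (leq_trans (leq_card_setU _ _)); rewrite -addnS; apply: leq_add => //.
  apply: (leq_trans (card_vtx_img psi T)); rewrite ltnS sT leq_mul2r leq_addr orbT //.
have Hfresh := wp_fresh wp vle; rewrite -/f in Hfresh.
have Hedge := wp_edges wp.
have Zs : `|q%:R^-1 * Zsum| <= Z2.
  rewrite normrM normfV normr_nat mulrC ler_pdivrMr ?ltr0n// mulr_natr.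
  rewrite [leRHS](_ : _ = \sum_(i < q) Z2); last by rewrite sumr_const card_ord.
  apply: (le_trans (ler_norm_sum _ _ _)); apply: ler_sum => i _.
  by apply: HZ2; rewrite size_rcons sT.
pose phi := q%:R * f%:R * s : R; pose bphi := q%:R * #|bad|%:R * s : R.
have phi1 : (1 - delta) * rho ^+ 2 <= phi by rewrite /phi -natrM.
have phib : bphi + phi <= rho ^+ 2.
  apply: le_trans Hedge; rewrite /bphi /phi -mulrDl ler_wpM2r// -mulrDr -natrD natrM.
  by rewrite ler_wpM2l// ler_nat.
have bphi0 : 0 <= bphi by rewrite /bphi; nonneg.
have phi0 : 0 <= phi by rewrite /phi; nonneg.
have rn0 : rho != 0 by rewrite gt_eqF.
have qn0 : q%:R != 0 :> R by rewrite pnatr_eq0 -lt0n.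
have {}Hf : `|Ff - r * R1 * (q%:R^-1 * Zsum) * (phi / rho ^+ 2)| <= delta * C2 * R1 * (phi / rho ^+ 2).
  move: Hf; rewrite /R1 /phi exprS.
  move: Zsum Bd (rho ^+ k) f%:R r => zz bb rk ff rr.
  rewrite (_ : rr * (rho * rk * bb) * (q%:R^-1 * zz) * (q%:R * ff * s / rho ^+ 2) =
     ff * (rr * (bb * (s / rho)) * rk * zz)); last by field; rewrite rn0 qn0.
  rewrite (_ : delta * C2 * (rho * rk * bb) * (q%:R * ff * s / rho ^+ 2) =
     ff * (q%:R * (delta * C2 * rk * (bb * (s / rho)))))//; by field.
have {}Hb : `|Fb| <= CR * R1 * (bphi / rho ^+ 2).
  move: Hb; rewrite /R1 /bphi exprS.
  move: Bd (rho ^+ k) #|bad|%:R => bb rk ff.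
  rewrite (_ : CR * (rho * rk * bb) * (q%:R * ff * s / rho ^+ 2) =
     ff * (q%:R * (CR * rk * (bb * (s / rho)))))//; by field.
have r20 : 0 < rho ^+ 2 by rewrite exprn_gt0.
have p1 : 1 - delta <= phi / rho ^+ 2 by rewrite ler_pdivlMr.
have p2 : bphi / rho ^+ 2 + phi / rho ^+ 2 <= 1 by rewrite -mulrDl ler_pdivrMr// mul1r.
have p0 : 0 <= phi / rho ^+ 2 by rewrite divr_ge0// ltW.
have pb0 : 0 <= bphi / rho ^+ 2 by rewrite divr_ge0// ltW.
rewrite [leRHS](_ : _ = (m * q.+1)%:R * (delta * (K0 * C1 + Z1 + CR) * R1) +
  (delta * C2 * R1 + R1 * Z2 * delta + CR * R1 * delta)); last by rewrite /R1; ring.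
have r1 := ratio_le1.
have d0' := wp_delta wp.
move: (phi / _) (bphi / _) p1 p2 p0 pb0 Hf Hb => ph bp p1 p2 p0 pb0 Hf Hb.
move: r r1 Hf Ht => r1 r1le Hf Ht.
move: (q%:R^-1 * Zsum) Zs Hf => zz Zs Hf.
(* The term in [ph - 1] is the price of treating every new step as fresh, which is what [tree_walks]
   does. *)
rewrite (_ : _ - _ = (Ft - r1 * Bd * rho ^+ k.+1 * Zt) + ((Ff - r1 * R1 * zz * ph)
  + (r1 * R1 * zz * (ph - 1)) + Fb)); last by rewrite /R1; ring.
clearbody R1.
apply: (le_trans (ler_normD _ _)); apply: lerD => //.
apply: (le_trans (ler_normD _ _)); apply: lerD.
  apply: (le_trans (ler_normD _ _)); apply: lerD.
    apply: (le_trans Hf); rewrite ler_piMr//; [by nonneg|lra].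
  rewrite !normrM (ger0_norm R10).
  apply: ler_pM; [by nonneg|by []| |]; last first.
    by rewrite ler_norml; apply/andP; split; lra.
  by apply: ler_pM => //; [nonneg|rewrite ler_piMl].
apply: (le_trans Hb); rewrite ler_wpM2l//; [by nonneg|lra].
Qed.

End fixed.
End step.

Lemma tree_approx_ex k m S u : exists2 C : R, 0 <= C & tree_approx k m S u C.
Proof.
elim: k m S => [|k IH] m S; first by exists S%:R; [exact: ler0n|exact: tree_approx0].
have [C1 C10 H1] := IH m S.+1; have [C2 C20 H2] := IH m.+1 S.+1.
have [Z1 Z10 HZ1] := tree_walks_bounded q eta k m.
have [Z2 Z20 HZ2] := tree_walks_bounded q eta k m.+1.
have K00 : 0 <= K0 by rewrite (le_trans _ K0_ge1).
exists ((m * q.+1)%:R * (K0 * C1 + Z1 + walk_const q K0 k (u + m).+1)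
  + (C2 + Z2 + walk_const q K0 k (u + m).+1)).
  by nonneg; exact: walk_const_ge0.
move=> V s rho delta kap wp T mu x psi M' U *.
by eapply tree_approx_fixed; eassumption.
Qed.
End main_bound.

Definition uniform_mult (V : finType) (q : nat) (M : {ffun {set V} -> nat}) : bool :=
  [forall e, (M e != 0%N) ==> (#|e| == q.+1)].

Definition mult0 (V : finType) : {ffun {set V} -> nat} := [ffun=> 0%N].

Lemma uniform_mult0 (V : finType) q : uniform_mult q (mult0 V).
Proof. by apply/forallP => e; rewrite ffunE. Qed.

Lemma uniform_mult_incr (V : finType) q (M : {ffun {set V} -> nat}) (e : {set V}) :
  uniform_mult q M -> #|e| == q.+1 -> uniform_mult q (incr_mult M e).
Proof.
move=> /forallP HM ce; apply/forallP => f; rewrite ffunE.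
by case: (eqVneq f e) => [->|_]; [rewrite ce implybT|rewrite addn0; exact: HM].
Qed.

Lemma walk_sum_eq_in (R : realFieldType) (V : finType) q k x y
    (G G' : {ffun {set V} -> nat} -> R) M :
  (forall M, uniform_mult q M -> G M = G' M) -> uniform_mult q M ->
  walk_sum q k x y G M = walk_sum q k x y G' M.
Proof.
move=> GG'; elim: k x M => [|k IH] x M HM /=; first by rewrite GG'.
apply: eq_bigr => e /andP[ce _]; apply: eq_bigr => x' _; apply: IH.
exact: uniform_mult_incr.
Qed.

Lemma mult_bound0 (R : realFieldType) (V : finType) (s rho : R) :
  mult_bound s rho (mult0 V) = 1.
Proof.
rewrite /mult_bound (_ : mult_supp _ = set0); last by apply/setP => e; rewrite !inE ffunE.
rewrite (_ : mult_single _ = set0); last by apply/setP => e; rewrite !inE ffunE.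
by rewrite !cards0 !expr0 divr1.
Qed.

Lemma card_mult_supp0 (V : finType) : #|mult_supp (mult0 V)| = 0%N.
Proof. by apply: eq_card0 => e; rewrite !inE ffunE. Qed.

(** * The first two moments of the trace *)

Section traces.
Variables (R : realFieldType) (q : nat) (K0 eta : R).
Hypotheses (q_gt0 : (0 < q)%N) (K0_ge1 : 1 <= K0).
Local Notation vtx := (option (nat * 'I_q)).

Definition tree_moment k : R := tree_walks eta k ([::] : seq vtx) [::] None.

Lemma closed_walk_approx k u : exists2 C : R, 0 <= C &
  forall (V : finType) s rho delta kap, walk_params q K0 eta V s rho delta kap (u + k * q).+1 ->
  forall x (M : {ffun {set V} -> nat}) (U : {set V}),
    (forall e, M e != 0%N -> e != set0 /\ e \subset U) ->
    (#|U| <= u)%N -> (#|mult_supp M| <= u)%N -> x \notin U ->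
  `|walk_sum q k x x (mult_weight kap) M - mult_weight kap M * rho ^+ k * tree_moment k|
    <= delta * C * rho ^+ k * mult_bound s rho M.
Proof.
have [C C0 HC] := tree_approx_ex eta q_gt0 K0_ge1 k 0 0 u.
exists C => // V s rho delta kap wp x M U far cU cM xU.
(* A constant map embeds the empty hypertree, whose only vertex is the root. *)
pose psi (v : vtx) := x.
have TM : tree_mult psi [::] M [::] = M.
  by apply/ffunP => e; rewrite ffunE big_ord0 addn0.
have := HC V s rho delta kap wp [::] [::] None psi M U.
rewrite TM divfK; last first.
  by rewrite gt_eqF// mult_bound_gt0//; [exact: (wp_s wp)|exact: (wp_rho wp)].
apply=> //; first by right.
- by move=> [[l i]|] [[l' i']|].
- apply/pred0P => y /=; apply/negP => /andP[yU /vtx_imgP[v _ E]].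
  by move: xU; rewrite -/(psi v) -E yU.
Qed.

Lemma trace_approx k : exists2 C : R, 0 <= C &
  forall (V : finType) s rho delta kap, walk_params q K0 eta V s rho delta kap (k * q).+1 ->
  `|\sum_x walk_sum q k x x (mult_weight kap) (mult0 V) - #|V|%:R * rho ^+ k * tree_moment k|
    <= delta * C * #|V|%:R * rho ^+ k.
Proof.
have [C C0 HC] := closed_walk_approx k 0.
exists C => // V s rho delta kap wp.
have W0 : mult_weight kap (mult0 V) = 1.
  by rewrite /mult_weight big1// => e _; rewrite ffunE (wp_kap0 wp).
rewrite -mulrA mulr_natl -sumr_const -sumrB; apply: (le_trans (ler_norm_sum _ _ _)).
rewrite [leRHS](_ : _ = \sum_(x : V) delta * C * rho ^+ k); last first.
  by rewrite sumr_const -[RHS]mulr_natr; ring.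
apply: ler_sum => x _; have := HC V s rho delta kap wp x (mult0 V) set0.
rewrite W0 mul1r mult_bound0 mulr1; apply; rewrite ?cards0 ?card_mult_supp0 ?inE//.
by move=> e; rewrite ffunE.
Qed.

(** After the first walk at most [k * q.+1] vertices are touched. A second walk that starts
    elsewhere decouples, by [closed_walk_approx]; one that starts among them is bounded crudely,
    whence the term linear in [#|V|]. The resulting error, as a function of the multiplicities of
    the first walk, is fed to [walk_sum_bound]. *)
Lemma trace_sqr_approx k : exists2 C : R, 0 <= C &
  forall (V : finType) s rho delta kap,
    walk_params q K0 eta V s rho delta kap (k * q.+1 + k * q).+1 ->
  `|\sum_x \sum_y walk_sum q k x x (walk_sum q k y y (mult_weight kap)) (mult0 V)
     - (#|V|%:R * rho ^+ k * tree_moment k) ^+ 2|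
    <= C * (delta * #|V|%:R ^+ 2 + #|V|%:R) * (rho ^+ k) ^+ 2.
Proof.
have [C1 C10 H1] := closed_walk_approx k (k * q.+1).
have [C2 C20 H2] := trace_approx k.
pose W := walk_const q K0 k k; pose W0 := walk_const q K0 k 0.
have W_ge0 : 0 <= W by exact: walk_const_ge0.
have W0_ge0 : 0 <= W0 by exact: walk_const_ge0.
pose Z := tree_moment k.
pose E := (k * q.+1)%:R * (W + `|Z|) : R.
have E0 : 0 <= E by nonneg.
exists ((C1 + E) * W0 + `|Z| * C2); first by nonneg.
move=> V s rho delta kap wp.
have s0 := wp_s wp; have r0 := wp_rho wp; have d0 := wp_delta wp.
have r0' := ltW r0; have rk0 : 0 <= rho ^+ k by rewrite exprn_ge0.
pose kp := mult_weight kap : {ffun {set V} -> nat} -> R.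
pose n : R := #|V|%:R.
have n0 : 0 <= n by exact: ler0n.
pose G M := \sum_y walk_sum q k y y kp M - n * rho ^+ k * Z * kp M.
(* Walks produce only uniform multiplicities, and only for these is the number of touched vertices
   controlled; elsewhere the value is set to 0. *)
pose G' M := if uniform_mult q M then G M else 0.
pose D := (delta * C1 * n + E) * rho ^+ k.
have D0 : 0 <= D by rewrite /D; nonneg.
have crude y M : (#|mult_supp M| <= k)%N ->
    `|walk_sum q k y y kp M| <= W * rho ^+ k * mult_bound s rho M.
  move=> cM; have b0 := mult_bound_gt0 s0 r0 M.
  have H N : `|kp N| <= 1 * mult_bound s rho N.
    by rewrite mul1r; apply: mult_weight_le => //; case: wp.
  have := @walk_sum_bound R V q s rho K0 s0 r0 K0_ge1 (wp_K0 wp) (wp_edges wp) k y y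
    kp M 1 ler01 (fun N _ => H N).
  move=> h; apply: (le_trans h); rewrite mul1r.
  by rewrite ler_wpM2r ?(ltW b0)// ler_wpM2r// walk_const_le.
have G'le M : (#|mult_supp M| <= #|mult_supp (mult0 V)| + k)%N -> `|G' M| <= D * mult_bound s rho M.
  rewrite card_mult_supp0 add0n => cM; have b0 := ltW (mult_bound_gt0 s0 r0 M).
  rewrite /G'; case: ifP => [/forallP uM|_]; last by rewrite normr0 mulr_ge0.
  pose U := \bigcup_(e in mult_supp M) e.
  have cU : (#|U| <= k * q.+1)%N.
    apply: (leq_trans (leq_card_cover _).1).
    apply: (@leq_trans (\sum_(e in mult_supp M) q.+1)).
      by apply: leq_sum => e; rewrite inE => Me; have := uM e; rewrite Me /= => /eqP ->.
    by rewrite sum_nat_const leq_mul2r cM orbT.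
  have far e : M e != 0%N -> e != set0 /\ e \subset U.
    move=> Me; split; last by apply: bigcup_sup; rewrite inE.
    by have := uM e; rewrite Me /= -card_gt0 => /eqP ->.
  have -> : G M = \sum_y (walk_sum q k y y kp M - kp M * rho ^+ k * Z).
    by rewrite sumrB sumr_const -[X in _ - X]mulr_natl; congr (_ - _); rewrite /n; ring.
  apply: (le_trans (ler_norm_sum _ _ _)).
  rewrite (bigID (fun y => y \in U)) /= addrC.
  rewrite (_ : D * _ = delta * C1 * rho ^+ k * mult_bound s rho M * n +
      E * rho ^+ k * mult_bound s rho M); last by rewrite /D; ring.
  apply: lerD.
    apply: (@le_trans _ _ (\sum_(y : V) delta * C1 * rho ^+ k * mult_bound s rho M)).
      rewrite big_mkcond; apply: ler_sum => y _; case: ifP => [yU|_]; last by nonneg.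
      apply: (H1 V s rho delta kap wp y M U) => //.
      by apply: (leq_trans cM); rewrite leq_pmulr.
    by rewrite sumr_const -[leLHS]mulr_natr.
  apply: (@le_trans _ _ (\sum_(y in U) (W + `|Z|) * rho ^+ k * mult_bound s rho M)).
    apply: ler_sum => y _; apply: (le_trans (ler_normB _ _)); rewrite !mulrDl lerD ?crude//.
    rewrite !normrM (ger0_norm rk0).
    rewrite (_ : `|kp M| * _ * _ = `|Z| * rho ^+ k * `|kp M|); last by ring.
    rewrite ler_wpM2l//; first by nonneg.
    by apply: mult_weight_le => //; case: wp.
  rewrite sumr_const -[leLHS]mulr_natl /E -!mulrA ler_wpM2r//; last by rewrite ler_nat.
  by nonneg.
have step x : `|\sum_y walk_sum q k x x (walk_sum q k y y kp) (mult0 V)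
    - n * rho ^+ k * Z * walk_sum q k x x kp (mult0 V)| <= D * W0 * rho ^+ k.
  rewrite -walk_sum_sum -walk_sumZ.
  have -> (a b : R) : a - b = a + (-1) * b by ring.
  rewrite -walk_sumZ -walk_sumD (@walk_sum_eq_in R V q k x x _ G' (mult0 V)); last exact: uniform_mult0.
    have := @walk_sum_bound R V q s rho K0 s0 r0 K0_ge1 (wp_K0 wp) (wp_edges wp) k x x
      G' (mult0 V) D D0 G'le.
    by rewrite mult_bound0 mulr1 card_mult_supp0.
  by move=> M uM; rewrite /G' uM /G mulN1r.
have wp' : walk_params q K0 eta V s rho delta kap (k * q).+1.
  by apply: walk_params_le wp; rewrite ltnS leq_addl.
have H2' := H2 V s rho delta kap wp'.
rewrite -/n -/Z -/kp in H2' *.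
set S1 := \sum_x _ in H2'; set S2 := \sum_x _.
have -> : S2 - (n * rho ^+ k * Z) ^+ 2 = (S2 - n * rho ^+ k * Z * S1) +
   n * rho ^+ k * Z * (S1 - n * rho ^+ k * Z) by ring.
have H3 : `|S2 - n * rho ^+ k * Z * S1| <= D * W0 * rho ^+ k * n.
  rewrite /S2 /S1 mulr_sumr -sumrB; apply: (le_trans (ler_norm_sum _ _ _)).
  apply: (@le_trans _ _ (\sum_(x : V) D * W0 * rho ^+ k)); first by apply: ler_sum => x _; exact: step.
  by rewrite sumr_const -[leLHS]mulr_natr.
apply: (le_trans (ler_normD _ _)).
apply: (@le_trans _ _ (D * W0 * rho ^+ k * n + n * rho ^+ k * `|Z| * (delta * C2 * n * rho ^+ k))).
  apply: lerD => //; rewrite normrM; apply: ler_pM => //.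
  by rewrite !normrM (ger0_norm rk0) (ger0_norm n0).
rewrite -subr_ge0 /D.
rewrite (_ : _ - _ = (rho ^+ k) ^+ 2 * (C1 * W0 * n + E * W0 * (delta * n ^+ 2) + `|Z| * C2 * n)); last by ring.
by nonneg.
Qed.
End traces.

(** * Averages over the random hypergraph *)

Section hypergraph_law.
Variables (R : realFieldType) (V : finType) (q : nat) (alpha : R).
Implicit Types (e : {set V}) (h : {set {set V}}) (M : {ffun {set V} -> nat}).

(** Independence is stated through inclusion probabilities, since centred monomials are combinations
    of the events that a given set of hyperedges is present. *)
Record hypergraph_law (pr : {set {set V}} -> R) : Prop := {
  law_ge0 : forall h, 0 <= pr h;
  law_uniform : forall h e, pr h != 0 -> e \in h -> #|e| = q.+1;
  law_indep : forall S : {set {set V}}, (forall e, e \in S -> #|e| = q.+1) ->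
    \sum_(h : {set {set V}} | S \subset h) pr h = alpha ^+ #|S| }.

Definition law_mean (pr g : {set {set V}} -> R) : R := \sum_h pr h * g h.

Definition centred h e : R := (e \in h)%:R - alpha.

Definition central_moment (j : nat) : R :=
  alpha * (1 - alpha) ^+ j + (1 - alpha) * (- alpha) ^+ j.

Definition centred_mono h M : R := \prod_(e : {set V}) centred h e ^+ M e.

Section mean.
Variable pr : {set {set V}} -> R.
Hypothesis prl : hypergraph_law pr.

Lemma law_total : \sum_h pr h = 1.
Proof.
have := law_indep prl (S := set0); rewrite cards0 expr0 => <-.
  by apply: eq_bigl => h; rewrite sub0set.
by move=> e; rewrite inE.
Qed.

Lemma law_meanZ c g : law_mean pr (fun h => c * g h) = c * law_mean pr g.
Proof. by rewrite /law_mean mulr_sumr; apply: eq_bigr => h _; rewrite mulrCA. Qed.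

Lemma law_mean_sum (I : Type) (r : seq I) (P : pred I) (g : I -> {set {set V}} -> R) :
  law_mean pr (fun h => \sum_(i <- r | P i) g i h) = \sum_(i <- r | P i) law_mean pr (g i).
Proof.
rewrite /law_mean exchange_big /=; apply: eq_bigr => h _.
by rewrite mulr_sumr.
Qed.

Lemma law_mean_ext f g : (forall h, pr h != 0 -> f h = g h) -> law_mean pr f = law_mean pr g.
Proof.
move=> fg; apply: eq_bigr => h _; have [->|/fg ->//] := eqVneq (pr h) 0.
by rewrite !mul0r.
Qed.

Lemma law_mean_walk_sum k x y (G : {set {set V}} -> {ffun {set V} -> nat} -> R) M :
  law_mean pr (fun h => walk_sum q k x y (G h) M) =
  walk_sum q k x y (fun M => law_mean pr (G^~ M)) M.
Proof.
elim: k x M => [|k IH] x M /=; first exact: law_meanZ.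
rewrite law_mean_sum; apply: eq_bigr => e _.
by rewrite law_mean_sum; apply: eq_bigr => x' _; exact: IH.
Qed.

(* The powers of an indicator minus its mean are affine in the indicator, so the
   monomial expands over the sets of hyperedges required to be present. *)
Lemma law_mean_mono M : uniform_mult q M ->
  law_mean pr (centred_mono^~ M) = mult_weight central_moment M.
Proof.
move=> /forallP uM.
pose a e := (- alpha) ^+ M e; pose b e := (1 - alpha) ^+ M e - (- alpha) ^+ M e.
have E h e : centred h e ^+ M e = b e * (e \in h)%:R + a e.
  rewrite /centred /a /b; case: (e \in h); rewrite ?mulr1 ?mulr0 ?add0r ?sub0r//.
  by rewrite subrK.
pose c (S : {set {set V}}) := \prod_(e : {set V}) (if e \in S then b e else a e).
have factor (f : {set V} -> R) (S : {set {set V}}) :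
    \prod_e (if e \in S then b e * f e else a e) = c S * \prod_(e in S) f e.
  rewrite [X in _ = _ * X]big_mkcond -big_split /=; apply: eq_bigr => e _.
  by case: ifP; rewrite ?mulr1.
have prodb (h S : {set {set V}}) : \prod_(e in S) (e \in h)%:R = (S \subset h)%:R :> R.
  have [/subsetP Sh|/subsetPn[e eS eh]] := boolP (S \subset h).
    by rewrite big1// => e /Sh ->.
  by rewrite (bigD1 e)//= (negbTE eh) mul0r.
transitivity (\sum_(S : {set {set V}}) c S * law_mean pr (fun h => (S \subset h)%:R)).
  under [RHS]eq_bigr => S _ do rewrite -law_meanZ.
  rewrite -law_mean_sum; apply: eq_bigr => h _; congr (_ * _).
  rewrite /centred_mono; under eq_bigr do rewrite E.
  by rewrite bigA_distr; apply: eq_bigr => S _; rewrite factor prodb.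
rewrite /mult_weight.
have -> : \prod_e central_moment (M e) = \prod_e (b e * alpha + a e).
  by apply: eq_bigr => e _; rewrite /central_moment /a /b;
    move: (_ ^+ _) ((- alpha) ^+ _) => u v; ring.
rewrite bigA_distr; apply: eq_bigr => S _; rewrite factor prodr_const.
have [uS|/forallPn[e]] := boolP [forall e, (e \in S) ==> (#|e| == q.+1)].
  congr (_ * _); rewrite -(law_indep prl); last first.
    by move=> e eS; have := forallP uS e; rewrite eS => /eqP.
  rewrite /law_mean [RHS]big_mkcond; apply: eq_bigr => h _.
  by case: ifP; rewrite ?mulr1 ?mulr0.
rewrite negb_imply => /andP[eS eu]; suff -> : c S = 0 by rewrite !mul0r.
rewrite /c (bigD1 e)//= eS /b.
have := uM e; rewrite (negbTE eu) implybF negbK => /eqP ->.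
by rewrite !expr0 subrr mul0r.
Qed.

End mean.

(** An explicit model of the law, from which the limit measures are built before any random
    hypergraph is given. *)
Definition product_law h : R :=
  \prod_(e : {set V}) (if e \in h then (if #|e| == q.+1 then alpha else 0)
                       else (if #|e| == q.+1 then 1 - alpha else 1)).

Lemma product_law_law : 0 <= alpha <= 1 -> hypergraph_law product_law.
Proof.
move=> /andP[a0 a1]; split.
- move=> h; apply: prodr_ge0 => e _.
  by case: ifP => _; case: ifP => _ //; rewrite subr_ge0.
- move=> h e prh eh; apply/eqP; apply: contraNT prh => ce.
  by rewrite /product_law (bigD1 e)//= eh (negbTE ce) mul0r.
- move=> S uS.
  (* The condition that [S] is contained in [h] is moved into the factors: a hyperedge of [S] absent
     from [h] contributes 0. The sum over [h] then factorises. *)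
  transitivity (\sum_(h : {set {set V}}) \prod_(e : {set V}) (if e \in h then
      (if #|e| == q.+1 then alpha else 0)
    else ((e \notin S)%:R * (if #|e| == q.+1 then 1 - alpha else 1)))).
    rewrite big_mkcond; apply: eq_bigr => h _; case: ifP => [/subsetP Sh|/negbT/subsetPn[e eS eh]].
      apply: eq_bigr => e _; case: ifP => // /negbT eh.
      suff -> : e \notin S by rewrite mul1r.
      by apply: contra eh; exact: Sh.
    by rewrite (bigD1 e)//= (negbTE eh) eS !mul0r.
  rewrite -bigA_distr -prodr_const [RHS]big_mkcond; apply: eq_bigr => e _ /=.
  case: (boolP (e \in S)) => eS /=; first by rewrite mul0r addr0 uS// eqxx.
  by rewrite mul1r; case: ifP => _; [rewrite addrC subrK|rewrite add0r].
Qed.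

End hypergraph_law.

Section matrices.
Variables (R : realFieldType) (n q : nat) (alpha : R).
Local Notation V := 'I_n.+2.
Implicit Types (h : {set {set V}}) (M : {ffun {set V} -> nat}).

Definition centred_adjacency h : 'M[R]_n.+2 :=
  \matrix_(x, y) ((x != y)%:R * \sum_(e : {set V} | [&& #|e| == q.+1, x \in e & y \in e])
    centred alpha h e).

Lemma centred_mono_incr h M e :
  centred_mono alpha h (incr_mult M e) = centred_mono alpha h M * centred alpha h e.
Proof.
rewrite /centred_mono (bigD1 e)//= [in RHS](bigD1 e)//= ffunE eqxx exprD expr1.
rewrite mulrAC; congr (_ * _ * _); apply: eq_bigr => f fe.
by rewrite ffunE (negbTE fe) addn0.
Qed.

Lemma centred_mono0 h : centred_mono alpha h (mult0 V) = 1.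
Proof. by rewrite /centred_mono big1// => e _; rewrite ffunE. Qed.

(** The monomial in front absorbs each step into [M], which closes the induction and later lets a
    second walk continue from the hyperedges of the first. *)
Lemma centred_adjacency_walk h M k x y :
  centred_mono alpha h M * (centred_adjacency h ^+ k) x y =
  walk_sum q k x y (centred_mono alpha h) M.
Proof.
elim: k x M => [|k IH] x M /=; first by rewrite expr0 mxE mulrC mulr_natl.
rewrite exprS mxE.
under [RHS]eq_bigr => e _ do under eq_bigr => x' _ do rewrite -IH centred_mono_incr -mulrA.
under [RHS]eq_bigr => e _ do rewrite -mulr_sumr.
rewrite -mulr_sumr; congr (_ * _).
under eq_bigr => x' _ do rewrite [X in X * _]mxE -mulrA mulr_suml mulr_sumr.
under [RHS]eq_bigr => e _ do rewrite big_mkcond.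
rewrite [RHS]exchange_big /=; apply: eq_bigr => x' _.
rewrite [RHS]big_mkcond [LHS]big_mkcond; apply: eq_bigr => e _.
rewrite !inE [x' == x]eq_sym; case: (#|e| == q.+1) => //=; case: (x \in e) => //=.
by case: (x' \in e); rewrite ?andbT ?andbF//; case: (x != x'); rewrite /= ?mul1r ?mul0r ?mulr0.
Qed.

Section mean.
Variable pr : {set {set V}} -> R.
Hypothesis prl : hypergraph_law q alpha pr.

Lemma law_mean_walk k x y M : uniform_mult q M ->
  walk_sum q k x y (fun M => law_mean pr (centred_mono alpha ^~ M)) M =
  walk_sum q k x y (mult_weight (central_moment alpha)) M.
Proof. by move=> uM; apply: walk_sum_eq_in => // M' uM'; exact: (law_mean_mono prl). Qed.

Lemma law_mean_trace k :
  law_mean pr (fun h => \tr (centred_adjacency h ^+ k)) =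
  \sum_x walk_sum q k x x (mult_weight (central_moment alpha)) (mult0 V).
Proof.
rewrite law_mean_sum; apply: eq_bigr => x _.
rewrite -law_mean_walk ?uniform_mult0// -law_mean_walk_sum.
by apply: law_mean_ext => h _; rewrite -centred_adjacency_walk centred_mono0 mul1r.
Qed.

Lemma law_mean_trace_sqr k :
  law_mean pr (fun h => (\tr (centred_adjacency h ^+ k)) ^+ 2) =
  \sum_x \sum_y walk_sum q k x x (walk_sum q k y y (mult_weight (central_moment alpha))) (mult0 V).
Proof.
transitivity (law_mean pr (fun h => \sum_x \sum_y
    (centred_adjacency h ^+ k) x x * (centred_adjacency h ^+ k) y y)).
  by apply: law_mean_ext => h _; rewrite expr2 /mxtrace mulr_suml; apply: eq_bigr => x _; rewrite mulr_sumr.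
rewrite law_mean_sum; apply: eq_bigr => x _; rewrite law_mean_sum; apply: eq_bigr => y _.
have -> : walk_sum q k x x (walk_sum q k y y (mult_weight (central_moment alpha))) (mult0 V) =
    walk_sum q k x x (fun M => law_mean pr (fun h => walk_sum q k y y (centred_mono alpha h) M)) (mult0 V).
  apply: walk_sum_eq_in (uniform_mult0 V q) => M uM.
  by rewrite law_mean_walk_sum law_mean_walk.
rewrite -law_mean_walk_sum; apply: law_mean_ext => h _.
rewrite -[X in X * _]mul1r -(centred_mono0 h) centred_adjacency_walk mulrC -walk_sumZ.
by apply: walk_sum_ext => M; rewrite mulrC centred_adjacency_walk.
Qed.

End mean.

Lemma card_edges_at2 (x y : V) : (0 < q)%N -> x != y ->
  #|[set e : {set V} | [&& #|e| == q.+1, x \in e & y \in e]]| = 'C(n, q.-1).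
Proof.
move=> q0 xy; have cn : #|~: [set x; y]| = n.
  by have := cardsC [set x; y]; rewrite cards2 xy card_ord; lia.
rewrite -[X in 'C(X, _)]cn -cards_draws -(@card_in_imset _ _ (fun e => e :\ x :\ y) [set e | _]).
  apply: eq_card => B; rewrite inE; apply/imsetP/andP => [[e]|[BU /eqP cB]].
    rewrite inE => /and3P[/eqP ce xe ye] ->; split.
      by apply/subsetP => z; rewrite !inE negb_or => /and3P[-> -> _].
    have := cardsD1 x e; rewrite xe ce add1n => -[].
    have := cardsD1 y (e :\ x); rewrite !inE ye eq_sym xy => ->.
    by move=> ->; rewrite add1n.
  have xB : x \notin B by apply/negP => /(subsetP BU); rewrite !inE eqxx.
  have yB : y \notin B by apply/negP => /(subsetP BU); rewrite !inE eqxx orbT.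
  exists (x |: (y |: B)); last by rewrite setU1K ?setU1K// !inE negb_or xy.
  rewrite inE !cardsU1 cB !inE negb_or xy xB yB !eqxx orbT /= !add1n prednK//.
  by rewrite eqxx.
move=> e e'; rewrite !inE => /and3P[_ xe ye] /and3P[_ xe' ye'] E.
have y1 : y \in e :\ x by rewrite !inE ye eq_sym xy.
have y2 : y \in e' :\ x by rewrite !inE ye' eq_sym xy.
by rewrite -(setD1K xe) -(setD1K y1) E setD1K// setD1K.
Qed.

Lemma law_mean_edge pr (e : {set V}) : hypergraph_law q alpha pr -> #|e| = q.+1 ->
  law_mean pr (fun h => (e \in h)%:R) = alpha.
Proof.
move=> prl ce; have := law_indep prl (S := [set e]); rewrite cards1 expr1 => <-.
  rewrite /law_mean [RHS]big_mkcond; apply: eq_bigr => h _; rewrite sub1set.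
  by case: (e \in h); rewrite ?mulr1 ?mulr0.
by move=> f; rewrite inE => /eqP ->.
Qed.

(** Cross terms contain a first central moment and vanish; the diagonal ones give a Bernoulli
    variance for each hyperedge through the pair. *)
Lemma law_mean_centred_sqr pr (x y : V) : (0 < q)%N -> hypergraph_law q alpha pr -> x != y ->
  law_mean pr (fun h => (centred_adjacency h x y) ^+ 2) = 'C(n, q.-1)%:R * (alpha * (1 - alpha)).
Proof.
move=> q0 prl xy.
pose E2 := [set e : {set V} | [&& #|e| == q.+1, x \in e & y \in e]].
transitivity (law_mean pr (fun h => \sum_(e in E2) \sum_(f in E2) centred_mono alpha h (incr_mult (incr_mult (mult0 V) e) f))).
  apply: law_mean_ext => h _; rewrite mxE xy mul1r.
  under [X in X ^+ 2]eq_bigl => e do rewrite -[[&& _, _ & _]]/(_) .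
  rewrite (eq_bigl (fun e => e \in E2)); last by move=> e; rewrite inE.
  rewrite expr2 mulr_suml; apply: eq_bigr => e _; rewrite mulr_sumr; apply: eq_bigr => f _.
  by rewrite !centred_mono_incr centred_mono0 mul1r.
rewrite law_mean_sum -(card_edges_at2 q0 xy) mulr_natl -sumr_const; apply: eq_bigr => e eE.
have := eE; rewrite inE => /and3P[ce _ _]; rewrite law_mean_sum.
have uni f : f \in E2 -> uniform_mult q (incr_mult (incr_mult (mult0 V) e) f).
  rewrite inE => /and3P[cf _ _]; apply: uniform_mult_incr => //.
  by apply: uniform_mult_incr => //; exact: uniform_mult0.
rewrite (bigD1 e eE) /= big1 ?addr0; last first.
  move=> f /andP[fE fe]; rewrite (law_mean_mono prl (uni _ fE)) /mult_weight (bigD1 e)//=.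
  by rewrite !ffunE eqxx eq_sym (negbTE fe) /= /central_moment !expr1; ring.
rewrite (law_mean_mono prl (uni _ eE)).
rewrite /mult_weight (bigD1 e)//= big1 ?mulr1.
  by rewrite !ffunE eqxx /central_moment; ring.
by move=> f fe; rewrite !ffunE (negbTE fe) /central_moment !expr0; ring.
Qed.

End matrices.

(** * Ballot paths and Galton-Watson walks *)

(* [ballot k h] counts the nonnegative nearest-neighbour paths of length [k]
   from height [h] to height 0. *)
Fixpoint ballot (k h : nat) : nat :=
  if k is k'.+1 then (ballot k' h.+1 + (if h is h'.+1 then ballot k' h' else 0))%N
  else (h == 0)%N.

Section tree_paths.
Variable q : nat.
Hypothesis q_gt0 : (0 < q)%N.
Local Notation vtx := (option (nat * 'I_q)).
Implicit Types (T : seq vtx) (l : nat) (x y v : vtx).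

(** In [tree_path T v p] the list [p] is the geodesic from [v] to the root, nearest hyperedge first;
    its length is the height of [v]. *)
Inductive tree_path T : vtx -> seq nat -> Prop :=
| tree_path_root : tree_path T None [::]
| tree_path_edge l i p : (l < size T)%N -> tree_path T (nth None T l) p ->
    tree_path T (Some (l, i)) (l :: p).

Lemma tree_path_rcons T x v p : tree_path T v p -> tree_path (rcons T x) v p.
Proof.
elim=> [|l i p' lT _ IH]; first exact: tree_path_root.
by apply: tree_path_edge; rewrite ?size_rcons ?nth_rcons ?lT// leqW.
Qed.

Lemma tree_path_new T x p i : tree_path T x p ->
  tree_path (rcons T x) (Some (size T, i)) (size T :: p).
Proof.
move=> h; apply: tree_path_edge; first by rewrite size_rcons.
by rewrite nth_rcons ltnn eqxx; exact: tree_path_rcons.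
Qed.

(** Indices decrease towards the root, so a vertex older than the hyperedge [l] cannot have it on
    its path. *)
Lemma tree_path_lt T v p l : hypertree T -> tree_path T v p -> l \in p -> is_vtx l v -> False.
Proof.
move=> hT; elim=> [//|l' i p' l'T _ IH]; rewrite inE => /orP[/eqP ->|lp] /=.
  by rewrite ltnn.
move=> l'l; apply: IH => //; apply: is_vtxS (hT _ l'T).
exact: ltnW.
Qed.

Lemma tree_path_vtx T v p l : tree_path T v p -> l \in p -> (l < size T)%N.
Proof. by elim=> [//|l' i p' l'T _ IH]; rewrite inE => /orP[/eqP ->|/IH]. Qed.

(** The cases are the moves down to a child, up to the parent and sideways to a sibling within the
    hyperedge [l]. *)
Lemma tree_path_step T x p l y : hypertree T -> tree_path T x p -> (l < size T)%N ->
  x \in hedge T l -> y \in hedge T l -> y != x ->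
  [\/ exists i, [/\ y = Some (l, i), l \notin p & tree_path T y (l :: p)],
      exists p', [/\ p = l :: p', l \notin p', y = nth None T l & tree_path T y p']
    | exists p', [/\ p = l :: p', l \notin p' & tree_path T y p]].
Proof.
move=> hT xp lT; rewrite !mem_hedge.
have lx v p' : v = nth None T l -> tree_path T v p' -> l \notin p'.
  by move=> E vp; apply/negP => lp; apply: (tree_path_lt hT vp lp); rewrite E; exact: hT.
case/orP => [/eqP xE|].
  move=> + yx; rewrite -xE (negbTE yx) /=; case: y yx => [[l' i] _|//] /eqP ->.
  constructor 1; exists i; split => //; first exact: lx xp.
  by apply: tree_path_edge => //; rewrite -xE.
case: xp => [//|l' i p' l'T xp'] /eqP E; rewrite E in l'T xp' *.
have lp' := lx _ _ erefl xp'.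
case: eqVneq => [-> _ _|_] /=; first by constructor 2; exists p'.
case: y => [[l'' j] /eqP ->|//] _; constructor 3; exists p'; split => //.
exact: tree_path_edge.
Qed.

Section dyck.
Variable R : realFieldType.

(** A hyperedge on the path to the root has to be used again before the walk can return; if it has
    been used twice, the third use costs [eta], here 0. *)
Lemma tree_walks_dead k T mu x p l : hypertree T -> size mu = size T -> is_vtx (size T) x ->
  tree_path T x p -> l \in p -> (1 < nth 0 mu l)%N -> tree_walks (0 : R) k T mu x = 0.
Proof.
elim: k T mu x p => [|k IH] T mu x p hT smu hx xp lp mul /=.
  by case: eqVneq xp => [-> xp|//]; inversion xp as [E1 E2|]; rewrite -E2 in lp.
have lT := tree_path_vtx xp lp.
rewrite big1 ?mulr0 ?add0r => [|i _]; last first.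
  apply: (IH _ _ _ (size T :: p)).
  - exact: hypertree_rcons.
  - by rewrite !size_rcons smu.
  - by rewrite /= size_rcons.
  - exact: tree_path_new.
  - by rewrite inE lp orbT.
  - by rewrite nth_rcons smu lT.
apply: big1 => l0 xl0; rewrite big_seq_cond; apply: big1 => y /andP[yl0 yx].
have [|mul0] := ltnP 1 (nth 0 mu l0); first by rewrite expr1 mul0r.
have l0l : l != l0 :> nat by apply: contraTneq mul => ->; rewrite -leqNgt.
have step p' : tree_path T y p' -> l \in p' -> tree_walks (0 : R) k T (incr_nth mu l0) y = 0.
  move=> yp' lp'; apply: (IH _ _ _ p') => //.
  - by rewrite size_incr_nth smu ltn_ord.
  - exact: hedge_vtx yl0.
  - by rewrite nth_incr_nth; apply: leq_trans mul (leq_addl _ _).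
rewrite mul1r.
have [[i [_ _ yp']]|[p' [pE _ _ yp']]|[p' [_ _ yp']]] :=
  tree_path_step hT xp (ltn_ord l0) xl0 yl0 yx.
- by apply: step yp' _; rewrite inE lp orbT.
- apply: step yp' _; move: lp; rewrite pE inE => /orP[/eqP E|//].
  by rewrite E eqxx in l0l.
- exact: step yp' lp.
Qed.

(** Invariant: the hyperedges on the path to the root have been used once, all others twice. The
    surviving moves open a new hyperedge, at one of [q] vertices averaged by the factor [q^-1], or
    go back to the parent vertex: the height moves by plus or minus 1. *)
Lemma tree_walks_ballot k T mu x p : hypertree T -> size mu = size T -> is_vtx (size T) x ->
  tree_path T x p -> (forall l, (l < size T)%N -> nth 0%N mu l = if l \in p then 1%N else 2%N) ->
  tree_walks (0 : R) k T mu x = (ballot k (size p))%:R.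
Proof.
elim: k T mu x p => [|k IH] T mu x p hT smu hx xp mup /=.
  case: xp mup => [mup|//] /=; congr (_%:R).
  suff -> : all (leq 2) mu by [].
  by apply/(all_nthP 0%N) => i imu; rewrite mup// -smu.
rewrite natrD; congr (_ + _).
  have E i : tree_walks (0 : R) k (rcons T x) (rcons mu 1%N) (Some (size T, i)) =
      (ballot k (size p).+1)%:R.
    rewrite (IH _ _ _ (size T :: p)) ?size_rcons ?smu//.
    - exact: hypertree_rcons.
    - exact: leqnn.
    - exact: tree_path_new.
    - move=> l; rewrite ltnS leq_eqVlt nth_rcons smu inE => /orP[/eqP ->|lT].
        by rewrite ltnn eqxx.
      by rewrite lT mup// (ltn_eqF lT).
  under eq_bigr do rewrite E.
  by rewrite sumr_const card_ord -[X in _ * X]mulr_natl mulKf// pnatr_eq0 -lt0n.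
have term (l : 'I_(size T)) y : x \in hedge T l -> y \in hedge T l -> y != x ->
    (0 : R) ^+ (1 < nth 0%N mu l)%N * tree_walks 0 k T (incr_nth mu l) y =
    if p is l0 :: p' then ((l == l0 :> nat) && (y == nth None T l))%:R * (ballot k (size p'))%:R else 0.
  move=> xl yl yx; rewrite mup//; case: ifP => lp; last first.
    rewrite expr1 mul0r; case: p lp {xp mup} => // l0 p'; rewrite inE => /norP[/negbTE -> _].
    by rewrite mul0r.
  rewrite mul1r.
  have [[i [_ + _]]|[p' [pE lp' yE yp']]|[p' [pE lp' yp']]] := tree_path_step hT xp (ltn_ord l) xl yl yx.
  - by rewrite lp.
  - rewrite pE eqxx yE eqxx mul1r -yE; apply: IH => //.
    + by rewrite size_incr_nth smu ltn_ord.
    + exact: hedge_vtx yl.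
    + move=> l' l'T; rewrite nth_incr_nth mup// pE inE.
      by case: eqVneq => [<-|]; rewrite ?(negbTE lp') //= eq_sym => /negbTE ->.
  (* Sideways move: the hyperedge is now used twice and still separates [y] from the root, so no
     continuation survives. *)
  - have [y' E] : exists i, y = Some (nat_of_ord l, i).
      by rewrite pE in yp'; inversion yp' as [|l1 i p1 h1 h2 E1 E2]; exists i.
    have yN : y != nth None T l.
      by apply/eqP => yE; have := hT _ (ltn_ord l); rewrite -yE E /= ltnn.
    rewrite pE (negbTE yN) andbF mul0r.
    apply: (@tree_walks_dead k T _ y (nat_of_ord l :: p') l) => //.
    + by rewrite size_incr_nth smu ltn_ord.
    + exact: hedge_vtx yl.
    + by rewrite -pE.
    + by rewrite inE eqxx.
    + by rewrite nth_incr_nth eqxx mup// lp.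
under eq_bigr => l xl do rewrite big_seq_cond (eq_bigr _ (fun y h => term l y xl (andP h).1 (andP h).2)).
case: xp term mup => [_ _|l0 i p' l0T xp' _ _] /=; first by rewrite !big1// => l _; rewrite big1.
rewrite (bigD1 (Ordinal l0T)) /=; last by rewrite mem_hedge eqxx orbT.
rewrite [X in _ + X]big1 ?addr0 => [|l /andP[_ ll0]]; last first.
  rewrite big1// => y _; rewrite (_ : (l == l0 :> nat) = false) ?mul0r//.
  by apply: contraNF ll0 => /eqP E; apply/eqP/val_inj.
rewrite -big_seq_cond eqxx /= /hedge big_cons big_map.
have -> : nth None T l0 != Some (l0, i).
  by apply/eqP => E; have := hT _ l0T; rewrite E /= ltnn.
rewrite eqxx mul1r big1 ?addr0// => j _.
rewrite (_ : (_ == _) = false) ?mul0r//; apply/eqP => E.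
by have := hT _ l0T; rewrite -E /= ltnn.
Qed.

Lemma tree_walks0 k : tree_walks (0 : R) k ([::] : seq vtx) [::] None = (ballot k 0)%:R.
Proof. by apply: (@tree_walks_ballot k [::] [::] None [::]) => //; exact: tree_path_root. Qed.

End dyck.

Lemma count1_incr_nth (mu : seq nat) l : (l < size mu)%N ->
  (count_mem 1 (incr_nth mu l) + (nth 0 mu l == 1) = count_mem 1 mu + (nth 0 mu l == 0))%N.
Proof.
elim: mu l => // j mu IH [_|l] /=; last by rewrite ltnS -!addnA => /IH ->.
by rewrite eqSS -!addnA [(count_mem _ _ + _)%N]addnC [in RHS](addnC (count_mem _ _)) addnCA.
Qed.

Section galton_watson_walks.
Variables (R : realFieldType) (lam : R).

(* Expected number of walks of length [k] from [x] to the root in a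
   Galton-Watson hypertree conditioned to contain [T]. *)
Fixpoint gw_walks (k : nat) T x : R :=
  if k is k'.+1 then
    lam * (\sum_(i < q) gw_walks k' (rcons T x) (Some (size T, i)))
    + \sum_(l < size T | x \in hedge T l) \sum_(y <- hedge T l | y != x) gw_walks k' T y
  else (x == None)%:R.

(** With one factor [rho] per step, a new hyperedge costs [q^-1 * rho], that is [lam / rho], and
    adds a hyperedge of multiplicity 1; a second use costs [rho] and removes one; a later use costs
    [rho^-1 * rho]. The discrepancy is therefore always [rho] to the number of hyperedges used
    once. *)
Lemma gw_walksE rho k T mu x p : 0 < rho -> rho ^+ 2 = q%:R * lam ->
  hypertree T -> size mu = size T -> is_vtx (size T) x ->
  tree_path T x p -> all (leq 1) mu ->
  (forall l, (l < size T)%N -> nth 0%N mu l = 1%N -> l \in p) ->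
  tree_walks rho^-1 k T mu x * rho ^+ k = gw_walks k T x * rho ^+ (count_mem 1%N mu).
Proof.
move=> rho0 rho2; have rn0 : rho != 0 by rewrite gt_eqF.
have qn0 : q%:R != 0 :> R by rewrite pnatr_eq0 -lt0n.
elim: k T mu x p => [|k IH] T mu x p hT smu hx xp mu1 mup /=.
  rewrite expr0 mulr1; case: eqVneq xp mup => [-> xp|]; last by rewrite !mul0r.
  inversion xp as [E|] => mup; subst p; rewrite mul1r.
  (* Hyperedges used once lie on the path to the root, which is empty here: the closing condition of
     [tree_walks] holds automatically. *)
  have mu2 : all (leq 2) mu.
    apply/(all_nthP 0%N) => i imu; have := allP mu1 _ (mem_nth 0%N imu).
    rewrite leq_eqVlt => /orP[/eqP/esym/mup|//].
    by rewrite -smu => /(_ imu).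
  rewrite mu2 (count_memPn _) ?expr0//.
  by apply/negP => /(allP mu2).
rewrite mulrDl [RHS]mulrDl; congr (_ + _).
  rewrite exprS mulrACA [X in _ * X]mulr_suml.
  have E i : tree_walks rho^-1 k (rcons T x) (rcons mu 1%N) (Some (size T, i)) * rho ^+ k =
     gw_walks k (rcons T x) (Some (size T, i)) * rho ^+ (count_mem 1%N mu).+1.
    rewrite (IH _ _ _ (size T :: p)).
    - by rewrite -(cats1 mu) count_cat /= addn0 addn1.
    - exact: hypertree_rcons.
    - by rewrite !size_rcons smu.
    - by rewrite /= size_rcons.
    - exact: tree_path_new.
    - by rewrite all_rcons.
    - move=> l; rewrite size_rcons ltnS leq_eqVlt nth_rcons smu inE => /orP[->//|lT].
      by rewrite lT => /mup -> //; rewrite orbT.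
  rewrite (eq_bigr _ (fun i _ => E i)) -mulr_suml exprS.
  have -> : lam = rho ^+ 2 / q%:R by rewrite rho2 mulrC mulKf.
  by move: (\sum_(i < q) _) (rho ^+ count_mem _ _) => S r; field.
rewrite mulr_suml [RHS]mulr_suml; apply: eq_bigr => l xl.
rewrite mulr_suml [RHS]mulr_suml big_seq_cond [RHS]big_seq_cond; apply: eq_bigr => y /andP[yl yx].
have lmu : (l < size mu)%N by rewrite smu.
(* Only the hyperedge just used can leave the path, and its multiplicity is then at least 2. *)
have [p' yp' pp'] : exists2 p', tree_path T y p' & forall l', l' \in p -> l' != l :> nat -> l' \in p'.
  have [[i [_ _ yp']]|[p' [pE _ _ yp']]|[p' [pE _ yp']]] :=
    tree_path_step hT xp (ltn_ord l) xl yl yx.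
  - by exists (nat_of_ord l :: p) => // l' l'p _; rewrite inE l'p orbT.
  - by exists p' => // l'; rewrite pE inE => /orP[->//|].
  - by exists p.
have IHl : tree_walks rho^-1 k T (incr_nth mu l) y * rho ^+ k =
    gw_walks k T y * rho ^+ count_mem 1%N (incr_nth mu l).
  apply: (IH _ _ _ p') => //.
  - by rewrite size_incr_nth lmu.
  - exact: hedge_vtx yl.
  - apply/(all_nthP 0%N) => i; rewrite size_incr_nth lmu => imu; rewrite nth_incr_nth.
    by apply: ltn_addl; apply: (allP mu1); exact: mem_nth.
  - move=> l' l'T; rewrite nth_incr_nth.
    have l'mu : (0 < nth 0 mu l')%N by apply: (allP mu1); rewrite mem_nth ?smu.
    case: eqVneq => [_ |ll' /mup h]; first by move: l'mu; case: (nth 0 mu l').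
    by apply: pp'; [exact: h|rewrite eq_sym].
have cnt := count1_incr_nth lmu.
have mul0 : (0 < nth 0 mu l)%N by apply: (allP mu1); exact: mem_nth.
have [mul2|mul1] := ltnP 1 (nth 0 mu l).
  rewrite expr1 exprS mulrACA mulVf// mul1r IHl.
  by move: cnt; rewrite (gtn_eqF mul2) (gtn_eqF mul0) !addn0 => ->.
have mul : nth 0%N mu l = 1%N by apply/eqP; rewrite eqn_leq mul1.
by move: cnt; rewrite mul /= addn0 => <-; rewrite expr0 mul1r exprS addn1 exprS mulrCA IHl mulrCA.
Qed.

Lemma tree_walks_gw rho k : 0 < rho -> rho ^+ 2 = q%:R * lam ->
  tree_walks rho^-1 k ([::] : seq vtx) [::] None * rho ^+ k = gw_walks k [::] None.
Proof.
move=> r0 r2; rewrite (@gw_walksE rho k [::] [::] None [::]) ?expr0 ?mulr1//.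
exact: tree_path_root.
Qed.

Hypothesis lam_ge0 : 0 <= lam.

Lemma gw_walks_ge0 k T x : 0 <= gw_walks k T x.
Proof.
elim: k T x => [|k IH] T x /=; first exact: ler0n.
by rewrite addr_ge0 ?mulr_ge0 ?sumr_ge0// => l _; exact: sumr_ge0.
Qed.

(** The [k]-th moment of [m] plus a Poisson variable of mean [lam]; for [m = 0] this is the Touchard
    polynomial at [lam]. *)
Fixpoint touchard (k m : nat) : R :=
  if k is k'.+1 then m%:R * touchard k' m + lam * touchard k' m.+1 else 1.

Lemma touchard_ge0 k m : 0 <= touchard k m.
Proof. by elim: k m => //= k IH m; rewrite addr_ge0 ?mulr_ge0. Qed.

(** The geometry is forgotten: a step picks one of the [size T] known hyperedges and one of its
    [q.+1] vertices, or pays [lam] for a new hyperedge and picks one of its [q] new vertices. *)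
Lemma gw_walks_le k T x : gw_walks k T x <= q.+1%:R ^+ k * touchard k (size T).
Proof.
elim: k T x => [|k IH] T x /=; first by rewrite expr0 mulr1 lern1; case: (x == None).
rewrite addrC exprS -mulrA !mulrDr lerD//.
  rewrite [leRHS](_ : _ = \sum_(l < size T) \sum_(y <- hedge T l) q.+1%:R ^+ k * touchard k (size T)); last first.
    under eq_bigr do rewrite big_const_seq count_predT size_hedge iter_addr_0.
    by rewrite sumr_const card_ord -mulrnA -[RHS]mulr_natr mulnC natrM; ring.
  rewrite big_mkcond; apply: ler_sum => l _; case: ifP => _; last first.
    by apply: sumr_ge0 => y _; nonneg; exact: touchard_ge0.
  rewrite big_mkcond; apply: ler_sum => y _; case: ifP => _; first exact: IH.
  by nonneg; exact: touchard_ge0.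
rewrite [leRHS](_ : _ = lam * (q.+1%:R * (q.+1%:R ^+ k * touchard k (size T).+1))); last by ring.
rewrite ler_wpM2l//.
apply: (@le_trans _ _ (\sum_(i < q) q.+1%:R ^+ k * touchard k (size T).+1)).
  by apply: ler_sum => i _; rewrite (le_trans (IH _ _))// size_rcons.
rewrite sumr_const card_ord -[leLHS]mulr_natl ler_wpM2r ?ler_nat//.
by nonneg; exact: touchard_ge0.
Qed.

Lemma gw_walks_back k T l i : (l < size T)%N -> nth None T l = None ->
  gw_walks k T None <= gw_walks k.+1 T (Some (l, i)).
Proof.
move=> lT Tl /=; rewrite -[leLHS]add0r lerD ?mulr_ge0 ?sumr_ge0//.
  by move=> *; exact: gw_walks_ge0.
rewrite (bigD1 (Ordinal lT)) /=; last by rewrite mem_hedge eqxx orbT.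
rewrite {1}/hedge big_cons Tl /= -addrA lerDl addr_ge0//; apply: sumr_ge0 => *.
  exact: gw_walks_ge0.
by apply: sumr_ge0 => *; exact: gw_walks_ge0.
Qed.

(** Each pair of steps enters a hyperedge attached to the root and comes straight back. *)
Lemma gw_walks_star k T : (count_mem None T)%:R ^+ k <= gw_walks k.*2 T None.
Proof.
elim: k => [|k IH]; first by rewrite expr0.
rewrite doubleS exprS; pose i0 : 'I_q := Ordinal q_gt0.
apply: (@le_trans _ _ ((count_mem None T)%:R * gw_walks k.*2 T None)); first by rewrite ler_wpM2l.
rewrite [leRHS]/= -/(gw_walks _.+1) -[leLHS]add0r lerD ?mulr_ge0 ?sumr_ge0//.
  by move=> *; rewrite -/(gw_walks _.+1 _ _) gw_walks_ge0.
have -> : count_mem None T = (\sum_(l < size T) (nth None T l == None))%N.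
  by rewrite -sum1_count (big_nth None) big_mkord big_mkcond; apply: eq_bigr => l _; rewrite /= ; case: (nth None T l == None).
rewrite natr_sum mulr_suml [leRHS]big_mkcond; apply: ler_sum => l _.
case: eqVneq => [Tl|_]; last first.
  rewrite mul0r; case: ifP => // _; apply: sumr_ge0 => *; exact: (gw_walks_ge0 _.+1).
rewrite mem_hedge Tl eqxx mul1r /hedge big_cons Tl eqxx /= big_map.
rewrite (bigD1_seq i0) ?enum_uniq ?mem_enum//=.
rewrite -[leLHS]addr0; apply: lerD; first exact: gw_walks_back.
by apply: sumr_ge0 => *; exact: (gw_walks_ge0 _.+1).
Qed.

Lemma gw_walks_new k T : lam * gw_walks k (rcons T None) None <= gw_walks k.+2 T None.
Proof.
pose i0 : 'I_q := Ordinal q_gt0.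
rewrite [leRHS]/= -/(gw_walks _.+1) -[leLHS]addr0; apply: lerD; last first.
  by apply: sumr_ge0 => *; apply: sumr_ge0 => *; exact: (gw_walks_ge0 _.+1).
rewrite ler_wpM2l// (bigD1 i0)//= -[leLHS]addr0; apply: lerD; last first.
  by apply: sumr_ge0 => *; exact: (gw_walks_ge0 _.+1).
by apply: gw_walks_back; rewrite ?size_rcons// nth_rcons ltnn eqxx.
Qed.

(** The walks kept open [j] hyperedges at the root, at the price [lam ^+ j], and make [k] further
    excursions with [j] choices each. As [j] is free, the growth is faster than any exponential. *)
Lemma gw_walks_lower j k : lam ^+ j * j%:R ^+ k <= gw_walks (j + k).*2 [::] None.
Proof.
have H T i : lam ^+ i * (i + count_mem None T)%:R ^+ k <= gw_walks (i + k).*2 T None.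
  elim: i T => [|i IH] T; first by rewrite expr0 mul1r; exact: gw_walks_star.
  rewrite addSn doubleS; apply: le_trans (gw_walks_new _ _).
  rewrite exprS -mulrA ler_wpM2l//; apply: le_trans (IH _).
  by rewrite -(cats1 T) count_cat /= addn0 addn1 addnS.
by have := H [::] j; rewrite /= addn0.
Qed.

End galton_watson_walks.
End tree_paths.

(** * Real symmetric matrices *)

Section real_spectrum.
Variables (R : rcfType) (n : nat).
Local Notation C := (complex R).

(** The spectral theorem is applied over the complex numbers; hermitian symmetry makes the diagonal
    real, and characteristic polynomial and traces descend to [R]. *)
Lemma real_spectral (A : 'M[R]_n.+1) : A^T = A ->
  exists r : 'rV[R]_n.+1,
    char_poly A = \prod_i ('X - (r 0 i)%:P) /\ forall k, \tr (A ^+ k) = \sum_i r 0 i ^+ k.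
Proof.
move=> symA; pose Ac : 'M[C]_n.+1 := map_mx (real_complex R) A.
have hA : Ac \is hermsymmx.
  apply/is_hermitianmxP; rewrite expr0 scale1r.
  apply/matrixP => i j; rewrite !mxE -{2}symA mxE.
  by rewrite conj_Creal ?Creal_real// complex_real.
have /orthomx_spectralP AE := hermitian_normalmx hA.
have /mxOverP Dreal := hermitian_spectral_diag_real hA.
set P := spectralmx Ac in AE; set D := spectral_diag Ac in AE Dreal.
pose r : 'rV[R]_n.+1 := \row_j complex.Re (D 0 j).
have Dr j : D 0 j = (r 0 j)%:C%C.
  by rewrite mxE RRe_real.
have Pu : P \in unitmx by exact: spectral_unit.
have chA : char_poly Ac = \prod_i ('X - (D 0 i)%:P).
  have -> : char_poly Ac = char_poly (diag_mx D).
    rewrite /char_poly.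
    have -> : char_poly_mx Ac =
        map_mx polyC (invmx P) *m char_poly_mx (diag_mx D) *m map_mx polyC P.
      rewrite /char_poly_mx mulmxBr mulmxBl AE !map_mxM; congr (_ - _).
      by rewrite mul_mx_scalar -scalemxAl -map_mxM mulVmx// map_mx1 scalemx1.
    rewrite !det_mulmx mulrAC -det_mulmx -map_mxM mulVmx// map_mx1 det1 mul1r//.
  rewrite char_poly_trig; last first.
    by apply/is_trig_mxP => i j ij; rewrite mxE; case: eqVneq ij => [->|//]; rewrite ltnn.
  by apply: eq_bigr => i _; rewrite mxE eqxx.
have powA k : Ac ^+ k = invmx P *m diag_mx (\row_j D 0 j ^+ k) *m P.
  elim: k => [|k IH].
    have -> : (\row_j D 0 j ^+ 0) = const_mx 1 by apply/rowP => j; rewrite !mxE expr0.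
    by rewrite diag_const_mx mulmx1 mulVmx.
  rewrite exprSr IH {1}AE !mulmxE -!mulrA; congr (_ * _); rewrite !mulrA; congr (_ * _).
  rewrite -(mulrA _ P) (_ : P * invmx P = 1) ?mulr1; last by rewrite -mulmxE mulmxV.
  rewrite -mulmxE mulmx_diag; congr diag_mx; apply/rowP => j.
  by rewrite !mxE exprSr.
exists r; split => [|k].
  apply: (map_poly_inj (real_complex R)); rewrite map_char_poly chA rmorph_prod.
  by apply: eq_bigr => i _; rewrite rmorphB /= map_polyX map_polyC /= -Dr.
apply: (@complexI R); rewrite -[LHS]/((real_complex R) _).
have -> : real_complex R (\tr (A ^+ k)) = \tr (Ac ^+ k).
  by rewrite -rmorphXn /mxtrace rmorph_sum; apply: eq_bigr => i _; rewrite [in RHS]mxE.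
rewrite powA -mulmxA mxtrace_mulC -mulmxA mulmxV// mulmx1 mxtrace_diag rmorph_sum.
by apply: eq_bigr => i _; rewrite mxE Dr -rmorphXn.
Qed.

Lemma perm_roots_mup (r : seq R) (p : {poly R}) : p = \prod_(x <- r) ('X - x%:P) ->
  perm_eq (flatten [seq nseq (mup x p) x | x <- rootsR p]) r.
Proof.
move=> pE; have p0 : p != 0 by rewrite pE monic_neq0// monic_prod_XsubC.
apply: perm_trans (perm_count_undup r).
rewrite (eq_map (g := fun x => nseq (count_mem x r) x)); last first.
  by move=> x; rewrite pE mu_prod_XsubC.
apply/perm_flatten/perm_map/uniq_perm; rewrite ?undup_uniq ?uniq_roots// => x.
by rewrite mem_undup -(roots_on_rootsR p0) in_itv /= pE root_prod_XsubC.
Qed.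

End real_spectrum.

(** * Polynomial approximation controlled by moments *)

From mathcomp Require Import all_classical all_reals all_analysis.
From mathcomp Require Import measurable_realfun.

Import numFieldNormedType.Exports.

Section weierstrass.
Local Open Scope classical_set_scope.
Local Open Scope ring_scope.
Variable R : realType.
Implicit Types (f g : R -> R) (phi psi : nat -> R).

Lemma continuous_segment_uniform f (a b e : R) : continuous f -> 0 < e ->
  exists2 d : R, 0 < d & forall x y, a <= x <= b -> `|x - y| <= d -> `|f x - f y| <= e.
Proof.
(* Compactness in covering form: a radius that works near each point of the segment can be chosen
   once for all. The second point may lie outside the segment. *)
move=> cf e0; have := @segment_compact R a b; rewrite compact_near_coveringP.
pose P (d x : R) := forall y, `|x - y| <= d -> `|f x - f y| <= e.
move=> /(_ R (at_right 0) P _).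
have H (x : R) : `[a, b]%classic x -> \forall x' \near x & d \near 0^'+, P d x'.
  move=> _; have e20 : 0 < e / 2 by rewrite divr_gt0.
  have /cvgrPdist_le/(_ _ e20)/nbhs_ballP[r /= r0 Hr] := cf x.
  exists (ball x (r / 2), [set d | 0 < d < r / 2]).
    split; first by apply: nbhsx_ballx; rewrite divr_gt0.
    near=> d; rewrite /=; apply/andP; split; first by near: d; exact: nbhs_right_gt.
    by near: d; apply: nbhs_right_lt; rewrite divr_gt0.
  move=> [x' d] /= [xx' /andP[d0 dr]] y yd.
  have xx : ball x r x' by apply: le_ball xx'; rewrite ler_pdivrMr// ler_peMr ?(ltW r0)// ler1n.
  have xy : ball x r y.
    rewrite [r]splitr; apply: ball_triangle xx' _.
    by apply: le_lt_trans yd dr.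
  have -> : f x' - f y = - (f x - f x') + (f x - f y) by ring.
  rewrite (le_trans (ler_normD _ _))// normrN [leRHS]splitr lerD//; exact: Hr.
move=> /(_ H) [d0 /= d00 Hd].
exists (d0 / 2); first by rewrite divr_gt0.
move=> x y xab xy; apply: (Hd (d0 / 2)) => //=.
- by rewrite sub0r normrN gtr0_norm ?divr_gt0// ltr_pdivrMr// ltr_pMr// ltr1n.
- by rewrite divr_gt0.
Unshelve. all: by end_near.
Qed.

(* The Bernstein operator, through its Pascal recursion. *)
Fixpoint bernstein (n : nat) phi : {poly R} :=
  if n is n'.+1 then 'X * bernstein n' (fun k => phi k.+1) + (1 - 'X) * bernstein n' phi
  else (phi 0%N)%:P.

Lemma bernsteinS n phi (u : R) : (bernstein n.+1 phi).[u] =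
  u * (bernstein n (fun k => phi k.+1)).[u] + (1 - u) * (bernstein n phi).[u].
Proof. by rewrite /= !hornerE. Qed.

Lemma bernstein_lin n phi psi (u a b : R) :
  (bernstein n (fun k => a * phi k + b * psi k)).[u] =
  a * (bernstein n phi).[u] + b * (bernstein n psi).[u].
Proof.
elim: n phi psi => [|n IH] phi psi; first by rewrite /= !hornerE.
by rewrite !bernsteinS (IH (fun k => phi k.+1) (fun k => psi k.+1)) IH; ring.
Qed.

Lemma bernstein_cst n (u c : R) : (bernstein n (fun=> c)).[u] = c.
Proof. by elim: n => [|n IH]; [rewrite /= hornerE|rewrite bernsteinS IH; ring]. Qed.

Lemma bernstein_le n phi psi (u : R) : 0 <= u <= 1 ->
  (forall k, (k <= n)%N -> phi k <= psi k) -> (bernstein n phi).[u] <= (bernstein n psi).[u].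
Proof.
move=> /andP[u0 u1]; elim: n phi psi => [|n IH] phi psi H.
  by rewrite /= !hornerE H.
rewrite !bernsteinS lerD// ler_wpM2l ?subr_ge0//.
  by apply: IH => k kn; exact: H.
by apply: IH => k kn; apply: H; exact: leqW.
Qed.

(** The variance of a binomial law; the shift [c] absorbs the change of mean along the Pascal
    recursion. *)
Lemma bernstein_var n (u c : R) :
  (bernstein n (fun k => (k%:R - n%:R * u + c) ^+ 2)).[u] = n%:R * (u * (1 - u)) + c ^+ 2.
Proof.
elim: n c => [|n IH] c; first by rewrite /= hornerE; ring.
rewrite bernsteinS.
have -> : (fun k : nat => (k.+1%:R - n.+1%:R * u + c) ^+ 2) =
    (fun k : nat => (k%:R - n%:R * u + (c + 1 - u)) ^+ 2).
  by apply/funext => k; rewrite -!natr1; ring.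
have -> : (fun k : nat => (k%:R - n.+1%:R * u + c) ^+ 2) =
    (fun k : nat => (k%:R - n%:R * u + (c - u)) ^+ 2).
  by apply/funext => k; rewrite -!natr1; ring.
by rewrite !IH -natr1; ring.
Qed.

(** The operator is monotone and fixes constants, so a modulus of continuity of the form
    [e + C * (u - v) ^+ 2] is averaged through the binomial variance. *)
Lemma bernstein_approx g (e C : R) n : 0 <= C ->
  (forall u v, 0 <= u <= 1 -> 0 <= v <= 1 -> `|g u - g v| <= e + C * (u - v) ^+ 2) ->
  forall u, 0 <= u <= 1 ->
  `|g u - (bernstein n.+1 (fun k => g (k%:R / n.+1%:R))).[u]| <= e + C / n.+1%:R.
Proof.
move=> C0 Hg u u01; have /andP[u0 u1] := u01.
set phi := fun k : nat => _; set N := n.+1.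
have N0 : 0 < N%:R :> R by rewrite ltr0n.
have E (c : R) : c * (g u - (bernstein N phi).[u]) = (bernstein N (fun k => c * (g u - phi k))).[u].
  have -> : (fun k => c * (g u - phi k)) = (fun k => c * g u + (- c) * phi k).
    by apply/funext => k; ring.
  by rewrite (bernstein_lin N (fun=> g u)) bernstein_cst; ring.
have B : (bernstein N (fun k => e + C * (u - k%:R / N%:R) ^+ 2)).[u] <= e + C / N%:R.
  have -> : (fun k : nat => e + C * (u - k%:R / N%:R) ^+ 2) =
      (fun k : nat => 1 * e + (C / N%:R ^+ 2) * (k%:R - N%:R * u + 0) ^+ 2).
    by apply/funext => k; field; rewrite gt_eqF.
  rewrite (bernstein_lin N (fun=> e)) bernstein_cst bernstein_var mul1r lerD2l.
  rewrite [leLHS](_ : _ = C / N%:R * (u * (1 - u))); last by field; rewrite gt_eqF.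
  rewrite ler_piMr ?divr_ge0 ?ler0n// mulr_ile1 ?subr_ge0//.
  by rewrite lerBlDr lerDl.
have kN k : (k <= N)%N -> 0 <= (k%:R / N%:R : R) <= 1.
  by move=> kn; rewrite divr_ge0 ?ler0n//= ler_pdivrMr// mul1r ler_nat.
rewrite ler_norml; apply/andP; split.
  rewrite lerNl -mulN1r E; apply: le_trans B; apply: bernstein_le => // k kn.
  by rewrite mulN1r (le_trans (ler_norm _))// normrN Hg// kN.
rewrite -[leLHS]mul1r E; apply: le_trans B; apply: bernstein_le => // k kn.
by rewrite mul1r (le_trans (ler_norm _))// Hg// kN.
Qed.

Theorem weierstrass f (M e : R) : continuous f -> (forall x, `|f x| <= M) -> 0 < e ->
  exists P : {poly R}, forall y, -1 <= y <= 1 -> `|f y - P.[y]| <= e.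
Proof.
move=> cf fM e0; have e20 : 0 < e / 2 by rewrite divr_gt0.
have [d d0 Hd] := @continuous_segment_uniform f (-1) 1 (e / 2) cf e20.
have M0 : 0 <= M by rewrite (le_trans _ (fM 0)).
(* When [2 * u - 1] and [2 * v - 1] are more than [d] apart, [C * (u - v) ^+ 2] exceeds [2 * M], the
   largest possible variation of [f]. *)
pose C := 8 * M / d ^+ 2.
have C0 : 0 <= C by rewrite /C divr_ge0 ?exprn_ge0 ?mulr_ge0// ltW.
pose g u := f (2 * u - 1).
have Hg u v : 0 <= u <= 1 -> 0 <= v <= 1 -> `|g u - g v| <= e / 2 + C * (u - v) ^+ 2.
  move=> /andP[u0 u1] /andP[v0 v1]; have [uv|uv] := leP `|2 * u - 1 - (2 * v - 1)| d.
    rewrite -[leLHS]addr0; apply: lerD; last by rewrite mulr_ge0// sqr_ge0.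
    by apply: Hd => //; apply/andP; split; lra.
  apply: (@le_trans _ _ (2 * M)).
    by rewrite (le_trans (ler_normB _ _))// mulr_natl mulr2n lerD// fM.
  rewrite -[leLHS]add0r; apply: lerD; first exact: ltW.
  rewrite /C [leRHS](_ : _ = 2 * M * ((2 * (u - v)) ^+ 2 / d ^+ 2)); last first.
    by field; rewrite gt_eqF.
  rewrite ler_peMr ?mulr_ge0// ler_pdivlMr ?exprn_gt0// mul1r.
  rewrite -[leRHS]real_normK ?num_real// ler_pXn2r ?nnegrE ?normr_ge0 ?(ltW d0)//.
  by rewrite (le_trans (ltW uv))// (_ : _ - (2 * v - 1) = 2 * (u - v)); last ring.
have [n Hn] : exists n : nat, C / n.+1%:R <= e / 2.
  exists (Num.bound ((C + 1) / (e / 2))).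
  rewrite ler_pdivrMr ?ltr0n// mulrC -ler_pdivrMr//.
  have := Num.Theory.archi_boundP (divr_ge0 (addr_ge0 C0 ler01) (ltW e20)).
  move=> /ltW h; rewrite (le_trans _ (le_trans h _))//; last by rewrite ler_nat.
  by rewrite ler_pM2r ?invr_gt0// lerDl.
exists (bernstein n.+1 (fun k => g (k%:R / n.+1%:R)) \Po (2^-1 *: ('X + 1))) => y /andP[y0 y1].
rewrite horner_comp.
have -> : (2^-1 *: ('X + 1 : {poly R})).[y] = 2^-1 * (y + 1) by rewrite !hornerE.
set u := 2^-1 * (y + 1).
have -> : f y = g u by rewrite /g /u; congr f; field.
have u01 : 0 <= u <= 1 by rewrite /u; apply/andP; split; lra.
rewrite (le_trans (bernstein_approx n C0 Hg u01))// [leRHS]splitr lerD2l//.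
Qed.

End weierstrass.

(** * Taylor polynomials of sine and cosine *)

Section taylor.
Local Open Scope classical_set_scope.
Local Open Scope ring_scope.
Variable R : realType.

Lemma nonneg_of_derive (F dF : R -> R) : (forall x, is_derive x (1 : R) F (dF x)) ->
  0 <= F 0 -> (forall x, 0 <= x -> 0 <= dF x) -> forall y, 0 <= y -> 0 <= F y.
Proof.
move=> HF F0 dF0 y; rewrite le_eqVlt => /predU1P[<- //|y0].
have cF : {within `[0, y], continuous F}.
  apply: continuous_subspaceT => x.
  by apply: differentiable_continuous; apply/derivable1_diffP; case: (HF x).
have [c] := MVT y0 (fun x _ => HF x) cF.
rewrite in_itv /= => /andP[c0 _] E.
have -> : F y = F 0 + dF c * (y - 0) by rewrite -E addrC subrK.
by rewrite addr_ge0// subr0 mulr_ge0 ?dF0 ?(ltW c0) ?(ltW y0).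
Qed.

Definition cos_poly n : {poly R} := \sum_(k < n) ((-1) ^+ k / (k.*2)`!%:R) *: 'X^(k.*2).
Definition sin_poly n : {poly R} := \sum_(k < n) ((-1) ^+ k / (k.*2.+1)`!%:R) *: 'X^(k.*2.+1).

Lemma fact_neq0 n : n`!%:R != 0 :> R.
Proof. by rewrite pnatr_eq0 -lt0n fact_gt0. Qed.

Lemma deriv_mono_fact (c : R) n :
  ((c / n.+1`!%:R) *: 'X^(n.+1) : {poly R})^`() = (c / n`!%:R) *: 'X^n.
Proof.
rewrite derivZ derivXn /= -scalerMnr scalerMnl; congr (_ *: _).
have h := fact_neq0 n; have h' : n.+1%:R != 0 :> R by rewrite pnatr_eq0.
by rewrite -[LHS]mulr_natr factS natrM; move: n.+1%:R n`!%:R h h' => u v v0 u0; field; rewrite v0.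
Qed.

(** The next monomial plus or minus [F - p] vanishes at 0 and has a nonnegative derivative. *)
Lemma taylor_step (F dF : R -> R) (p : {poly R}) n :
  (forall x, is_derive x (1 : R) F (dF x)) -> F 0 = p.[0] ->
  (forall z, 0 <= z -> `|dF z - p^`().[z]| <= z ^+ n / n`!%:R) ->
  forall z, 0 <= z -> `|F z - p.[z]| <= z ^+ n.+1 / n.+1`!%:R.
Proof.
move=> HF F0 Hd z z0; pose m k : {poly R} := (1 / k`!%:R) *: 'X^k.
have mE k y : (m k).[y] = y ^+ k / k`!%:R by rewrite /m hornerZ hornerXn mul1r mulrC.
have dm k : (m k.+1)^`() = m k by exact: deriv_mono_fact.
have m0 : (m n.+1).[0] = 0 by rewrite mE expr0n /= mul0r.
rewrite -mE ler_norml; apply/andP; split; rewrite -subr_ge0.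
  apply: (@nonneg_of_derive (F - horner p - - horner (m n.+1))
    (fun x => dF x - p^`().[x] - - (m n).[x])) => // [x||x x0].
  - have -> : (m n).[x] = (m n.+1)^`().[x] by rewrite dm.
    exact: (is_deriveB (is_deriveB (HF x) (is_derive_poly p x)) (is_deriveN (is_derive_poly _ x))).
  - by rewrite /GRing.add /GRing.opp /= F0 m0 subrr ?subr0 ?oppr0.
  - by rewrite mE subr_ge0; have := Hd x x0; rewrite ler_norml => /andP[].
apply: (@nonneg_of_derive (horner (m n.+1) - (F - horner p))
    (fun x => (m n).[x] - (dF x - p^`().[x]))) => // [x||x x0].
- have -> : (m n).[x] = (m n.+1)^`().[x] by rewrite dm.
  exact: (is_deriveB (is_derive_poly _ x) (is_deriveB (HF x) (is_derive_poly p x))).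
- by rewrite /GRing.add /GRing.opp /= F0 m0 subrr subr0.
- by rewrite mE subr_ge0; have := Hd x x0; rewrite ler_norml => /andP[].
Qed.

Lemma deriv_sin_poly n : (sin_poly n)^`() = cos_poly n.
Proof.
rewrite /sin_poly (raddf_sum (@deriv R)).
by apply: eq_bigr => k _; rewrite /= deriv_mono_fact.
Qed.

Lemma deriv_cos_poly n : (cos_poly n.+1)^`() = - sin_poly n.
Proof.
rewrite /cos_poly (raddf_sum (@deriv R)) big_ord_recl /= derivZ derivXn /= mulr0n scaler0 add0r.
rewrite -sumrN; apply: eq_bigr => k _.
by rewrite /bump /= add1n doubleS deriv_mono_fact exprS mulN1r mulNr scaleNr.
Qed.

Lemma cos_poly0 n : (cos_poly n.+1).[0] = 1.
Proof.
rewrite /cos_poly big_ord_recl /= hornerD horner_sum big1 ?addr0.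
  by rewrite hornerZ hornerXn /= fact0 !expr0 divr1 mulr1.
by move=> k _; rewrite hornerZ hornerXn /= expr0n mulr0.
Qed.

Lemma sin_poly0 n : (sin_poly n).[0] = 0.
Proof. by rewrite /sin_poly horner_sum big1// => k _; rewrite hornerZ hornerXn expr0n mulr0. Qed.

(** One integration leads from cosine to sine at the same order and another from sine to cosine at
    the next; the start is that cosine is bounded by 1. *)
Lemma taylor_sin_cos n (y : R) : 0 <= y ->
  `|cos y - (cos_poly n).[y]| <= y ^+ n.*2 / (n.*2)`!%:R /\
  `|sin y - (sin_poly n).[y]| <= y ^+ n.*2.+1 / (n.*2.+1)`!%:R.
Proof.
have sin_of_cos k : (forall z : R, 0 <= z -> `|cos z - (cos_poly k).[z]| <= z ^+ k.*2 / (k.*2)`!%:R) ->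
    forall z : R, 0 <= z -> `|sin z - (sin_poly k).[z]| <= z ^+ k.*2.+1 / (k.*2.+1)`!%:R.
  move=> H; apply: (@taylor_step _ cos) => [|z z0]; first by rewrite sin0 sin_poly0.
  by rewrite deriv_sin_poly; exact: H.
have cos_bound : forall z : R, 0 <= z -> `|cos z - (cos_poly n).[z]| <= z ^+ n.*2 / (n.*2)`!%:R.
  elim: n => [|k IH].
    by move=> z z0; rewrite /cos_poly big_ord0 horner0 subr0 expr0 fact0 divr1 cos_max.
  rewrite doubleS; apply: (@taylor_step _ (- sin)) => [|z z0]; first by rewrite cos0 cos_poly0.
  rewrite deriv_cos_poly hornerN opprK.
  by rewrite [_ + _](_ : _ = - (sin z - (sin_poly k).[z])) ?normrN ?sin_of_cos// opprB addrC.
by move=> y0; split; [exact: cos_bound|exact: sin_of_cos].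
Qed.

Lemma taylor_cos n (y : R) : `|cos y - (cos_poly n).[y]| <= y ^+ n.*2 / (n.*2)`!%:R.
Proof.
wlog y0 : y / 0 <= y => [H|]; last by have [] := taylor_sin_cos n y0.
have [/H//|y0] := leP 0 y; have := H (- y); rewrite oppr_ge0 => /(_ (ltW y0)).
rewrite cosN exprNn -signr_odd odd_double expr0 mul1r.
suff -> : (cos_poly n).[- y] = (cos_poly n).[y] by [].
rewrite /cos_poly !horner_sum; apply: eq_bigr => k _.
by rewrite !hornerZ !hornerXn [(- y) ^+ _]exprNn -(signr_odd _ k.*2) odd_double expr0 mul1r.
Qed.

Lemma taylor_sin n (y : R) : `|sin y - (sin_poly n).[y]| <= `|y| ^+ n.*2.+1 / (n.*2.+1)`!%:R.
Proof.
wlog y0 : y / 0 <= y => [H|]; last first.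
  by rewrite (ger0_norm y0); have [] := taylor_sin_cos n y0.
have [/H//|y0] := leP 0 y; have := H (- y); rewrite oppr_ge0 normrN => /(_ (ltW y0)).
rewrite sinN.
suff -> : (sin_poly n).[- y] = - (sin_poly n).[y] by rewrite -opprD normrN.
rewrite /sin_poly !horner_sum -sumrN; apply: eq_bigr => k _.
by rewrite !hornerZ !hornerXn [(- y) ^+ _]exprNn -(signr_odd _ k.*2.+1) /= odd_double /= expr1 mulN1r mulrN.
Qed.

End taylor.

(** * Approximation by polynomials in the sense of moments *)

Section sandwich.
Local Open Scope classical_set_scope.
Local Open Scope ring_scope.
Variable R : realType.
Implicit Types (m : nat -> R) (f g : R -> R) (p Q K : {poly R}).

(** The linear functional on polynomials that sends the [i]-th power to [m i]: the integral of [p]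
    as soon as [m] is a moment sequence. *)
Definition mom_pairing m p : R := \sum_(i < size p) p`_i * m i.

Lemma mom_pairingE m n p : (size p <= n)%N -> mom_pairing m p = \sum_(i < n) p`_i * m i.
Proof.
move=> pn; rewrite /mom_pairing (big_ord_widen _ (fun i => p`_i * m i) pn) big_mkcond /=.
by apply: eq_bigr => i _; case: ltnP => // /leq_sizeP/(_ i (leqnn _)) ->; rewrite mul0r.
Qed.

Lemma mom_pairingD m p Q : mom_pairing m (p + Q) = mom_pairing m p + mom_pairing m Q.
Proof.
have h1 := size_polyD p Q.
rewrite (mom_pairingE m h1) (mom_pairingE m (leq_maxl (size p) (size Q))).
rewrite (mom_pairingE m (leq_maxr (size p) (size Q))) -big_split /=.
by apply: eq_bigr => i _; rewrite coefD mulrDl.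
Qed.

Lemma mom_pairingZ m (c : R) p : mom_pairing m (c *: p) = c * mom_pairing m p.
Proof.
rewrite (mom_pairingE m (size_scale_leq c p)) /mom_pairing big_distrr /=.
by apply: eq_bigr => i _; rewrite coefZ mulrA.
Qed.

Lemma mom_pairingXn m n : mom_pairing m 'X^n = m n.
Proof.
rewrite /mom_pairing size_polyXn big_ord_recr /= coefXn eqxx mul1r big1 ?add0r// => i _.
by rewrite coefXn ltn_eqF ?mul0r// ltn_ord.
Qed.

Lemma mom_pairingC m (c : R) : mom_pairing m c%:P = c * m 0%N.
Proof. by rewrite -alg_polyC mom_pairingZ; congr (_ * _); exact: (mom_pairingXn m 0). Qed.

(** Any average whose moments are close to [m] then evaluates [f] close to the pairing with [Q],
    with an error controlled by the pairing with [K]. *)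
Definition poly_approx m f := forall e, 0 < e ->
  exists Q K, (forall x, `|f x - Q.[x]| <= K.[x]) /\ mom_pairing m K <= e.

Lemma poly_approx_lin m f g (a b : R) : poly_approx m f -> poly_approx m g ->
  poly_approx m (fun x => a * f x + b * g x).
Proof.
move=> hf hg e e0.
have d0 : 0 < `|a| + `|b| + 1 by rewrite ltr_wpDl// addr_ge0.
have [Q1 [K1 [h1 l1]]] := hf _ (divr_gt0 e0 d0).
have [Q2 [K2 [h2 l2]]] := hg _ (divr_gt0 e0 d0).
exists (a *: Q1 + b *: Q2), (`|a| *: K1 + `|b| *: K2); split.
  move=> x; rewrite !hornerD !hornerZ.
  have -> : a * f x + b * g x - (a * Q1.[x] + b * Q2.[x]) =
    a * (f x - Q1.[x]) + b * (g x - Q2.[x]) by ring.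
  by rewrite (le_trans (ler_normD _ _))// !normrM lerD// ler_wpM2l.
rewrite mom_pairingD !mom_pairingZ.
apply: (@le_trans _ _ (`|a| * (e / (`|a| + `|b| + 1)) + `|b| * (e / (`|a| + `|b| + 1)))).
  by rewrite lerD// ler_wpM2l.
by rewrite -mulrDl mulrCA ler_piMr ?(ltW e0)// ler_pdivrMr// mul1r lerDl.
Qed.

Lemma poly_approx_ext m f g : (forall x, f x = g x) -> poly_approx m g -> poly_approx m f.
Proof. by move=> fg; rewrite (_ : f = g)//; apply: funext. Qed.

Lemma poly_approx_sum m n (F : nat -> R -> R) (c : nat -> R) :
  (forall k, poly_approx m (F k)) -> poly_approx m (fun x => \sum_(k < n) c k * F k x).
Proof.
move=> h; elim: n => [|n IH].
  apply: poly_approx_ext (poly_approx_lin 0 0 (h 0%N) (h 0%N)) => x.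
  by rewrite big_ord0 !mul0r addr0.
apply: poly_approx_ext (poly_approx_lin 1 (c n) IH (h n)) => x.
by rewrite big_ord_recr /= mul1r.
Qed.

Lemma poly_approx_near m f :
  (forall e, 0 < e -> exists g K, [/\ poly_approx m g,
     forall x, `|f x - g x| <= K.[x] & mom_pairing m K <= e]) -> poly_approx m f.
Proof.
move=> h e e0; have e20 : 0 < e / 2 by rewrite divr_gt0.
have [g [K [/(_ _ e20)[Q [K' [h1 l1]]] h2 l2]]] := h _ e20.
exists Q, (K + K'); split=> [x|]; last by rewrite mom_pairingD [e]splitr lerD.
rewrite hornerD (le_trans _ (lerD (h2 x) (h1 x)))//.
by rewrite (le_trans _ (ler_normD _ _))// addrA subrK.
Qed.

Section entire.
Variable m : nat -> R.
Hypothesis m_ge0 : forall k, 0 <= m k.*2.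
Hypothesis m_entire : forall s e : R, 0 < e ->
  exists n0, forall n, (n0 <= n)%N -> s ^+ n.*2 * m n.*2 / (n.*2)`!%:R <= e.

Lemma poly_approx_cos (s : R) : poly_approx m (fun x => cos (s * x)).
Proof.
move=> e e0; have [n0 /(_ n0 (leqnn _)) hn] := m_entire s e0.
exists (cos_poly R n0 \Po (s *: 'X)), ((s ^+ n0.*2 / (n0.*2)`!%:R) *: 'X^(n0.*2)); split.
  move=> x; rewrite horner_comp !hornerZ hornerX hornerXn.
  by rewrite (le_trans (taylor_cos _ _))// exprMn mulrAC.
by rewrite mom_pairingZ mom_pairingXn mulrAC.
Qed.

Lemma poly_approx_sin (s : R) : poly_approx m (fun x => sin (s * x)).
Proof.
move=> e e0; have e20 : 0 < e / 2 by rewrite divr_gt0.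
have [n1 h1] := m_entire s e20; have [n2 h2] := m_entire (s * 2) e20.
pose n := maxn n1 n2; have {}h1 := h1 n (leq_maxl _ _).
have {}h2 := h2 n.+1 (leqW (leq_maxr _ _)).
(* The remainder has odd degree, and an odd power of the absolute value is no polynomial; it is
   bounded by the two neighbouring even powers. The factor 2 in [s * 2] pays for the larger
   factorial under the second one. *)
exists (sin_poly R n \Po (s *: 'X)), ((s ^+ n.*2 / (n.*2)`!%:R) *: 'X^(n.*2) +
  ((s * 2) ^+ n.+1.*2 / (n.+1.*2)`!%:R) *: 'X^(n.+1.*2)); split; last first.
  rewrite mom_pairingD !mom_pairingZ !mom_pairingXn.
  by rewrite ![_ / _ * m _]mulrAC [e]splitr lerD.
move=> x; rewrite horner_comp hornerD !hornerZ hornerX !hornerXn.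
apply: (le_trans (taylor_sin _ _)).
rewrite ![_ / _ * _ ^+ _]mulrAC -!exprMn [s * 2 * x]mulrAC [(s * x * 2) ^+ _]exprMn.
have key (y : R) k : 0 <= y -> y ^+ k.*2.+1 <= y ^+ k.*2 + y ^+ k.+1.*2.
  move=> y0; rewrite doubleS !exprS mulrA -expr2; have := exprn_ge0 k.*2 y0.
  by move: (_ ^+ _) => u u0; rewrite -{2}[u]mul1r -mulrDl ler_wpM2r//; nra.
have ev k : (s * x) ^+ k.*2 = `|s * x| ^+ k.*2 by rewrite -normrX ger0_norm// -muln2 exprM sqr_ge0.
rewrite !ev; have := key _ n (normr_ge0 (s * x)).
have := exprn_ge0 n.*2 (normr_ge0 (s * x)); have := exprn_ge0 n.+1.*2 (normr_ge0 (s * x)).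
move: (_ ^+ _) (`|_| ^+ n.*2) (_ ^+ n.*2.+1) => u v w u0 v0 hw.
apply: (@le_trans _ _ ((v + u) / (n.*2.+1)`!%:R)).
  by rewrite ler_wpM2r ?invr_ge0.
rewrite mulrDl lerD//.
  rewrite ler_wpM2l// lef_pV2 ?posrE ?ltr0n ?fact_gt0// ler_nat factS leq_pmull//.
rewrite -mulrA ler_wpM2l// doubleS [(n.*2.+2)`!]factS natrM invfM.
rewrite mulrA ler_peMl ?invr_ge0// ler_pdivlMr ?ltr0n// mul1r -natrX ler_nat.
exact/ltnW/ltn_expl.
Qed.

(** Multiplying by a sine exchanges the two families and shifts the frequency by plus or minus [t],
    so both claims are carried together, for all frequencies [s]. *)
Lemma poly_approx_sin_exp (t : R) k (s : R) :
  poly_approx m (fun x => sin (t * x) ^+ k * cos (s * x)) /\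
  poly_approx m (fun x => sin (t * x) ^+ k * sin (s * x)).
Proof.
elim: k s => [|k IH] s.
  split; [apply: poly_approx_ext (poly_approx_cos s)|apply: poly_approx_ext (poly_approx_sin s)];
    by move=> x; rewrite expr0 mul1r.
have [c1 s1] := IH (s + t); have [c2 s2] := IH (s - t).
split.
  apply: poly_approx_ext (poly_approx_lin (1/2) (-1/2) s1 s2) => x.
  by rewrite [(s + t) * x]mulrDl [(s - t) * x]mulrBl sinB sinD exprS; field.
apply: poly_approx_ext (poly_approx_lin (1/2) (-1/2) c2 c1) => x.
by rewrite [(s + t) * x]mulrDl [(s - t) * x]mulrBl cosB cosD exprS; field.
Qed.

(** The function [f] is compared with [P] evaluated at [sin (t * x)], where [P] approximates
    [f (y / t)] on [-1, 1]. The error is at most [2 * e1] on [-L, L]; beyond, it is at most [2 * e1]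
    plus a multiple of x^2 / L^2, whose pairing only involves the second moment. *)
Lemma poly_approx_bounded f (M : R) : continuous f -> (forall x, `|f x| <= M) -> poly_approx m f.
Proof.
move=> cf fM; apply: poly_approx_near => e e0.
have M0 : 0 <= M by rewrite (le_trans _ (fM 0)).
have m00 : 0 <= m 0%N := m_ge0 0.
have m20 : 0 <= m 2%N := m_ge0 1.
pose e1 := e / (4 * (m 0%N + 1)); have e10 : 0 < e1 by rewrite divr_gt0// mulr_gt0// ltr_wpDl.
(* Makes [2 * M * m 2%N / L ^+ 2] at most [e / 2], since [L] is at most its square. *)
pose L := 1 + 4 * M * m 2%N / e.
have L1 : 1 <= L by rewrite lerDl divr_ge0 ?(ltW e0)// !mulr_ge0.
have L0 : 0 < L by rewrite (lt_le_trans _ L1).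
have [d d0 Hd] := @continuous_segment_uniform R f (- L) L e1 cf e10.
(* The cubic Taylor bound gives a distance between [x] and [sin (t * x) / t] of at most t^2 L^3,
   which is at most t L^3 and so at most [d]. *)
pose t := Num.min 1 (d / L ^+ 3).
have L30 : 0 < L ^+ 3 by rewrite exprn_gt0.
have t0 : 0 < t by rewrite lt_min ltr01 divr_gt0.
have t1 : t <= 1 by rewrite ge_min lexx.
have td : t * L ^+ 3 <= d by rewrite -ler_pdivlMr// ge_min lexx orbT.
have cg : continuous (fun y : R => f (y / t)).
  by move=> y; apply: (@continuous_comp _ _ _ (fun y : R => y / t) f); [exact: mulrr_continuous|exact: cf].
have [P HP] := @weierstrass R (fun y => f (y / t)) M e1 cg (fun x => fM _) e10.
exists (fun x => P.[sin (t * x)]), ((2 * e1)%:P + (2 * M / L ^+ 2) *: 'X^2); split.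
- apply: poly_approx_ext (poly_approx_sum (size P) (fun k => P`_k) (fun k => (poly_approx_sin_exp t k 0).1)) => x.
  by rewrite horner_coef; apply: eq_bigr => k _; rewrite mul0r cos0 mulr1.
- move=> x; rewrite hornerD hornerC hornerZ hornerXn.
  have sb : -1 <= sin (t * x) <= 1 by rewrite sin_geN1 sin_le1.
  have := HP _ sb; set S := sin (t * x) => hP.
  have -> : f x - P.[S] = (f x - f (S / t)) + (f (S / t) - P.[S]) by ring.
  rewrite (le_trans (ler_normD _ _))// [2 * e1]mulr_natl mulr2n addrAC lerD//.
  rewrite -/S.
  have q0 : 0 <= 2 * M / L ^+ 2 * x ^+ 2.
    by rewrite mulr_ge0 ?sqr_ge0// divr_ge0 ?exprn_ge0 ?(ltW L0)// mulr_ge0.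
  have [xL|xL] := leP `|x| L.
    rewrite (@le_trans _ _ e1) ?lerDl// ?lerDr//; apply: Hd; first by rewrite -ler_norml.
    have -> : x - S / t = (t * x - S) / t by field; rewrite gt_eqF.
    rewrite normrM normfV (gtr0_norm t0) ler_pdivrMr// distrC.
    have := taylor_sin 1 (t * x); rewrite /sin_poly big_ord_recl big_ord0 /= addr0.
    rewrite hornerZ hornerXn expr0 (_ : (0.*2.+1)`! = 1%N)// divr1 mul1r expr1 => h.
    apply: (le_trans h); apply: (@le_trans _ _ (`|t * x| ^+ 3)).
      by rewrite ler_pdivrMr ?ltr0n ?fact_gt0// ler_peMr ?exprn_ge0// ler1n fact_gt0.
    rewrite normrM (gtr0_norm t0) exprMn.
    apply: (@le_trans _ _ (t ^+ 3 * L ^+ 3)).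
      by rewrite ler_wpM2l ?exprn_ge0 ?(ltW t0)// lerXn2r ?nnegrE ?(ltW L0).
    rewrite -[d * t]mulrC; apply: (@le_trans _ _ (t * (t * L ^+ 3))); last by rewrite ler_wpM2l ?(ltW t0).
    rewrite mulrA -expr2 ler_wpM2r ?(ltW L30)//.
    by rewrite exprS ler_piMl ?sqr_ge0.
  rewrite (@le_trans _ _ (2 * M)) //.
    by rewrite mulr_natl mulr2n (le_trans (ler_normB _ _))// lerD.
  rewrite (@le_trans _ _ (2 * M / L ^+ 2 * x ^+ 2)) ?lerDl// ?lerDr ?(ltW e10)//.
  rewrite mulrAC ler_pdivlMr ?exprn_gt0// ler_wpM2l// ?mulr_ge0//.
  by rewrite -[x ^+ 2]real_normK ?num_real// lerXn2r ?nnegrE ?(ltW L0) ?(ltW xL).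
- rewrite mom_pairingD mom_pairingC mom_pairingZ mom_pairingXn [e]splitr lerD//.
    rewrite /e1; apply: (@le_trans _ _ (e / 2 * (m 0%N / (m 0%N + 1)))).
      by rewrite le_eqVlt; apply/orP; left; apply/eqP; field; rewrite gt_eqF// ltr_wpDl.
    by rewrite ler_piMr ?divr_ge0 ?(ltW e0)// ler_pdivrMr ?mul1r ?lerDl// ltr_wpDl.
  rewrite mulrAC ler_pdivrMr ?exprn_gt0//.
  have LL : L <= L ^+ 2 by rewrite expr2 ler_peMl// (ltW L0).
  apply: (@le_trans _ _ (e / 2 * L)); last by rewrite ler_wpM2l// divr_ge0// ltW.
  rewrite /L mulrDr mulr1.
  have -> : e / 2 * (4 * M * m 2%N / e) = 2 * M * m 2%N by field; rewrite gt_eqF.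
  by rewrite lerDr divr_ge0// ltW.
Qed.

End entire.
End sandwich.

(** * Representation of positive functionals and the moment problem *)

Section riesz.
Local Open Scope classical_set_scope.
Local Open Scope ring_scope.
Variable R : realType.
Implicit Types (f g : R -> R) (mu nu : probability (measurableTypeR R) R).

Definition cont_bounded f := continuous f /\ exists M, forall x, `|f x| <= M.

Lemma cont_bounded_cst (c : R) : cont_bounded (fun=> c).
Proof. by split; [move=> x; exact: cvg_cst|exists `|c|]. Qed.

Lemma cont_bounded_lin f g (a b : R) : cont_bounded f -> cont_bounded g ->
  cont_bounded (fun x => a * f x + b * g x).
Proof.
move=> [cf [M fM]] [cg [M' gM]]; split.
  by move=> x; apply: cvgD; apply: cvgMr; [exact: cf|exact: cg].
exists (`|a| * M + `|b| * M') => x.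
by rewrite (le_trans (ler_normD _ _))// !normrM lerD// ler_wpM2l.
Qed.

(** A continuous substitute for the indicator of a half-line: 1 up to [a], 0 from [b] on, affine in
    between when [a < b]. *)
Definition ramp (a b x : R) : R := Num.max 0 (Num.min 1 ((b - x) / (b - a))).

Lemma ramp_ge0 a b x : 0 <= ramp a b x.
Proof. by rewrite le_max lexx. Qed.

Lemma ramp_le1 a b x : ramp a b x <= 1.
Proof. by rewrite ge_max ler01 ge_min lexx. Qed.

Lemma ramp1 a b x : a < b -> x <= a -> ramp a b x = 1.
Proof.
move=> ab xa; rewrite /ramp; have h : 1 <= (b - x) / (b - a).
  by rewrite ler_pdivlMr ?subr_gt0// mul1r lerD2l lerN2.
by rewrite (min_idPl h); apply/max_idPr.
Qed.

Lemma ramp0 a b x : a < b -> b <= x -> ramp a b x = 0.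
Proof.
move=> ab bx; rewrite /ramp; have h : (b - x) / (b - a) <= 0.
  by rewrite ler_pdivrMr ?subr_gt0// mul0r subr_le0.
by apply/max_idPl; rewrite ge_min h orbT.
Qed.

Lemma ramp_mid a b x : a < b -> a <= x <= b -> ramp a b x = (b - x) / (b - a).
Proof.
move=> ab /andP[ax xb]; rewrite /ramp.
rewrite (min_idPr _) ?ler_pdivrMr ?subr_gt0// ?mul1r ?lerD2l ?lerN2//.
by apply/max_idPr; rewrite divr_ge0 ?subr_ge0 ?(ltW ab).
Qed.

Lemma cont_bounded_ramp a b : cont_bounded (ramp a b).
Proof.
split; last first.
  by exists 1 => x; rewrite ger0_norm ?ramp_ge0 ?ramp_le1.
have c1 : continuous (fun x : R => (b - x) / (b - a)).
  move=> x; apply: cvgM; last exact: cvg_cst.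
  by apply: cvgB; [exact: cvg_cst|exact: cvg_id].
have c2 : continuous (cst 1 \min (fun x : R => (b - x) / (b - a))).
  by move=> x; apply: (@continuous_min R R); [exact: cvg_cst|exact: c1].
have c3 : continuous (cst 0 \max (cst 1 \min (fun x : R => (b - x) / (b - a)))).
  by move=> x; apply: (@continuous_max R R); [exact: cvg_cst|exact: c2].
exact: c3.
Qed.

Lemma integrable_cont_bounded mu f : cont_bounded f -> mu.-integrable setT (EFin \o f).
Proof.
move=> [cf [M fM]]; apply: measurable_bounded_integrable => //.
- by rewrite (le_lt_trans (probability_le1 _ _)) ?ltry.
- exact: continuous_measurable_fun.
- exists M; split; first by rewrite num_real.
  by move=> x Mx y _; exact: le_trans (fM y) (ltW Mx).
Qed.

Lemma integral_indic_itv mu (x : R) :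
  \int[mu]_y (\1_(`]-oo, x]%classic) y) = fine (mu `]-oo, x]%classic).
Proof. by rewrite /Rintegral /= integral_indic// setIT. Qed.

Lemma integrable_indic_itv mu (x : R) :
  mu.-integrable setT (EFin \o (\1_(`]-oo, x]%classic) : R -> R)).
Proof.
apply: integrable_indic => //.
Qed.

Lemma itv_le_integral mu f x : cont_bounded f -> (forall y, 0 <= f y) ->
  (forall y, y <= x -> 1 <= f y) -> fine (mu `]-oo, x]%classic) <= \int[mu]_y f y.
Proof.
move=> cf f0 f1; rewrite -integral_indic_itv; apply: le_Rintegral => //.
- exact: integrable_indic_itv.
- exact: integrable_cont_bounded.
move=> y _; rewrite indicE; case: (boolP (_ \in _)) => // /set_mem.
by rewrite /= in_itv /= => /f1.
Qed.

Lemma integral_le_itv mu f x : cont_bounded f -> (forall y, f y <= 1) ->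
  (forall y, x < y -> f y <= 0) -> \int[mu]_y f y <= fine (mu `]-oo, x]%classic).
Proof.
move=> cf f0 f1; rewrite -integral_indic_itv; apply: le_Rintegral => //.
- exact: integrable_cont_bounded.
- exact: integrable_indic_itv.
move=> y _; rewrite indicE; case: (boolP (_ \in _)) => //.
move=> h; apply: f1; rewrite ltNge; apply: contra h => h.
by rewrite inE /= in_itv.
Qed.

(** Half-open intervals are stable under intersection and generate the Borel sets; their measures
    are differences of the two distribution functions. *)
Lemma eq_probability_itv mu nu : (forall x, mu `]-oo, x]%classic = nu `]-oo, x]%classic) ->
  forall A, measurable A -> mu A = nu A.
Proof.
move=> h A mA.
apply: (@measure_unique _ R (measurableTypeR R) (@ocitv R) (fun n => `]- n%:R, n%:R]%classic)) => //.
- exact: ocitvI.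
- by move=> n; exact: is_ocitv.
- rewrite -subTset => x _; exists (Num.bound `|x|) => //=.
  by have := archi_boundP (normr_ge0 x); rewrite in_itv /= ltr_norml => /andP[-> /ltW].
- move=> _ [[a b] _ <-] /=; have [ab | ba] := leP a b; last first.
    by rewrite set_itv_ge ?measure0// bnd_simp -leNgt ltW.
  have -> : `]a, b]%classic = `]-oo, b] `\` `]-oo, a] :> set R.
    by rewrite -[RHS]setCK setCD setCitvl setUC -[LHS]setCK setCitv.
  have sub : (`]-oo, a] : set R) `<=` (`]-oo, b] : set R) by exact: subset_itvl.
  have fin (P : probability (measurableTypeR R) R) B : (measurable B -> P B < +oo)%E.
    by move=> mB; rewrite (le_lt_trans (probability_le1 _ mB)) ?ltry.
  have E (P : probability (measurableTypeR R) R) :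
      P (`]-oo, b] `\` `]-oo, a])%classic = (P `]-oo, b]%classic - P `]-oo, a]%classic)%E.
    by rewrite measureD ?setIidr// fin.
  by rewrite !E !h.
- by move=> n; rewrite (le_lt_trans (probability_le1 _ _)) ?ltry.
Qed.

Definition pos_functional (J : (R -> R) -> R) :=
  [/\ forall f g (a b : R), cont_bounded f -> cont_bounded g ->
       J (fun x => a * f x + b * g x) = a * J f + b * J g,
     forall f g, cont_bounded f -> cont_bounded g -> (forall x, f x <= g x) -> J f <= J g
   & J (fun=> 1) = 1].

Lemma pos_functional_cst J c : pos_functional J -> J (fun=> c) = c.
Proof.
move=> [lin _ J1]; rewrite -[RHS]mulr1 -[X in _ * X]J1 -[RHS]addr0 -[X in _ + X](mul0r (J (fun=> 1))).
rewrite -lin; try exact: cont_bounded_cst.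
by congr J; apply: funext => x; rewrite mulr1 mul0r addr0.
Qed.

Lemma pos_functional_integral mu : pos_functional (fun f => \int[mu]_y f y).
Proof.
have Zint f (a : R) : cont_bounded f -> mu.-integrable setT (EFin \o (fun x => a * f x)).
  move=> cf; apply: integrable_cont_bounded.
  have := cont_bounded_lin a 0 cf cf; congr cont_bounded.
  by apply: funext => x; rewrite mul0r addr0.
split=> [f g a b cf cg|f g cf cg fg|].
- rewrite RintegralD//; [|exact: Zint|exact: Zint].
  by rewrite !RintegralZl//; exact: integrable_cont_bounded.
- by apply: le_Rintegral => //; exact: integrable_cont_bounded.
- by rewrite Rintegral_cst//= probability_setT mulr1.
Qed.

(* Piecewise linear interpolation of f at the nodes a 0 < ... < a n; the factors 1
   put it in the form of [cont_bounded_lin]. *)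
Fixpoint interpolation f (a : nat -> R) n x : R :=
  if n is k.+1 then 1 * interpolation f a k x + (f (a k.+1) - f (a k)) * (1 * 1 + (-1) * ramp (a k) (a k.+1) x)
  else f (a 0%N).

Lemma cont_bounded_interpolation f a n : cont_bounded (interpolation f a n).
Proof.
elim: n => [|n IH]; first exact: cont_bounded_cst.
apply: (cont_bounded_lin _ _ IH); apply: cont_bounded_lin; first exact: cont_bounded_cst.
exact: cont_bounded_ramp.
Qed.

Lemma interpolation_left f a n x : (forall i, a i < a i.+1) -> x <= a 0%N ->
  interpolation f a n x = f (a 0%N).
Proof.
move=> aS xa; elim: n => [//|n /= ->]; rewrite ramp1//; first by rewrite !mul1r mulN1r subrr mulr0 addr0.
rewrite (le_trans xa)//; elim: n => // n; move=> /le_trans; apply; exact: ltW.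
Qed.

Lemma interpolation_right f a n x : (forall i, a i < a i.+1) -> a n <= x ->
  interpolation f a n x = f (a n).
Proof.
move=> aS; elim: n => [//|n IH] nx /=; rewrite ramp0// IH; first by ring.
by rewrite (le_trans _ nx)// ltW.
Qed.

Lemma interpolation_near f a n x e : (forall i, a i < a i.+1) ->
  (forall i y, (i < n)%N -> a i <= y <= a i.+1 -> `|f y - f (a i)| <= e /\ `|f y - f (a i.+1)| <= e) ->
  0 <= e -> a 0%N <= x <= a n -> `|f x - interpolation f a n x| <= e.
Proof.
move=> aS H e0; elim: n H => [|n IH] H /andP[x0 xn].
  by have -> : x = a 0%N; [apply/eqP; rewrite eq_le x0 xn|rewrite subrr normr0].
rewrite /=; have [xa|xa] := leP x (a n).
  rewrite ramp1// !mul1r mulN1r subrr mulr0 addr0; apply: IH; last by rewrite x0.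
  by move=> i y /leqW; exact: H.
have hx : a n <= x <= a n.+1 by rewrite (ltW xa) xn.
rewrite (interpolation_right _ aS (ltW xa)) ramp_mid//.
have [] := H n x (ltnSn n) hx.
have: 0 <= (a n.+1 - x) / (a n.+1 - a n) <= 1.
  have d0 : 0 < a n.+1 - a n by rewrite subr_gt0.
  rewrite divr_ge0 ?(subr_ge0 x) ?(ltW d0)//=.
  by rewrite ler_pdivrMr// mul1r lerD2l lerN2 ltW.
move: ((a n.+1 - x) / _) (f x) (f (a n)) (f (a n.+1)) => r u v w /andP[r0 r1] h1 h2.
have -> : u - (1 * v + (w - v) * (1 * 1 + -1 * r)) = r * (u - v) + (1 - r) * (u - w) by ring.
rewrite (le_trans (ler_normD _ _))// !normrM (ger0_norm r0) (@ger0_norm _ (1 - r)) ?subr_ge0//.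
have -> : e = r * e + (1 - r) * e by ring.
by rewrite lerD// ler_wpM2l ?subr_ge0.
Qed.

(** The interpolation is a combination of ramps whose coefficients are increments of [f]. On each
    ramp both functionals lie between consecutive values of [F], and the resulting bounds
    telescope. *)
Lemma pos_functional_interpolation J J' f a n e (F : R -> R) : pos_functional J -> pos_functional J' ->
  (forall i, a i < a i.+1) ->
  (forall i, (i < n)%N -> `|f (a i.+1) - f (a i)| <= e) ->
  (forall b b', b < b' -> F b <= J (ramp b b') <= F b') ->
  (forall b b', b < b' -> F b <= J' (ramp b b') <= F b') ->
  `|J (interpolation f a n) - J' (interpolation f a n)| <= e * (F (a n) - F (a 0%N)).
Proof.
move=> PJ PJ' aS; elim: n => [|n IH] He H H'.
  by rewrite /= !pos_functional_cst// !subrr normr0 mulr0.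
have [lin _ J1] := PJ; have [lin' _ J1'] := PJ'; rewrite /=.
have c1 := cont_bounded_cst 1; have cr := cont_bounded_ramp (a n) (a n.+1).
have ci := cont_bounded_interpolation f a n; have cc := cont_bounded_lin 1 (-1) c1 cr.
rewrite !lin// !lin'// J1 J1' !mul1r.
have {}IH := IH (fun i h => He i (leqW h)) H H'.
move: (J (interpolation f a n)) (J' (interpolation f a n)) IH => u u' IH.
have := H _ _ (aS n); have := H' _ _ (aS n).
move: (J (ramp _ _)) (J' (ramp _ _)) (He n (ltnSn n)) => r r' he /andP[h1 h2] /andP[h3 h4].
set c := f (a n.+1) - f (a n) in he *.
have -> : u + c * (1 + -1 * r) - (u' + c * (1 + -1 * r')) = (u - u') + c * (r' - r) by ring.
have -> : e * (F (a n.+1) - F (a 0)) = e * (F (a n) - F (a 0)) + e * (F (a n.+1) - F (a n)) by ring.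
rewrite (le_trans (ler_normD _ _))// lerD// normrM ler_pM//.
by rewrite ler_norml; lra.
Qed.

(** A Riemann-Stieltjes argument: ramps pin down both functionals through the same [F], a fine
    interpolation reduces [f] to ramps on a segment, and the tail hypothesis handles the rest of the
    line. *)
Lemma pos_functional_eq J J' (F : R -> R) : pos_functional J -> pos_functional J' ->
  (forall b b', b < b' -> F b <= J (ramp b b') <= F b') ->
  (forall b b', b < b' -> F b <= J' (ramp b b') <= F b') ->
  (forall e, 0 < e -> exists2 L, 0 < L & F (- L) <= e /\ 1 - e <= F L) ->
  forall f, cont_bounded f -> J f = J' f.
Proof.
move=> PJ PJ' H H' tail f [cf [M fM]].
apply/eqP; rewrite -subr_eq0 -normr_le0; apply/ler_addgt0Pr => e e0; rewrite add0r.
have M0 : 0 <= M by rewrite (le_trans _ (fM 0)).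
(* Two interpolation errors [e1 + 4 * M * e1] and one comparison error [e1] add up to
   [(3 + 8 * M) * e1]. *)
have d0 : 0 < 3 + 8 * M by rewrite ltr_wpDr// mulr_ge0.
pose e1 := e / (3 + 8 * M); have e10 : 0 < e1 by rewrite divr_gt0.
have [L0 L00 [tl th]] := tail _ e10; pose L := L0 + 1.
have LP : 0 < L by rewrite addr_gt0.
have [d dP Hd] := @continuous_segment_uniform R f (- L) L e1 cf e10.
pose n := (Num.bound (2 * L / d)).+1.
have n0 : 0 < n%:R :> R by rewrite ltr0n.
have nd : 2 * L / n%:R <= d.
  have hb : 2 * L / d < (Num.bound (2 * L / d))%:R.
    by apply: archi_boundP; rewrite divr_ge0 ?mulr_ge0 ?(ltW LP) ?(ltW dP).
  rewrite ler_pdivrMr// [d * _]mulrC -ler_pdivrMr//; apply: ltW; apply: (lt_le_trans hb).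
  by rewrite ler_nat.
pose a i : R := - L + i%:R * (2 * L / n%:R).
have h0 : 0 < 2 * L / n%:R by rewrite divr_gt0// mulr_gt0.
have aE i : a i.+1 - a i = 2 * L / n%:R by rewrite /a -natr1; ring.
have aS i : a i < a i.+1 by rewrite -subr_gt0 aE.
have a0E : a 0%N = - L by rewrite /a mul0r addr0.
have anE : a n = L by rewrite /a mulrCA mulfV ?gt_eqF//; ring.
have amono i j : (i <= j)%N -> a i <= a j by move=> ij; rewrite lerD2l ler_wpM2r ?ler_nat// ltW.
have osc i y : (i < n)%N -> a i <= y <= a i.+1 -> `|f y - f (a i)| <= e1 /\ `|f y - f (a i.+1)| <= e1.
  move=> ilt /andP[y1 y2].
  have yb : - L <= y <= L.
    by rewrite -a0E -anE (le_trans (amono _ _ (leq0n i)))//= (le_trans y2)// amono.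
  split; apply: Hd => //; rewrite (le_trans _ nd)// -(aE i) ler_norml; lra.
pose g := interpolation f a n; have cg : cont_bounded g := cont_bounded_interpolation f a n.
have JF : F (a n) - F (a 0%N) <= 1.
  have /andP[h1 _] := H _ _ (aS n); have /andP[_ h2] : F (a 0%N - 1) <= J (ramp (a 0%N - 1) (a 0%N)) <= F (a 0%N).
    by apply: H; rewrite gtrDl oppr_lt0.
  rewrite -[leRHS]subr0 lerB//.
    rewrite (le_trans h1)// -[leRHS](pos_functional_cst 1 PJ); have [_ le _] := PJ; apply: le => // [||x].
    - exact: cont_bounded_ramp.
    - exact: cont_bounded_cst.
    - exact: ramp_le1.
  rewrite (le_trans _ h2)// -[leLHS](pos_functional_cst 0 PJ); have [_ le _] := PJ; apply: le => // [||x].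
  - exact: cont_bounded_cst.
  - exact: cont_bounded_ramp.
  - exact: ramp_ge0.
have near : `|J g - J' g| <= e1.
  apply: le_trans (pos_functional_interpolation (f := f) (e := e1) PJ PJ' aS _ H H') _; last first.
    by rewrite ler_piMr// ltW.
  by move=> i ilt; have [] := osc i _ ilt (_ : a i <= a i.+1 <= a i.+1); rewrite ?lexx ?(ltW (aS i)).
(* At least 1 off [-L, L], while its value under either functional is at most [2 * e1]. *)
pose T x := 1 * ramp (- L) (- L0) x + 1 * (1 * 1 + (-1) * ramp L0 L x).
have l1 : - L < - L0 by rewrite ltrN2 ltrDl.
have l2 : L0 < L by rewrite ltrDl.
have T1 x : 0 <= T x.
  by rewrite /T; have := ramp_ge0 (- L) (- L0) x; have := ramp_le1 L0 L x; lra.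
have c1 := cont_bounded_cst 1; have cr := cont_bounded_ramp.
have cc := cont_bounded_lin 1 (-1) c1 (cr L0 L).
have cT : cont_bounded T by exact: cont_bounded_lin (cr _ _) cc.
have fgT x : `|f x - g x| <= e1 + 2 * M * T x.
  have t0 : 0 <= 2 * M * T x by rewrite !mulr_ge0.
  have big : 1 <= T x -> `|f x - g x| <= `|f x| + M -> `|f x - g x| <= e1 + 2 * M * T x.
    move=> Tx h; apply: (le_trans h); apply: (@le_trans _ _ (2 * M * T x)); last by rewrite lerDr ltW.
    apply: (@le_trans _ _ (2 * M)); last by rewrite ler_peMr// mulr_ge0.
    by rewrite mulr_natl mulr2n lerD2r.
  have [xL|xL] := leP x (- L).
    apply: big; first by rewrite /T ramp1//; have := ramp_le1 L0 L x; lra.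
    rewrite /g interpolation_left ?a0E// (le_trans (ler_normB _ _))// lerD2l//.
  have [Lx|Lx] := leP L x.
    apply: big; first by rewrite /T (@ramp0 L0)//; have := ramp_ge0 (- L) (- L0) x; lra.
    by rewrite /g interpolation_right ?anE// (le_trans (ler_normB _ _))// lerD2l.
  rewrite (@le_trans _ _ e1) ?lerDl//; apply: interpolation_near => //; first exact: ltW.
  by rewrite a0E anE !ltW.
have bound K : pos_functional K -> (forall b b', b < b' -> F b <= K (ramp b b') <= F b') ->
    `|K f - K g| <= e1 + 4 * M * e1.
  move=> PK HK; have [lin le K1] := PK.
  have KT : K T <= 2 * e1.
    rewrite /T lin// lin// K1 !mul1r.
    by have /andP[_ h1] := HK _ _ l1; have /andP[h2 _] := HK _ _ l2; lra.
  have cf' : cont_bounded f by split => //; exists M.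
  have cE := cont_bounded_lin e1 (2 * M) c1 cT.
  have up u v : cont_bounded u -> cont_bounded v -> (forall x, `|u x - v x| <= e1 + 2 * M * T x) ->
      K u - K v <= e1 + 4 * M * e1.
    move=> cu cv uv; have cv2 := cont_bounded_lin 1 1 cv cE.
    rewrite lerBlDl; apply: (@le_trans _ _ (K (fun x => 1 * v x + 1 * (e1 * 1 + 2 * M * T x)))).
      apply: le => // x; rewrite !mul1r mulr1 -lerBlDl; exact: le_trans (ler_norm _) (uv x).
    rewrite lin// lin// K1 !mul1r mulr1 lerD2l lerD2l.
    by rewrite (_ : 4 * M * e1 = 2 * M * (2 * e1)) ?ler_wpM2l ?mulr_ge0//; ring.
  rewrite ler_norml up// andbT lerNl opprB up// => x; by rewrite distrC.
have -> : J f - J' f = (J f - J g) + (J g - J' g) - (J' f - J' g) by ring.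
rewrite (le_trans (ler_normB _ _))// (le_trans (lerD (ler_normD _ _) (lexx _)))//.
have -> : e = (e1 + 4 * M * e1) + e1 + (e1 + 4 * M * e1).
  rewrite /e1; field; rewrite gt_eqF//.
by rewrite !lerD// bound.
Qed.

Section functional.
Variable Lam : (R -> R) -> R.
Hypothesis PLam : pos_functional Lam.
Variable m2 : R.
Hypothesis Lam_tight : forall f (c : R), cont_bounded f -> 0 <= c -> (forall x, f x <= c * x ^+ 2) ->
  Lam f <= c * m2.

Let Lam_lin f g (a b : R) : cont_bounded f -> cont_bounded g ->
  Lam (fun x => a * f x + b * g x) = a * Lam f + b * Lam g.
Proof. by have [h _ _] := PLam; exact: h. Qed.

Let Lam_le f g : cont_bounded f -> cont_bounded g -> (forall x, f x <= g x) -> Lam f <= Lam g.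
Proof. by have [_ h _] := PLam; exact: h. Qed.

Let Lam1 : Lam (fun=> 1) = 1.
Proof. by have [_ _ h] := PLam. Qed.

Let Lam_cst c : Lam (fun=> c) = c := pos_functional_cst c PLam.

(** Values of the functional on majorants of the indicator of a half-line. As for an outer measure,
    their infimum is the distribution function of the measure sought. *)
Let above (x : R) := [set v | exists g, [/\ cont_bounded g, forall y, 0 <= g y,
  forall y, y <= x -> 1 <= g y & v = Lam g]].

Let cdf_of (x : R) : R := inf (above x).

Let above_lb x : lbound (above x) 0.
Proof.
move=> _ [g [cg g0 _ ->]]; rewrite -(Lam_cst 0); apply: Lam_le => //; exact: cont_bounded_cst.
Qed.

Let cdf_lb g x : cont_bounded g -> (forall y, 0 <= g y) -> (forall y, y <= x -> 1 <= g y) ->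
  cdf_of x <= Lam g.
Proof. by move=> cg g0 g1; apply: ge_inf; [exists 0; exact: above_lb|exists g]. Qed.

Let above1 x : above x 1.
Proof. by exists (fun=> 1); split => //; exact: cont_bounded_cst. Qed.

Let le_cdf c x : (forall g, cont_bounded g -> (forall y, 0 <= g y) ->
  (forall y, y <= x -> 1 <= g y) -> c <= Lam g) -> c <= cdf_of x.
Proof.
move=> h; apply: lb_le_inf; first by exists 1; exact: above1.
by move=> _ [g [cg g0 g1 ->]]; exact: h.
Qed.

Let cdf_adherent x e : 0 < e -> exists g, [/\ cont_bounded g, forall y, 0 <= g y,
  forall y, y <= x -> 1 <= g y & Lam g < cdf_of x + e].
Proof.
move=> e0; have [_ [g [cg g0 g1 ->]] lt] : exists2 v, above x v & v < inf (above x) + e.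
  apply: inf_adherent => //; split; first by exists 1; exact: above1.
  by exists 0; exact: above_lb.
by exists g.
Qed.

Let cdf_le1 x : cdf_of x <= 1.
Proof. by rewrite -Lam1; apply: cdf_lb => //; exact: cont_bounded_cst. Qed.

Let cdf_ge0 x : 0 <= cdf_of x.
Proof. by apply: lb_le_inf; [exists 1; exact: above1|exact: above_lb]. Qed.

Let cdf_nd : nondecreasing cdf_of.
Proof.
move=> x y xy; apply: le_cdf => g cg g0 g1; apply: cdf_lb => // z zx.
by apply: g1; rewrite (le_trans zx).
Qed.

(** A nearly optimal majorant at [x], raised by [e / 2], is by continuity still a majorant slightly
    to the right of [x]. *)
Let cdf_rc : right_continuous cdf_of.
Proof.
move=> x; apply/cvgrPdist_le => e e0; have e20 : 0 < e / 2 by rewrite divr_gt0.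
have [g [cg g0 g1 lt]] := cdf_adherent x e20.
have /cvgrPdist_le/(_ _ e20)/nbhs_ballP[r /= r0 Hr] := cg.1 x.
near=> y.
have xy : x < y by near: y; exact: nbhs_right_gt.
have yr : y < x + r by near: y; apply: nbhs_right_lt; rewrite ltrDl.
rewrite distrC ger0_norm ?subr_ge0 ?cdf_nd ?(ltW xy)// lerBlDl.
have cg2 : cont_bounded (fun z => 1 * g z + (e / 2) * 1).
  by apply: (cont_bounded_lin 1 (e / 2) cg); exact: cont_bounded_cst.
apply: (@le_trans _ _ (Lam (fun z => 1 * g z + (e / 2) * 1))).
  apply: cdf_lb => // z; first by rewrite mul1r mulr1 addr_ge0// ltW.
  move=> zy; rewrite mul1r mulr1; have [zx|zx] := leP z x.
    by rewrite (le_trans (g1 _ zx))// lerDl ltW.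
  rewrite -lerBlDr (le_trans _ (_ : g x - e / 2 <= g z))//.
    by rewrite lerD2r g1.
  rewrite lerBlDr -lerBlDl; apply: le_trans (ler_norm _) _; apply: Hr.
  rewrite /ball /= distrC gtr0_norm ?subr_gt0// ltrBlDl.
  by rewrite (le_lt_trans zy).
rewrite Lam_lin//; last exact: cont_bounded_cst.
by rewrite mul1r Lam1 mulr1 [e in leRHS]splitr addrA lerD2r ltW.
Unshelve. all: by end_near. Qed.

Let cdf_lo (L : R) : 0 < L -> cdf_of (- L - 1) <= m2 / L ^+ 2.
Proof.
move=> L0; have lt : - L - 1 < - L by rewrite gtrDl oppr_lt0.
apply: (@le_trans _ _ (Lam (ramp (- L - 1) (- L)))).
  apply: cdf_lb => [|y|y yx]; [exact: cont_bounded_ramp|exact: ramp_ge0|by rewrite ramp1].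
rewrite mulrC; apply: Lam_tight; first exact: cont_bounded_ramp.
  by rewrite invr_ge0 exprn_ge0 ?(ltW L0).
move=> y; have [yL|yL] := leP (- L) y.
  by rewrite ramp0// mulr_ge0 ?sqr_ge0// invr_ge0 exprn_ge0// ltW.
rewrite (le_trans (ramp_le1 _ _ _))// mulrC ler_pdivlMr ?exprn_gt0// mul1r.
by nra.
Qed.

(** Chebyshev's inequality: [1 - g] is at most 0 up to [L] and at most 1 beyond, hence lies below
    y^2 / L^2 for every majorant [g]. *)
Let cdf_hi (L : R) : 0 < L -> 1 - m2 / L ^+ 2 <= cdf_of L.
Proof.
move=> L0; apply: le_cdf => g cg g0 g1; rewrite lerBlDr -lerBlDl.
have c1 := cont_bounded_cst 1.
have -> : 1 - Lam g = Lam (fun x => 1 * 1 + (-1) * g x) by rewrite Lam_lin// Lam1 mul1r mulN1r.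
rewrite [leRHS]mulrC; apply: Lam_tight; first exact: cont_bounded_lin.
  by rewrite invr_ge0 exprn_ge0 ?(ltW L0).
move=> y; rewrite mulr1 mulN1r; have [yL|yL] := leP y L.
  apply: (@le_trans _ _ 0); first by rewrite subr_le0 g1.
  by rewrite mulr_ge0 ?sqr_ge0// invr_ge0 exprn_ge0// ltW.
apply: (@le_trans _ _ 1); first by rewrite lerBlDr lerDl.
rewrite mulrC ler_pdivlMr ?exprn_gt0// mul1r.
by rewrite lerXn2r ?nnegrE ?(ltW L0)// ?(ltW yL)// (le_trans (ltW L0) (ltW yL)).
Qed.

Let m2_ge0 : 0 <= m2.
Proof.
rewrite -[m2]mul1r -(Lam_cst 0); apply: Lam_tight => // [|x]; first exact: cont_bounded_cst.
by rewrite mul1r sqr_ge0.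
Qed.

Let small e : 0 < e -> exists2 L : R, 0 < L & m2 / L ^+ 2 <= e.
Proof.
move=> e0; exists (1 + m2 / e); first by rewrite ltr_wpDr// divr_ge0// ltW.
have L1 : 1 <= 1 + m2 / e by rewrite lerDl divr_ge0// ltW.
have L0 : 0 < 1 + m2 / e by rewrite (lt_le_trans _ L1).
rewrite ler_pdivrMr ?exprn_gt0// (@le_trans _ _ (e * (1 + m2 / e)))//.
  by rewrite mulrDr mulr1 mulrCA mulfV ?gt_eqF// mulr1 lerDr ltW.
by rewrite ler_wpM2l ?(ltW e0)// expr2 ler_peMl// ltW.
Qed.

Let cdf_cvgNy : cdf_of @ -oo --> (0 : R).
Proof.
apply/cvgrPdist_le => e e0; have [L L0 Le] := small e0.
exists (- L - 1); split; first by rewrite num_real.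
move=> x xL; rewrite /= sub0r normrN ger0_norm//.
by rewrite (le_trans (cdf_nd (ltW xL)))// (le_trans (cdf_lo L0)).
Qed.

Let cdf_cvgy : cdf_of @ +oo --> (1 : R).
Proof.
apply/cvgrPdist_le => e e0; have [L L0 Le] := small e0.
exists L; split; first by rewrite num_real.
move=> x xL; rewrite /= ger0_norm ?subr_ge0// lerBlDr -lerBlDl.
rewrite (le_trans _ (cdf_nd (ltW xL)))// (le_trans _ (cdf_hi L0))//.
by rewrite lerD2l lerN2.
Qed.

Let riesz_cdf : exists mu, forall x, mu `]-oo, x]%classic = (cdf_of x)%:E.
Proof.
pose C1 := isCumulative.Build R _ R cdf_of cdf_nd cdf_rc.
pose C2 := isCumulativeBounded.Build R 0 1 cdf_of cdf_cvgNy cdf_cvgy.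
pose F : cumulativeBounded (0:R) (1:R) := HB.pack cdf_of C1 C2.
exists (lebesgue_stieltjes_measure F) => x.
exact: (cdf_lebesgue_stieltjes_id F x).
Qed.

(** Positivity alone would let mass escape to infinity; the second-moment bound [Lam_tight] prevents
    it. The Stieltjes measure of [cdf_of] and the functional are squeezed by the same distribution
    function. *)
Lemma riesz : exists mu, forall f, cont_bounded f -> \int[mu]_y f y = Lam f.
Proof.
have [mu Hmu] := riesz_cdf; exists mu => f cf.
apply: (pos_functional_eq (F := cdf_of) (pos_functional_integral mu) PLam) => //.
- move=> b b' bb; have cr := cont_bounded_ramp b b'; apply/andP; split.
    rewrite -[cdf_of b]/(fine (cdf_of b)%:E) -Hmu; apply: itv_le_integral => // [y|y yb].
      exact: ramp_ge0.
    by rewrite ramp1.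
  rewrite -[cdf_of b']/(fine (cdf_of b')%:E) -Hmu; apply: integral_le_itv => // [y|y yb].
    exact: ramp_le1.
  by rewrite ramp0// ltW.
- move=> b b' bb; have cr := cont_bounded_ramp b b'; apply/andP; split.
    by apply: cdf_lb => // [y|y yb]; [exact: ramp_ge0|rewrite ramp1].
  apply: le_cdf => g cg g0 g1; apply: Lam_le => // y; have [yb|yb] := leP y b'.
    by rewrite (le_trans (ramp_le1 _ _ _))// g1.
  by rewrite ramp0 ?g0// ltW.
- move=> e e0; have [L L0 HL] := small e0; exists (L + 1); first by rewrite addr_gt0.
  rewrite opprD (le_trans (cdf_lo L0))//; split=> //.
  apply: le_trans (cdf_nd (_ : L <= L + 1)); last by rewrite lerDl.
  by rewrite (le_trans _ (cdf_hi L0))// lerD2l lerN2.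
Qed.

End functional.

(** A ramp compares one measure of a half-line with the other measure of a slightly longer one; the
    excess shrinks to nothing, and the roles are exchangeable. *)
Lemma probability_eq_cont_bounded mu nu :
  (forall f, cont_bounded f -> \int[mu]_y f y = \int[nu]_y f y) ->
  forall A, measurable A -> mu A = nu A.
Proof.
have half (P Q : probability (measurableTypeR R) R) :
    (forall f, cont_bounded f -> \int[P]_y f y = \int[Q]_y f y) ->
    forall x, (P `]-oo, x]%classic <= Q `]-oo, x]%classic)%E.
  move=> PQ x; pose G n := (`]-oo, x + n.+1%:R^-1]%classic : set (measurableTypeR R)).
  have capG : \bigcap_n G n = `]-oo, x]%classic by rewrite -itvNycEbigcap.
  have : (Q \o G) n @[n --> \oo] --> Q (\bigcap_n G n).
    apply: nonincreasing_cvg_mu => [||| m n mn].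
    - apply: (@le_lt_trans _ _ 1%E); last exact: ltry.
      by apply: probability_le1; exact: measurable_itv.
    - by move=> n; exact: measurable_itv.
    - by rewrite capG; exact: measurable_itv.
    - by apply/subsetPset; apply: subset_itvl; rewrite bnd_simp lerD2l lef_pV2 ?posrE// ler_nat.
  rewrite capG => cvgQ; apply: (cvge_to_ge cvgQ).
  apply: nearW => n /=.
  have xn : x < x + n.+1%:R^-1 by rewrite ltrDl.
  have cr := cont_bounded_ramp x (x + n.+1%:R^-1).
  rewrite -[leLHS]fineK; last by apply: fin_num_measure; exact: measurable_itv.
  rewrite -[leRHS]fineK; last by apply: fin_num_measure; exact: measurable_itv.
  rewrite lee_fin.
  apply: (@le_trans _ _ (\int[P]_y ramp x (x + n.+1%:R^-1) y)).
    by apply: itv_le_integral => // [y|y yx]; [exact: ramp_ge0|rewrite ramp1].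
  rewrite PQ//; apply: integral_le_itv => // [y|y yx]; first exact: ramp_le1.
  by rewrite ramp0// ltW.
move=> h; apply: eq_probability_itv => x; apply/eqP; rewrite eq_le !half// => f cf.
by rewrite h.
Qed.

End riesz.

(** * Moment problem and convergence of averages *)

Section moment_problem.
Local Open Scope classical_set_scope.
Local Open Scope ring_scope.
Variable R : realType.
Implicit Types (f g : R -> R) (mu nu : probability (measurableTypeR R) R) (m : nat -> R)
  (p Q K : {poly R}) (L : (R -> R) -> R).

(** For a moment sequence this makes the exponential generating function of the even moments
    converge everywhere. *)
Definition entire_moments m := (forall k, 0 <= m k.*2) /\
  forall s e : R, 0 < e ->
    exists n0, forall n, (n0 <= n)%N -> s ^+ n.*2 * m n.*2 / (n.*2)`!%:R <= e.

Lemma entire_poly_approx m f : entire_moments m -> cont_bounded f -> poly_approx m f.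
Proof. by move=> [m0 me] [cf [M fM]]; exact: (poly_approx_bounded m0 me cf fM). Qed.

(** Stated for all functions, monomials included, since the examples are finite weighted sums of
    point evaluations. *)
Definition averaging L := [/\ forall f g a b, L (fun x => a * f x + b * g x) = a * L f + b * L g,
  forall f g, (forall x, f x <= g x) -> L f <= L g & L (fun=> 1) = 1].

Section averaging.
Variable L : (R -> R) -> R.
Hypothesis HL : averaging L.

Lemma averaging_lin f g a b : L (fun x => a * f x + b * g x) = a * L f + b * L g.
Proof. by have [h _ _] := HL; exact: h. Qed.

Lemma averaging_le f g : (forall x, f x <= g x) -> L f <= L g.
Proof. by have [_ h _] := HL; exact: h. Qed.

Lemma averaging1 : L (fun=> 1) = 1.
Proof. by have [_ _ h] := HL. Qed.

Lemma averagingZ f a : L (fun x => a * f x) = a * L f.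
Proof.
rewrite -[RHS]addr0 -[X in _ + X](mul0r (L f)) -averaging_lin.
by congr L; apply: funext => x; rewrite mul0r addr0.
Qed.

Lemma averagingB f g : L (fun x => f x - g x) = L f - L g.
Proof.
rewrite -[L f]mul1r -[- L g]mulN1r -averaging_lin.
by congr L; apply: funext => x; rewrite mul1r mulN1r.
Qed.

Lemma averaging_cst c : L (fun=> c) = c.
Proof.
rewrite -[RHS]mulr1 -averaging1 -averagingZ.
by congr L; apply: funext => x; rewrite mulr1.
Qed.

Lemma averaging_poly p : L (fun x => p.[x]) = mom_pairing (fun k => L (fun x => x ^+ k)) p.
Proof.
have -> : (fun x => p.[x]) = (fun x => \sum_(i < size p) p`_i * x ^+ i).
  by apply: funext => x; rewrite horner_coef.
rewrite /mom_pairing; elim: (size p) => [|n IH].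
  rewrite big_ord0 -[RHS](averaging_cst 0); congr L; apply: funext => x.
  by rewrite big_ord0.
rewrite big_ord_recr /= -IH -[X in X + _]mul1r -averaging_lin.
by congr L; apply: funext => x; rewrite big_ord_recr mul1r.
Qed.

Lemma averaging_near f g h : (forall x, `|f x - g x| <= h x) -> `|L f - L g| <= L h.
Proof.
move=> H; rewrite -averagingB ler_norml; apply/andP; split.
  rewrite -[- L h]mulN1r -averagingZ; apply: averaging_le => x.
  by have := H x; rewrite ler_norml mulN1r => /andP[].
by apply: averaging_le => x; exact: le_trans (ler_norm _) (H x).
Qed.

Lemma averaging_approx f Q K : (forall x, `|f x - Q.[x]| <= K.[x]) ->
  `|L f - mom_pairing (fun k => L (fun x => x ^+ k)) Q| <=
  mom_pairing (fun k => L (fun x => x ^+ k)) K.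
Proof. by move=> H; rewrite -!averaging_poly; exact: averaging_near. Qed.

End averaging.

Lemma cvg_mom_pairing (F : nat -> nat -> R) m p : (forall k, F n k @[n --> \oo] --> m k) ->
  mom_pairing (F n) p @[n --> \oo] --> mom_pairing m p.
Proof.
move=> H; rewrite /mom_pairing; elim: (size p) => [|k IH].
  by rewrite big_ord0; under eq_fun do rewrite big_ord0; exact: cvg_cst.
rewrite big_ord_recr /=; under eq_fun do rewrite big_ord_recr /=.
by apply: cvgD => //; apply: cvgMr.
Qed.

Section limit.
Variables (L : nat -> (R -> R) -> R) (m : nat -> R).
Hypothesis HL : forall n, averaging (L n).
Hypothesis Hm : forall k, L n (fun x => x ^+ k) @[n --> \oo] --> m k.
Hypothesis em : entire_moments m.

(** The values on [f] are eventually within [e] of one number, the pairing with [Q]: a Cauchy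
    argument that presupposes no limit measure. *)
Lemma averaging_cvg f : cont_bounded f -> cvgn (fun n => L n f).
Proof.
move=> cf; apply: cauchy_cvg; apply: cauchy_exP => e e0.
have e30 : 0 < e / 4 by rewrite divr_gt0.
have [Q [K [QK Ke]]] := entire_poly_approx em cf e30.
exists (mom_pairing m Q).
have /cvgrPdist_le/(_ _ e30) HQ := cvg_mom_pairing (F := fun n k => L n (fun x => x ^+ k)) (p := Q) Hm.
have /cvgrPdist_le/(_ _ e30) HK := cvg_mom_pairing (F := fun n k => L n (fun x => x ^+ k)) (p := K) Hm.
suff : \forall n \near \oo, ball (mom_pairing m Q) e (L n f) by [].
near=> n; rewrite /ball /=.
have h1 : `|mom_pairing m Q - mom_pairing (fun k => L n (fun x => x ^+ k)) Q| <= e / 4.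
  by near: n.
have : `|mom_pairing m K - mom_pairing (fun k => L n (fun x => x ^+ k)) K| <= e / 4.
  by near: n.
have := averaging_approx (HL n) QK; rewrite !ler_norml in h1 *.
by rewrite ltr_norml; lra.
Unshelve. all: by end_near. Qed.

Definition limit_functional f : R := lim (L n f @[n --> \oo]).

Lemma limit_functional_cvg f : cont_bounded f -> L n f @[n --> \oo] --> limit_functional f.
Proof. exact: averaging_cvg. Qed.

Lemma limit_functional_pos : pos_functional limit_functional.
Proof.
split=> [f g a b cf cg|f g cf cg fg|].
- apply/cvg_lim => //; under eq_fun do rewrite (averaging_lin (HL _)).
  by apply: cvgD; apply: cvgMr; exact: limit_functional_cvg.
- apply: ler_lim; [exact: averaging_cvg|exact: averaging_cvg|].
  by apply: nearW => n; exact: averaging_le.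
- apply/cvg_lim => //; under eq_fun do rewrite (averaging1 (HL _)); exact: cvg_cst.
Qed.

Lemma limit_functional_le f c k : cont_bounded f -> (forall x, f x <= c * x ^+ k) ->
  limit_functional f <= c * m k.
Proof.
move=> cf fc; apply: (ler_cvg_to (limit_functional_cvg cf)); first by apply: cvgMr; exact: Hm.
by apply: nearW => n; rewrite -(averagingZ (HL n)); exact: averaging_le.
Qed.

Lemma limit_functional_near f c j k : cont_bounded f -> (forall x, `|x ^+ j - f x| <= c * x ^+ k) ->
  `|m j - limit_functional f| <= c * m k.
Proof.
move=> cf fc.
have C : `|L n (fun x => x ^+ j) - L n f| @[n --> \oo] --> `|m j - limit_functional f|.
  by apply: cvg_norm; apply: cvgB => //; exact: limit_functional_cvg.
apply: (ler_cvg_to C); first by apply: cvgMr; exact: Hm.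
by apply: nearW => n; rewrite -(averagingZ (HL n)); exact: averaging_near.
Qed.

Lemma truncated_cont_bounded (B : R) k : 0 <= B ->
  cont_bounded (fun x => Num.max (- B) (Num.min B (x ^+ k))).
Proof.
move=> B0; split.
  have c0 : continuous (fun x : R => x ^+ k) by exact: exprn_continuous.
  have c1 : continuous (cst B \min (fun x : R => x ^+ k)).
    by move=> x; apply: (@continuous_min R R); [exact: cvg_cst|exact: c0].
  have c2 : continuous (cst (- B) \max (cst B \min (fun x : R => x ^+ k))).
    by move=> x; apply: (@continuous_max R R); [exact: cvg_cst|exact: c1].
  exact: c2.
exists B => x; rewrite ler_norml le_max lexx /= ge_max ge_min lexx /= andbT.
by rewrite (le_trans _ B0)// oppr_le0.
Qed.

Lemma truncated_near (B y : R) : 0 < B -> `|y - Num.max (- B) (Num.min B y)| <= B^-1 * y ^+ 2.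
Proof.
move=> B0; have r0 : 0 <= B^-1 * y ^+ 2 by rewrite mulr_ge0 ?sqr_ge0// invr_ge0 ltW.
rewrite mulrC ler_pdivlMr//; have [yB|yB] := leP B y.
  rewrite max_r; last by rewrite (le_trans _ (ltW B0))// oppr_le0 ltW.
  by rewrite ger0_norm ?subr_ge0//; nra.
have [By|By] := leP (- B) y; first by rewrite subrr normr0 mul0r sqr_ge0.
by rewrite ler0_norm; nra.
Qed.

(** The representation only knows bounded functions. Truncated powers give the integrability of even
    powers by monotone convergence; truncating at level [B] then costs at most 1/B times the next
    even moment, both in the limit and under [mu]. *)
Lemma moment_existence : exists mu, moments_finite mu /\ forall k, moment mu k = (m k)%:E.
Proof.
have [mu Hmu] : exists mu, forall f, cont_bounded f -> \int[mu]_y f y = limit_functional f.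
  apply: (@riesz _ limit_functional limit_functional_pos (m 2%N)) => f c cf _ fc.
  exact: limit_functional_le.
pose tr B k x : R := Num.max (- B) (Num.min B (x ^+ k)).
have mX k : measurable_fun [set: measurableTypeR R] (fun x : R => x ^+ k).
  by apply: continuous_measurable_fun; exact: exprn_continuous.
have intT B k : 0 <= B -> mu.-integrable setT (EFin \o tr B k).
  by move=> B0; apply: integrable_cont_bounded; exact: truncated_cont_bounded.
have even_le k : (\int[mu]_x (x ^+ k.*2)%:E <= (m k.*2)%:E)%E.
  have x0 (x : R) : 0 <= x ^+ k.*2 by rewrite -muln2 exprM sqr_ge0.
  have trE n x : tr n%:R k.*2 x = Num.min n%:R (x ^+ k.*2).
    by rewrite /tr max_r// le_min (le_trans _ (x0 x)) ?oppr_le0// andbT ge0_cp.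
  pose g (n : nat) (x : measurableTypeR R) := (tr n%:R k.*2 x)%:E.
  have cvg_g (x : measurableTypeR R) : limn (g^~ x) = (x ^+ k.*2)%:E.
    apply/cvg_lim => //; apply: cvg_near_cst; near=> n.
    by rewrite /g trE min_r//; near: n; exact: nbhs_infty_ger.
  have := @cvg_monotone_convergence _ (measurableTypeR R) R mu setT measurableT g.
  under eq_integral do rewrite cvg_g.
  move=> /(_ _ _ _)/cvge_to_le; apply.
  - by move=> n; exact: (measurable_int mu (intT _ _ (ler0n _ _))).
  - by move=> n x _; rewrite /g lee_fin trE le_min ler0n x0.
  - by move=> x _ n n' nn; rewrite /g lee_fin !trE le_min2// ler_nat.
  - apply: nearW => n; rewrite -[leLHS]fineK; last exact: integrable_fin_num (intT _ _ _).
    rewrite lee_fin -/(Rintegral mu setT (tr n%:R k.*2)) Hmu; last exact: truncated_cont_bounded.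
    rewrite -[leRHS]mul1r; apply: limit_functional_le; first exact: truncated_cont_bounded.
    by move=> x; rewrite -/(tr _ _ x) trE mul1r ge_min lexx orbT.
have int_even k : mu.-integrable setT (fun x : R => (x ^+ k.*2)%:E).
  apply/integrableP; split; first exact/measurable_EFinP.
  rewrite (le_lt_trans _ (ltry (m k.*2)))// (le_trans _ (even_le k))//.
  apply: ge0_le_integral => //.
  - by apply/measurable_EFinP; apply: measurableT_comp => //; exact/measurable_EFinP.
  - exact/measurable_EFinP.
  - by move=> x _; rewrite lee_fin /= ger0_norm// -muln2 exprM sqr_ge0.
(* All powers, odd ones included, are dominated through |y| <= 1 + y^2 with [y = x ^+ k]. *)
have mf : moments_finite mu.
  move=> k; have I1 : mu.-integrable setT (fun x : R => ((1 + x ^+ k.*2)%:E)).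
    under eq_fun do rewrite EFinD.
    by apply: integrableD => //; exact: (integrable_cont_bounded mu (cont_bounded_cst 1)).
  apply: (le_integrable measurableT _ _ I1); first exact/measurable_EFinP.
  move=> x _; rewrite lee_fin [leRHS]ger0_norm; last first.
    by rewrite addr_ge0// -muln2 exprM sqr_ge0.
  rewrite -muln2 exprM; move: (x ^+ k) => y.
  rewrite -[y ^+ 2]real_normK ?num_real//; move: (normr_ge0 y) => {}; nra.
exists mu; split=> // k.
rewrite /moment -[LHS]fineK; last exact: integrable_fin_num (mf k).
congr (_%:E); apply/eqP; rewrite -subr_eq0 -normr_le0; apply/ler_addgt0Pr => e e0; rewrite add0r.
pose B := 1 + 2 * m k.*2 / e.
have m0 : 0 <= m k.*2 by have [h _] := em.
have B0 : 0 < B by rewrite ltr_wpDr// divr_ge0 ?(ltW e0)// mulr_ge0.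
have cT : cont_bounded (tr B k) by exact/truncated_cont_bounded/ltW.
have Bm : B^-1 * m k.*2 <= e / 2.
  rewrite mulrC ler_pdivrMr// /B mulrDr mulr1.
  rewrite (_ : e / 2 * (2 * m k.*2 / e) = m k.*2) ?lerDr ?divr_ge0 ?(ltW e0)//.
  by field; rewrite gt_eqF.
have h1 : `|m k - limit_functional (tr B k)| <= e / 2.
  apply: le_trans Bm; apply: limit_functional_near => // x.
  by rewrite -muln2 exprM; exact: truncated_near.
have iT : mu.-integrable setT (EFin \o tr B k) by exact/intT/ltW.
have iB : mu.-integrable setT (EFin \o (fun x => x ^+ k - tr B k x)).
  exact: (integrableB measurableT (mf k) iT).
have h2 : `|\int[mu]_x (x ^+ k) - \int[mu]_x tr B k x| <= e / 2.
  rewrite -RintegralB//; last exact: mf.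
  apply: le_trans (le_normr_Rintegral _ iB) _ => //.
  have Z : mu.-integrable setT (EFin \o (fun x : R => B^-1 * x ^+ k.*2)).
    by apply: (integrableZl measurableT B^-1 (int_even k)).
  apply: (@le_trans _ _ (\int[mu]_x (B^-1 * x ^+ k.*2))).
    apply: le_Rintegral => //.
      exact: (integrable_norm iB).
    by move=> x _; rewrite -muln2 exprM; exact: truncated_near.
  rewrite RintegralZl//; last exact: int_even.
  apply: le_trans Bm; rewrite ler_wpM2l ?invr_ge0 ?(ltW B0)//.
  by rewrite -lee_fin fineK//; exact: integrable_fin_num (int_even k).
rewrite (Hmu _ cT) in h2; rewrite -/(Rintegral mu setT (fun x => x ^+ k)).
rewrite -[X in `|X|](subrKA (limit_functional (tr B k))) [e]splitr.
by rewrite (le_trans (ler_normD _ _))// lerD// distrC.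
Unshelve. all: by end_near. Qed.

End limit.

Section probability.
Variables (mu : probability (measurableTypeR R) R) (m : nat -> R).
Hypothesis mf : moments_finite mu.
Hypothesis mm : forall k, moment mu k = (m k)%:E.

Lemma integrable_poly p : mu.-integrable setT (EFin \o horner p).
Proof.
have -> : horner p = (fun x => \sum_(i < size p) p`_i * x ^+ i).
  by apply: funext => x; rewrite horner_coef.
elim: (size p) => [|n IH].
  by under eq_fun do rewrite big_ord0; exact: (integrable_cont_bounded mu (cont_bounded_cst 0)).
under eq_fun do rewrite big_ord_recr /=.
have Z : mu.-integrable setT (EFin \o (fun x : R => p`_n * x ^+ n)).
  exact: (integrableZl measurableT p`_n (mf n)).
exact: (integrableD measurableT IH Z).
Qed.

Lemma Rintegral_poly p : \int[mu]_x p.[x] = mom_pairing m p.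
Proof.
have -> : horner p = (fun x => \sum_(i < size p) p`_i * x ^+ i).
  by apply: funext => x; rewrite horner_coef.
rewrite /mom_pairing; suff H n : mu.-integrable setT (EFin \o (fun x : R => \sum_(i < n) p`_i * x ^+ i)) /\
    \int[mu]_x (\sum_(i < n) p`_i * x ^+ i) = \sum_(i < n) p`_i * m i by have [] := H (size p).
elim: n => [|n [I IH]].
  have e0 : (fun x : R => \sum_(i < 0) p`_i * x ^+ i) = (fun=> 0).
    by apply: funext => x; rewrite big_ord0.
  rewrite e0 big_ord0; split; first exact: (integrable_cont_bounded mu (cont_bounded_cst 0)).
  by rewrite Rintegral_cst ?mul0r.
under eq_fun do rewrite big_ord_recr /=; rewrite big_ord_recr /= -IH.
have Z : mu.-integrable setT (EFin \o (fun x : R => p`_n * x ^+ n)).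
  exact: (integrableZl measurableT p`_n (mf n)).
have e1 : \int[mu]_x (p`_n * x ^+ n) = p`_n * m n.
  rewrite RintegralZl//; last exact: mf.
  by congr (_ * _); have := mm n; rewrite /moment /Rintegral => ->.
split; first exact: (integrableD measurableT I Z).
by rewrite RintegralD// e1.
Qed.

Lemma Rintegral_approx f Q K : cont_bounded f -> (forall x, `|f x - Q.[x]| <= K.[x]) ->
  `|\int[mu]_x f x - mom_pairing m Q| <= mom_pairing m K.
Proof.
move=> cf H; rewrite -!Rintegral_poly.
have If := integrable_cont_bounded mu cf; have IQ := integrable_poly Q.
rewrite -RintegralB//.
have IB : mu.-integrable setT (EFin \o (fun x : R => f x - Q.[x])).
  exact: (integrableB measurableT If IQ).
apply: le_trans (le_normr_Rintegral _ IB) _ => //.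
apply: le_Rintegral => //; first exact: (integrable_norm IB).
exact: integrable_poly.
Qed.

End probability.

(** Two measures with these moments evaluate [f] within the same small error of the pairing with
    [Q]. *)
Lemma entire_moment_determinate mu m : moments_finite mu -> (forall k, moment mu k = (m k)%:E) ->
  entire_moments m -> moment_determinate mu.
Proof.
move=> mf mm em; split=> // nu nf nm; apply: probability_eq_cont_bounded => f cf.
apply/eqP; rewrite -subr_eq0 -normr_le0; apply/ler_addgt0Pr => e e0; rewrite add0r.
have e20 : 0 < e / 2 by rewrite divr_gt0.
have [Q [K [QK Ke]]] := entire_poly_approx em cf e20.
have h1 := Rintegral_approx mf mm cf QK.
have h2 := Rintegral_approx nf (fun k => etrans (nm k) (mm k)) cf QK.
rewrite -(subrKA (mom_pairing m Q)) (le_trans (ler_normD _ _))// [e]splitr lerD//.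
  exact: le_trans h2 Ke.
by rewrite distrC (le_trans h1).
Qed.

Lemma finite_markov (T : finType) (pr g : T -> R) (t : R) : (forall h, 0 <= pr h) -> 0 < t ->
  (forall h, 0 <= g h) -> \sum_(h | t < g h) pr h <= t^-1 * \sum_h pr h * g h.
Proof.
move=> pr0 t0 g0; rewrite mulrC ler_pdivlMr// mulr_suml.
rewrite big_mkcond /=; apply: ler_sum => h _; case: ltP => tg.
  by rewrite ler_wpM2l// ltW.
by rewrite mulr_ge0.
Qed.

(** * Concentration from the first two moments *)

Section concentration.
Variables (T : nat -> finType) (pr : forall n, T n -> R) (L : forall n, T n -> (R -> R) -> R).
Variable m : nat -> R.
Hypothesis pr0 : forall n h, 0 <= @pr n h.
Hypothesis pr1 : forall n, \sum_(h : T n) @pr n h = 1.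
Hypothesis HL : forall n h, averaging (@L n h).
Hypothesis em : entire_moments m.
Let x_ k n (h : T n) := L h (fun x => x ^+ k).
Hypothesis Hm : forall k, \sum_(h : T n) pr h * x_ k h @[n --> \oo] --> m k.
Hypothesis Hm2 : forall k, \sum_(h : T n) pr h * x_ k h ^+ 2 @[n --> \oo] --> m k ^+ 2.

Lemma mean_deviation k : \sum_(h : T n) pr h * `|x_ k h - m k| @[n --> \oo] --> (0 : R).
Proof.
have D2 : \sum_(h : T n) pr h * (x_ k h - m k) ^+ 2 @[n --> \oo] --> (0 : R).
  have E n : \sum_(h : T n) @pr n h * (x_ k h - m k) ^+ 2 =
      \sum_(h : T n) pr h * x_ k h ^+ 2 - 2 * m k * (\sum_(h : T n) pr h * x_ k h) + m k ^+ 2.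
    rewrite -[X in _ + X]mul1r -[X in _ + X * _](pr1 n) mulr_suml mulr_sumr -sumrN -!big_split /=.
    by apply: eq_bigr => h _; ring.
  rewrite [X in _ --> X](_ : _ = m k ^+ 2 - 2 * m k * m k + m k ^+ 2); last by ring.
  under eq_fun do rewrite E.
  by apply: cvgD; [apply: cvgB => //; exact: cvgMr|exact: cvg_cst].
apply/cvgrPdist_le => e e0; have e20 : 0 < (e / 2) ^+ 2 by rewrite exprn_gt0// divr_gt0.
have /cvgrPdist_le/(_ _ e20) H2 := D2; near=> n.
have P0 : 0 <= \sum_(h : T n) @pr n h * `|x_ k h - m k| by apply: sumr_ge0 => h _; rewrite mulr_ge0.
have : `|0 - \sum_(h : T n) @pr n h * (x_ k h - m k) ^+ 2| <= (e / 2) ^+ 2 by near: n.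
rewrite !sub0r !normrN !ger0_norm//; last by apply: sumr_ge0 => h _; rewrite mulr_ge0// sqr_ge0.
(* The elementary inequality y <= d + y^2 / d with [d = e / 2] passes from the variance to the mean
   deviation. *)
move=> h2; apply: (@le_trans _ _ (\sum_(h : T n) @pr n h * (e / 2 + (x_ k h - m k) ^+ 2 / (e / 2)))).
  apply: ler_sum => h _; rewrite ler_wpM2l//; rewrite -[(_ - _) ^+ 2]real_normK ?num_real//.
  move: `|_| (normr_ge0 (x_ k h - m k)) => y y0.
  have d0 : 0 < e / 2 by rewrite divr_gt0.
  move: (e / 2) d0 => d d0; rewrite -(ler_pM2r d0) mulrDl mulfVK ?gt_eqF//.
  nra.
have -> : \sum_(h : T n) @pr n h * (e / 2 + (x_ k h - m k) ^+ 2 / (e / 2)) =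
    e / 2 + (\sum_(h : T n) pr h * (x_ k h - m k) ^+ 2) / (e / 2).
  under eq_bigr do rewrite mulrDr mulrA; rewrite big_split /= -!mulr_suml pr1 mul1r//.
rewrite [leRHS]splitr lerD2l ler_pdivrMr ?divr_gt0//; exact: h2.
Unshelve. all: by end_near. Qed.

Lemma mean_deviation_poly p : \sum_(h : T n) pr h * `|mom_pairing (fun k => x_ k h) p - mom_pairing m p|
  @[n --> \oo] --> (0 : R).
Proof.
have H (c : nat -> R) N : \sum_(h : T n) pr h * `|\sum_(i < N) c i * x_ i h - \sum_(i < N) c i * m i|
    @[n --> \oo] --> (0 : R).
  elim: N => [|N IH].
    apply: cvg_near_cst; apply: nearW => n; apply: big1 => h _.
    by rewrite !big_ord0 subrr normr0 mulr0.
  apply: (@squeeze_cvgr _ _ _ _ (fun=> 0)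
    (fun n => \sum_(h : T n) pr h * `|\sum_(i < N) c i * x_ i h - \sum_(i < N) c i * m i| +
     `|c N| * \sum_(h : T n) @pr n h * `|x_ N h - m N|)); first apply: nearW => n; last 2 first.
  - exact: cvg_cst.
  - rewrite -[X in _ --> X]addr0; apply: cvgD => //; rewrite -[X in _ --> X](mulr0 `|c N|).
    by apply: cvgMr; exact: mean_deviation.
  apply/andP; split; first by apply: sumr_ge0 => h _; rewrite mulr_ge0.
  rewrite mulr_sumr -big_split /=; apply: ler_sum => h _.
  rewrite mulrCA -mulrDr ler_wpM2l// -normrM !big_ord_recr /=.
  by rewrite (le_trans _ (ler_normD _ _))// mulrBr addrACA opprD.
exact: H.
Qed.

(** The hypothesis on [I] holds for the integral of [f] against any measure with moments [m], which
    treats both limit laws alike. A deviation above [eps] forces the pairings with [Q] and [K] to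
    deviate by more than [eps / 2] in total, and Markov's inequality applies. *)
Lemma concentration f (I : R) : cont_bounded f ->
  (forall Q K, (forall x, `|f x - Q.[x]| <= K.[x]) -> `|I - mom_pairing m Q| <= mom_pairing m K) ->
  forall eps, 0 < eps -> \sum_(h : T n | eps < `|L h f - I|) @pr n h @[n --> \oo] --> (0 : R).
Proof.
move=> cf HI eps eps0; have e40 : 0 < eps / 4 by rewrite divr_gt0.
have [Q [K [QK Ke]]] := entire_poly_approx em cf e40.
pose D p n (h : T n) := `|mom_pairing (fun k => x_ k h) p - mom_pairing m p|.
apply: (@squeeze_cvgr _ _ _ _ (fun=> 0)
    (fun n => (eps / 2)^-1 * (\sum_(h : T n) pr h * D K n h + \sum_(h : T n) pr h * D Q n h)));
    first apply: nearW => n; last 2 first.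
- exact: cvg_cst.
- rewrite -[X in _ --> X](mulr0 (eps / 2)^-1); apply: cvgMr.
  by rewrite -[X in _ --> X]addr0; apply: cvgD; exact: mean_deviation_poly.
apply/andP; split; first by apply: sumr_ge0.
rewrite -big_split /=; under [in leRHS]eq_bigr do rewrite -mulrDr.
apply: le_trans (finite_markov (pr0 (n := n)) (_ : 0 < eps / 2) _); last 2 first.
- by rewrite divr_gt0.
- by move=> h; rewrite addr_ge0 ?normr_ge0.
rewrite [leLHS]big_mkcond [leRHS]big_mkcond; apply: ler_sum => h _.
case: ltP => lt1; case: ltP => lt2 //.
exfalso; move: lt1; apply/negP; rewrite -leNgt.
have h1 := averaging_approx (HL h) QK; have h2 := HI _ _ QK.
move: lt2; rewrite /D.
have h3 : `|L h f - I| <= `|L h f - mom_pairing (fun k => x_ k h) Q| +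
    `|mom_pairing (fun k => x_ k h) Q - mom_pairing m Q| + `|I - mom_pairing m Q|.
  rewrite [`|I - _|]distrC (le_trans _ (lerD (ler_normD _ _) (lexx _)))//.
  by rewrite (le_trans _ (ler_normD _ _))// !subrKA.
have h4 := ler_norm (mom_pairing (fun k => x_ k h) K - mom_pairing m K).
move: h1 h2 h3 h4 Ke; rewrite /x_.
set u := mom_pairing (fun k => L h (fun x => x ^+ k)) Q.
set v := mom_pairing (fun k => L h (fun x => x ^+ k)) K.
by move: (`|L h f - I|) (`|L h f - u|) (`|I - _|) (`|v - _|) (`|u - _|) => A B C D' E; clearbody u v; lra.
Qed.

End concentration.
End moment_problem.

(** * Growth of the limiting moments *)

Section growth.
Local Open Scope classical_set_scope.
Local Open Scope ring_scope.
Variable R : realType.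
Implicit Types (m : nat -> R) (mu : probability (measurableTypeR R) R).

Section touchard.
Variable lam : R.
Hypothesis lam0 : 0 <= lam.

Definition touchard_poly n j : {poly R} :=
  \sum_(k < n) (touchard lam k j / k`!%:R) *: 'X^k.

Lemma touchard_polyE n j t : (touchard_poly n j).[t] = \sum_(k < n) touchard lam k j * t ^+ k / k`!%:R.
Proof.
rewrite /touchard_poly horner_sum; apply: eq_bigr => k _.
by rewrite hornerZ hornerXn mulrAC.
Qed.

Lemma deriv_touchard_poly n j :
  (touchard_poly n.+1 j)^`() = j%:R *: touchard_poly n j + lam *: touchard_poly n j.+1.
Proof.
rewrite /touchard_poly (raddf_sum (@deriv R)) big_ord_recl /= derivZ derivXn mulr0n scaler0 add0r.
rewrite !scaler_sumr -big_split /=; apply: eq_bigr => k _.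
by rewrite /bump /= add1n deriv_mono_fact !scalerA -scalerDl mulrDl !mulrA.
Qed.

(** The right side is the moment generating function of [j] plus a Poisson variable. Both sides obey
    the same differential recursion in [j], so truncations are compared by induction through their
    derivatives. *)
Lemma touchard_poly_le n j t : 0 <= t ->
  (touchard_poly n j).[t] <= expR (j%:R * t) * expR (lam * (expR t - 1)).
Proof.
elim: n j t => [|n IH] j t t0.
  by rewrite /touchard_poly big_ord0 horner0 mulr_ge0 ?expR_ge0.
pose E := (fun u : R => expR (j%:R * u)) * (fun u : R => expR (lam * (expR u - 1))).
rewrite -subr_ge0.
apply: (@nonneg_of_derive R (E - horner (touchard_poly n.+1 j))
  (fun u => (expR (j%:R * u) * (expR (lam * (expR u - 1)) * (lam * expR u)) +
     expR (lam * (expR u - 1)) * (expR (j%:R * u) * j%:R)) - (touchard_poly n.+1 j)^`().[u])) => // [u||u u0].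
- apply: is_deriveB.
  have d1 : is_derive u 1 (fun u : R => j%:R * u) j%:R.
    by have := is_deriveZ j%:R (is_derive_id u 1); rewrite [_ *: 1]mulr1.
  have d2 : is_derive u 1 (fun u : R => lam * (expR u - 1)) (lam * expR u).
    by have := is_deriveZ lam (is_deriveB (is_derive_expR u) (is_derive_cst (1 : R) (u : R) (1 : R))); rewrite subr0.
  have d3 := is_derive1_comp (is_derive_expR _) d1.
  have d4 := is_derive1_comp (is_derive_expR _) d2.
  exact: (is_deriveM d3 d4).
- rewrite -[X in 0 <= X]/(expR (j%:R * 0) * expR (lam * (expR 0 - 1)) - (touchard_poly n.+1 j).[0]).
  rewrite mulr0 expR0 subrr mulr0 expR0.
  rewrite mulr1 touchard_polyE big_ord_recl big1 ?addr0 /= => [|k _].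
    by rewrite expr0 mulr1 fact0 divr1 subrr.
  by rewrite expr0n mulr0 mul0r.
- rewrite deriv_touchard_poly hornerD !hornerZ subr_ge0.
  have h1 := IH j u u0; have := IH j.+1 u u0.
  rewrite -natr1 mulrDl mul1r expRD => h2.
  have := ler_wpM2l (ler0n R j) h1; have := ler_wpM2l lam0 h2.
  move: (expR (lam * (expR u - 1))) (expR (j%:R * u)) (expR u) => a b c; lra.
Qed.

Lemma touchard_le n j t : 0 <= t ->
  touchard lam n j * t ^+ n / n`!%:R <= expR (j%:R * t) * expR (lam * (expR t - 1)).
Proof.
move=> t0; apply: le_trans (touchard_poly_le n.+1 j t0).
rewrite touchard_polyE big_ord_recr /= lerDr sumr_ge0// => k _.
by rewrite !mulr_ge0 ?touchard_ge0 ?exprn_ge0 ?invr_ge0.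
Qed.

Lemma entire_touchard m B j : 0 <= B ->
  (forall k, 0 <= m k.*2 <= B ^+ k.*2 * touchard lam k.*2 j) -> entire_moments m.
Proof.
move=> B0 mB; split=> [k|s e e0]; first by have /andP[] := mB k.
(* The factor 2 leaves a decay 2^(-2n) after the bound at [t]. *)
pose t := 2 * (`|s| * B); have t0 : 0 <= t by rewrite !mulr_ge0.
pose C := expR (j%:R * t) * expR (lam * (expR t - 1)).
have C0 : 0 < C by rewrite mulr_gt0 ?expR_gt0.
exists (Num.bound (C / e)) => n hn.
have hb : C / e <= n%:R.
  apply: ltW; apply: (@lt_le_trans _ _ (Num.bound (C / e))%:R); last by rewrite ler_nat.
  by apply: archi_boundP; rewrite divr_ge0 ?(ltW C0) ?(ltW e0).
have /andP[m0 m1] := mB n.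
have key : s ^+ n.*2 * m n.*2 / (n.*2)`!%:R <= C / 2 ^+ n.*2.
  rewrite ler_pdivlMr ?exprn_gt0//.
  apply: le_trans (touchard_le n.*2 j t0); rewrite mulrAC ler_wpM2r ?invr_ge0//.
  rewrite /t !exprMn.
  have -> : s ^+ n.*2 = `|s| ^+ n.*2 by rewrite -normrX ger0_norm// -muln2 exprM sqr_ge0.
  move: m1; have := exprn_ge0 n.*2 (normr_ge0 s); have : 0 <= (2 : R) ^+ n.*2 by rewrite exprn_ge0.
  move: (`|s| ^+ _) (2 ^+ _) (B ^+ _) (touchard _ _ _) (m _) => S T b u v T0 S0 hv.
  have -> : S * v * T = S * T * v by ring.
  have -> : u * (T * (S * b)) = S * T * (b * u) by ring.
  by rewrite ler_wpM2l// mulr_ge0.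
apply: (le_trans key); rewrite ler_pdivrMr ?exprn_gt0//.
rewrite mulrC -ler_pdivrMr//; apply: (le_trans hb).
rewrite -natrX ler_nat (leq_trans (ltnW (ltn_expl n (ltnSn 1))))// leq_exp2l//.
by rewrite -addnn leq_addr.
Qed.

End touchard.

Section unbounded.
Variables (mu : probability (measurableTypeR R) R) (m : nat -> R).
Hypothesis mf : moments_finite mu.
Hypothesis mm : forall k, moment mu k = (m k)%:E.

Lemma measurable_norm_gt (L : R) : measurable ([set x | L < `|x|] : set (measurableTypeR R)).
Proof.
rewrite (_ : [set x | L < `|x|] = (fun x : R => `|x|) @^-1` `]L, +oo[%classic); last first.
  by apply/seteqP; split => x /=; rewrite in_itv /= andbT.
rewrite -[X in measurable X]setTI; exact: normr_measurable.
Qed.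

(** Each point off the support lies in a null interval with rational endpoints, and there are
    countably many of these. *)
Lemma null_off_support (L : R) : (forall x, measure_support mu x -> `|x| <= L) ->
  mu [set x | L < `|x|] = 0%E.
Proof.
move=> HL.
pose I (r : rat * rat) := (`]ratr r.1, ratr r.2[%classic : set (measurableTypeR R)).
pose F n : set (measurableTypeR R) :=
  if unpickle n is Some r then (if mu (I r) == 0%E then I r else set0) else set0.
have mF n : measurable (F n).
  by rewrite /F; case: unpickle => // r; case: ifP => _ //; exact: measurable_itv.
have F0 n : mu (F n) = 0%E.
  by rewrite /F; case: unpickle => [r|]; rewrite ?measure0//; case: ifP => [/eqP|_]; rewrite ?measure0.
have mU : measurable (\bigcup_n F n) by exact: bigcup_measurable.
have U0 : mu (\bigcup_n F n) = 0%E.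
  apply/eqP; rewrite eq_le measure_ge0 andbT.
  apply: (le_trans (measure_sigma_subadditive mu mF mU (fun x h => h))).
  by rewrite eseries0// => n _ _; exact: F0.
apply/eqP; rewrite eq_le measure_ge0 andbT -U0.
have mN := measurable_norm_gt L.
apply: le_measure; rewrite ?inE// => x /= Lx.
have : ~ measure_support mu x by move=> /HL; rewrite leNgt Lx.
move=> /existsNP[U] /not_implyP[oU] /not_implyP[Ux]; rewrite lt_neqAle measure_ge0 andbT => /negP/negPn/eqP U00.
have /nbhs_ballP[r /= r0 rU] : nbhs x U by apply: open_nbhs_nbhs.
have [q1 /andP[a1 b1]] : exists q : rat, x - r < ratr q < x.
  by have [|q] := @rat_in_itvoo R (x - r) x; [rewrite gtrDl oppr_lt0|rewrite in_itv; exists q].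
have [q2 /andP[a2 b2]] : exists q : rat, x < ratr q < x + r.
  by have [|q] := @rat_in_itvoo R x (x + r); [rewrite ltrDl|rewrite in_itv; exists q].
have IU : I (q1, q2) `<=` U.
  move=> y; rewrite /I /= in_itv /= => /andP[h1 h2]; apply: rU; rewrite /ball /= ltr_norml.
  by apply/andP; split; lra.
have [n nE] : exists n, unpickle n = Some (q1, q2) by exists (pickle (q1, q2)); exact: pickleK.
exists n; first by []; rewrite /F nE.
have -> : mu (I (q1, q2)) == 0%E.
  rewrite eq_le measure_ge0 andbT U00; apply: le_measure; rewrite ?inE//.
    exact: measurable_itv.
  by apply: open_measurable.
by rewrite /I /= in_itv /= b1 a2.
Qed.

Lemma unbounded_support : (forall B : R, 0 <= B -> exists k, B ^+ k.*2 < m k.*2) ->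
  ~ bounded_set (measure_support mu).
Proof.
move=> Hm [M [_ HM]]; pose L := `|M| + 1.
have L0 : 0 <= L by rewrite addr_ge0.
have ML : M < L by rewrite (le_lt_trans (ler_norm M))// ltrDl.
have N0 := null_off_support (fun x sx => HM L ML x sx).
have [k] := Hm L L0; apply/negP; rewrite -leNgt -lee_fin -mm /moment.
set N := [set x | L < `|x|] in N0.
have x0 (x : R) : 0 <= x ^+ k.*2 by rewrite -muln2 exprM sqr_ge0.
have mN : measurable N := measurable_norm_gt L.
rewrite (@negligible_integral _ _ _ mu setT N)//.
apply: (@le_trans _ _ (\int[mu]_(x in setT `\` N) (L ^+ k.*2)%:E)%E).
  apply: ge0_le_integral => //.
  - by apply: measurableD.
  - by move=> x _; rewrite lee_fin.
  - by apply: measurable_funTS; apply: (measurable_int mu); exact: mf.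
  - move=> x [_ /negP]; rewrite /N /= -leNgt => xL.
    by rewrite lee_fin -(ger0_norm (x0 x)) normrX lerXn2r ?nnegrE.
rewrite integral_cst; last exact: measurableD.
rewrite -[leRHS]mule1 lee_wpmul2l ?lee_fin ?exprn_ge0// probability_le1//.
exact: measurableD.
Qed.

End unbounded.

Lemma gw_walks_unbounded (q : nat) (lam a : R) : (0 < q)%N -> 0 < lam -> 0 < a ->
  forall B : R, 0 <= B -> exists k, B ^+ k.*2 < gw_walks (q := q) lam k.*2 [::] None / a ^+ k.*2.
Proof.
move=> q0 lam0 a0 B B0.
(* Once [j] is at least [2 * C] and [2 ^+ k] exceeds [(C / lam) ^+ j], the lower bound
   [lam ^+ j * j%:R ^+ k] exceeds [C ^+ (j + k)]. *)
pose C := (B * a) ^+ 2 + 1; have C0 : 0 < C by rewrite ltr_wpDl// sqr_ge0.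
have [j jC] : exists j : nat, 2 * C <= j%:R.
  exists (Num.bound (2 * C)); apply: ltW; apply: archi_boundP; rewrite mulr_ge0// ltW//.
have [k kC] : exists k : nat, (C / lam) ^+ j < 2 ^+ k.
  exists (Num.bound ((C / lam) ^+ j)).
  apply: (@lt_le_trans _ _ (Num.bound ((C / lam) ^+ j))%:R).
    by apply: archi_boundP; rewrite exprn_ge0// divr_ge0 ?(ltW C0) ?(ltW lam0).
  by rewrite -natrX ler_nat ltnW// ltn_expl.
exists (j + k)%N; rewrite ltr_pdivlMr ?exprn_gt0// -exprMn -muln2 mulnC exprM.
apply: (@le_lt_trans _ _ (C ^+ (j + k))).
  by rewrite lerXn2r ?nnegrE ?sqr_ge0 ?(ltW C0)// lerDl.
rewrite mulnC muln2; apply: lt_le_trans (gw_walks_lower q0 (ltW lam0) j k).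
rewrite exprD; move: kC; rewrite expr_div_n ltr_pdivrMr ?exprn_gt0// => kC.
apply: (@lt_le_trans _ _ (2 ^+ k * lam ^+ j * C ^+ k)); first by rewrite ltr_pM2r ?exprn_gt0.
rewrite mulrC mulrA [leLHS]mulrC ler_wpM2l ?exprn_ge0 ?(ltW lam0)//.
by rewrite -exprMn lerXn2r ?nnegrE ?mulr_ge0 ?(ltW C0)// mulrC.
Qed.

End growth.

(** * The semicircle law and its moments *)

Section semicircle.
Local Open Scope classical_set_scope.
Local Open Scope ring_scope.
Variable R : realType.
Implicit Types (f g : R -> R).
Local Notation leb := (@lebesgue_measure R).

Lemma integrable_segment f (a b : R) : continuous f -> leb.-integrable `[a, b] (EFin \o f).
Proof.
move=> cf; apply: continuous_compact_integrable; first exact: segment_compact.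
exact: continuous_subspaceT.
Qed.

Lemma Rintegral_segment_lin f g (a b u v : R) : continuous f -> continuous g ->
  \int[leb]_(x in `[a, b]) (u * f x + v * g x) =
  u * \int[leb]_(x in `[a, b]) f x + v * \int[leb]_(x in `[a, b]) g x.
Proof.
move=> cf cg; have cZ (w : R) (h : R -> R) : continuous h -> continuous (fun x => w * h x).
  by move=> ch x; apply: cvgMr; exact: ch.
rewrite RintegralD//; [|exact/integrable_segment/cZ|exact/integrable_segment/cZ].
by rewrite !RintegralZl//; exact: integrable_segment.
Qed.

Lemma Rintegral_segment_le f g (a b : R) : continuous f -> continuous g ->
  (forall x, a <= x <= b -> f x <= g x) ->
  \int[leb]_(x in `[a, b]) f x <= \int[leb]_(x in `[a, b]) g x.
Proof.
move=> cf cg fg; apply: le_Rintegral; rewrite ?integrable_segment// => x /=.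
Qed.

Lemma Rintegral_segment_FTC (F f : R -> R) (a b : R) : a < b -> continuous f ->
  (forall x, is_derive x (1 : R) F (f x)) -> \int[leb]_(x in `[a, b]) f x = F b - F a.
Proof.
move=> ab cf dF; have cF : continuous F.
  by move=> x; apply: differentiable_continuous; apply/derivable1_diffP; case: (dF x).
rewrite /Rintegral (@continuous_FTC2 _ f F)//.
- exact: continuous_subspaceT.
- split; first by move=> x _; case: (dF x).
    by apply: cvg_at_right_filter; exact: cF.
  by apply: cvg_at_left_filter; exact: cF.
- by move=> x _; rewrite derive1E; case: (dF x).
Qed.

Lemma continuous_semicircle_pdf : continuous (@semicircle_pdf R).
Proof.
move=> x; rewrite /semicircle_pdf; apply: cvgM; last exact: cvg_cst.
apply: (cvg_comp _ Num.sqrt); last exact: sqrt_continuous.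
by apply: cvgB; [exact: cvg_cst|exact: sqr_continuous].
Qed.

Definition semicircle_mean f : R := \int[leb]_(x in `[-2, 2]) (f x * semicircle_pdf x).

(** Substituting x = 2 cos t turns the density into (2/pi) sin^2 t on [0, pi]. *)
Lemma semicircle_mean_subst f : continuous f ->
  semicircle_mean f = \int[leb]_(t in `[0, pi]) (f (2 * cos t) * (2 / pi * sin t ^+ 2)).
Proof.
move=> cf; rewrite /semicircle_mean /Rintegral.
have pi0 : 0 < pi :> R := pi_gt0 R.
pose F (t : R) := 2 * cos t.
have dF (t : R) : is_derive t 1 F (- 2 * sin t).
  have := is_deriveZ (2 : R) (is_derive_cos t).
  by rewrite (_ : 2 *: - sin t = - 2 * sin t)// /GRing.scale /= mulrN mulNr.
have F' : derive1 F = (fun t => - 2 * sin t).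
  by apply: funext => t; rewrite derive1E; case: (dF t).
have cF : continuous F.
  by move=> x; apply: differentiable_continuous; apply/derivable1_diffP; case: (dF x).
have cF' : continuous (derive1 F).
  by rewrite F' => t; apply: cvgMr; exact: continuous_sin.
have F0 : F 0 = 2 by rewrite /F cos0 mulr1.
have Fpi : F pi = -2 by rewrite /F cospi mulrN1.
have E (t : R) : 0 <= t <= pi ->
    f (F t) * semicircle_pdf (F t) * - (-2 * sin t) = f (2 * cos t) * (2 / pi * sin t ^+ 2).
  move=> tpi; have s0 := sin_ge0_pi tpi; rewrite /semicircle_pdf /F.
  have -> : 4 - (2 * cos t) ^+ 2 = (2 * sin t) ^+ 2.
    by rewrite !exprMn [sin t ^+ 2]sin2cos2; ring.
  rewrite sqrtr_sqr ger0_norm ?mulr_ge0//.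
  by move: pi pi0 => P /lt0r_neq0 P0; field.
have := @integration_by_substitution_decreasing R F (fun x => f x * semicircle_pdf x) 0 pi (ltW pi0).
rewrite F0 Fpi => -> //.
- congr fine; apply: eq_integral => t; rewrite inE /= in_itv /= => tpi.
  by rewrite -E// F'.
- by move=> x y xi yi xy; rewrite /F ltr_pM2l// ltr_cos.
- by apply: cvgP; apply: cvg_at_right_filter; exact: cF'.
- by apply: cvgP; apply: cvg_at_left_filter; exact: cF'.
- split; first by move=> x _; case: (dF x).
    by apply: cvg_at_right_filter; exact: cF.
  by apply: cvg_at_left_filter; exact: cF.
- apply: continuous_subspaceT => x; apply: cvgM; [exact: cf|exact: continuous_semicircle_pdf].
Qed.

Let cos_mul_continuous (n : R) : continuous (fun t : R => cos (n * t)).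
Proof. by move=> t; apply: (@continuous_comp _ _ _ (fun t => n * t) cos); [exact: mulrl_continuous|exact: continuous_cos]. Qed.

Let sin_mul_continuous (n : R) : continuous (fun t : R => sin (n * t)).
Proof. by move=> t; apply: (@continuous_comp _ _ _ (fun t => n * t) sin); [exact: mulrl_continuous|exact: continuous_sin]. Qed.

Lemma Rintegral_cos_nat n : \int[leb]_(t in `[0, pi]) cos (n%:R * t) = if n == 0%N then pi else 0 :> R.
Proof.
have pi0 : 0 < pi :> R := pi_gt0 R.
case: n => [|n] /=.
  have H (x : R) : is_derive x 1 (fun x : R => x) (cos (0 * x)).
    by rewrite mul0r cos0; exact: is_derive_id.
  by rewrite (Rintegral_segment_FTC pi0 (@cos_mul_continuous 0) H) subr0.
have n0 : n.+1%:R != 0 :> R by rewrite pnatr_eq0.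
have H (x : R) : is_derive x 1 (fun t => n.+1%:R^-1 * sin (n.+1%:R * t)) (cos (n.+1%:R * x)).
  have d1 := is_deriveZ (n.+1%:R : R) (is_derive_id (x : R) 1).
  have d2 := is_deriveZ (n.+1%:R^-1 : R) (is_derive1_comp (is_derive_sin _) d1).
  move: d2; rewrite /GRing.scale /= mulr1 (_ : _^-1 * (_ * _) = cos (n.+1%:R * x))//.
  by rewrite mulrC mulfK.
rewrite (Rintegral_segment_FTC pi0 (@cos_mul_continuous n.+1%:R) H).
have -> : sin (n.+1%:R * pi) = 0 :> R.
  elim: n {n0 H} => [|n IH]; first by rewrite mul1r sinpi.
  by rewrite -natr1 mulrDl mul1r sinDpi IH oppr0.
by rewrite !mulr0 sin0 mulr0 subrr.
Qed.

(** The quotient of sin((h+1)t) by sin t is the Chebyshev polynomial of the second kind of degree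
    [h] in cos t. These are orthonormal for the semicircle law, and multiplication by 2 cos t raises
    or lowers [h] by one, as in [ballot]. *)
Lemma chebyshev_moment k h :
  \int[leb]_(t in `[0, pi]) ((2 * cos t) ^+ k * (2 / pi * sin (h.+1%:R * t) * sin t)) = (ballot k h)%:R :> R.
Proof.
have pi0 : pi != 0 :> R by rewrite gt_eqF ?pi_gt0.
have cK (k' h' : nat) : continuous (fun t : R => (2 * cos t) ^+ k' * (2 / pi * sin (h'.+1%:R * t) * sin t)).
  move=> t; apply: cvgM.
    apply: (@continuous_comp _ _ _ (fun t : R => 2 * cos t) (fun x => x ^+ k')); last exact: exprn_continuous.
    by apply: cvgMr; exact: continuous_cos.
  by apply: cvgM; [apply: cvgMr; exact: sin_mul_continuous|exact: continuous_sin].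
elim: k h => [|k IH] h.
  have E (t : R) : (2 * cos t) ^+ 0 * (2 / pi * sin (h.+1%:R * t) * sin t) =
      1 / pi * cos (h%:R * t) + (-1 / pi) * cos (h.+2%:R * t).
    rewrite expr0 mul1r; have -> : h%:R * t = h.+1%:R * t - t :> R by rewrite -natr1; ring.
    have -> : h.+2%:R * t = h.+1%:R * t + t :> R by rewrite -[h.+2%:R]natr1; ring.
    by rewrite cosB cosD; move: pi pi0 => P P0; field.
  transitivity (\int[leb]_(t in `[0, pi]) (1 / pi * cos (h%:R * t) + (-1 / pi) * cos (h.+2%:R * t)) : R).
    by apply: eq_Rintegral => t _; exact: E.
  rewrite Rintegral_segment_lin// !Rintegral_cos_nat /= mulr0 addr0.
  by case: (h) => [|h'] /=; rewrite ?mulr0// div1r mulVf.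
case: h => [|h] /=.
  rewrite addn0 -IH.
  suff E (t : R) : (2 * cos t) ^+ k.+1 * (2 / pi * sin (1 * t) * sin t) =
    (2 * cos t) ^+ k * (2 / pi * sin (2 * t) * sin t) by apply: eq_Rintegral => t _; exact: E.
  rewrite exprSr mul1r (_ : 2 * t = t *+ 2) ?sin_mulr2n ?mulr_natl//.
  by rewrite -[_ *+ 2]mulr_natl; ring.
rewrite natrD -!IH -[X in X + _]mul1r -[X in _ + X]mul1r -Rintegral_segment_lin//.
suff E (t : R) : (2 * cos t) ^+ k.+1 * (2 / pi * sin (h.+2%:R * t) * sin t) =
    1 * ((2 * cos t) ^+ k * (2 / pi * sin (h.+3%:R * t) * sin t)) +
    1 * ((2 * cos t) ^+ k * (2 / pi * sin (h.+1%:R * t) * sin t)) by apply: eq_Rintegral => t _; exact: E.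
rewrite exprSr; have -> : h.+3%:R * t = h.+2%:R * t + t :> R by rewrite -[h.+3%:R]natr1; ring.
have -> : h.+1%:R * t = h.+2%:R * t - t :> R by rewrite -[h.+2%:R]natr1; ring.
by rewrite sinD sinB; ring.
Qed.

Definition ballot_moment k : R := (ballot k 0)%:R.

Lemma semicircle_meanXn k : semicircle_mean (fun x => x ^+ k) = ballot_moment k.
Proof.
rewrite semicircle_mean_subst; last exact: exprn_continuous.
rewrite /ballot_moment -chebyshev_moment.
suff E (t : R) : (2 * cos t) ^+ k * (2 / pi * sin t ^+ 2) =
    (2 * cos t) ^+ k * (2 / pi * sin (1 * t) * sin t) by apply: eq_Rintegral => t _; exact: E.
by rewrite mul1r -[2 / pi * _ * _]mulrA.
Qed.

Lemma entire_ballot : entire_moments ballot_moment.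
Proof.
have H k h : (ballot k h)%:R <= 2 ^+ k :> R.
  elim: k h => [|k IH] h /=; first by rewrite expr0; case: (h == 0%N); rewrite // ler0n.
  rewrite natrD exprS mulr_natl mulr2n lerD//; case: h => [|h] //.
  by rewrite exprn_ge0.
(* For [lam = 0] the number [touchard 0 k 2] is 2^k, which dominates the number of paths. *)
apply: (@entire_touchard R 0 (lexx _) _ 1 2 ler01) => k.
rewrite /ballot_moment ler0n /= expr1n mul1r; apply: (le_trans (H _ _)).
move: k.*2 => {}k; elim: k => [|k IH]; first by rewrite expr0.
by rewrite exprS /= mul0r addr0 ler_wpM2l.
Qed.

Let continuous_mul_pdf f : continuous f -> continuous (fun x => f x * semicircle_pdf x).
Proof. by move=> cf x; apply: cvgM; [exact: cf|exact: continuous_semicircle_pdf]. Qed.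

Lemma semicircle_mean_lin f g (a b : R) : continuous f -> continuous g ->
  semicircle_mean (fun x => a * f x + b * g x) = a * semicircle_mean f + b * semicircle_mean g.
Proof.
move=> cf cg; rewrite -Rintegral_segment_lin; try exact: continuous_mul_pdf.
by apply: eq_Rintegral => x _; rewrite mulrDl !mulrA.
Qed.

Lemma semicircle_mean_le f g : continuous f -> continuous g -> (forall x, f x <= g x) ->
  semicircle_mean f <= semicircle_mean g.
Proof.
move=> cf cg fg; apply: Rintegral_segment_le; try exact: continuous_mul_pdf.
by move=> x _; rewrite ler_wpM2r// semicircle_pdf_ge0.
Qed.

Lemma semicircle_mean1 : semicircle_mean (fun=> 1) = 1.
Proof. exact: (semicircle_meanXn 0). Qed.

Lemma semicircle_mean_poly (p : {poly R}) : semicircle_mean (horner p) = mom_pairing ballot_moment p.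
Proof.
have -> : horner p = (fun x => \sum_(i < size p) p`_i * x ^+ i).
  by apply: funext => x; rewrite horner_coef.
have cX k : continuous (fun x : R => x ^+ k) by exact: exprn_continuous.
have cS n : continuous (fun x : R => \sum_(i < n) p`_i * x ^+ i).
  elim: n => [|n IH].
    by under eq_fun do rewrite big_ord0; move=> x; exact: cvg_cst.
  under eq_fun do rewrite big_ord_recr /=; move=> x.
  by apply: cvgD; [exact: IH|apply: cvgMr; exact: cX].
rewrite /mom_pairing; elim: (size p) => [|n IH].
  rewrite big_ord0; under eq_fun do rewrite big_ord0.
  rewrite -[RHS](_ : 0 * semicircle_mean (fun x => x ^+ 0) + 0 * semicircle_mean (fun x => x ^+ 0) = 0).
    rewrite -semicircle_mean_lin//; congr semicircle_mean; apply: funext => x.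
    by rewrite !mul0r addr0.
  by rewrite !mul0r addr0.
rewrite big_ord_recr /= -IH -semicircle_meanXn -[X in _ = X + _]mul1r -semicircle_mean_lin//.
by congr semicircle_mean; apply: funext => x; rewrite big_ord_recr mul1r.
Qed.

Lemma semicircle_pdf0 x : ~~ (-2 <= x <= 2) -> semicircle_pdf x = 0 :> R.
Proof.
move=> h; rewrite /semicircle_pdf ler0_sqrtr ?mul0r// subr_le0.
have [x2|x2] := leP x (-2); first by nra.
by move: h; rewrite (ltW x2) /= -ltNge => h; nra.
Qed.

Lemma semicircle_indic_integrable (A : set (measurableTypeR R)) : measurable A ->
  leb.-integrable `[-2, 2] (EFin \o (fun x : R => \1_A x * semicircle_pdf x)).
Proof.
move=> mA.
have mpdf : measurable_fun (`[-2, 2]%classic : set (measurableTypeR R)) (fun x : measurableTypeR R => \1_A x * semicircle_pdf x).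
  apply: measurable_funTS; apply: measurable_funM; first exact: measurable_indic.
  exact: measurable_semicircle_pdf.
apply: (le_integrable _ _ _ (integrable_segment (-2) 2 continuous_semicircle_pdf)) => //.
  exact/measurable_EFinP.
move=> x _; rewrite lee_fin normrM ler_piMl// indicE.
by case: (_ \in _); rewrite ?normr1// normr0 ler01.
Qed.

Lemma semicircleE (A : set (measurableTypeR R)) : measurable A ->
  semicircle A = (semicircle_mean (\1_A))%:E.
Proof.
move=> mA; rewrite /semicircle_mean /Rintegral.
rewrite fineK; last exact: integrable_fin_num (semicircle_indic_integrable mA).
rewrite /semicircle [LHS]integral_mkcond [RHS]integral_mkcond.
apply: eq_integral => x _.
rewrite !patchE indicE; case: (boolP (x \in A)) => xA; case: ifPn => // xI.
- by rewrite mul1r.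
- rewrite semicircle_pdf0//; apply: contra xI => h; rewrite inE /=.
  by rewrite in_itv.
- by rewrite mul0r.
Qed.

Lemma semicircleT : semicircle setT = 1%E :> \bar R.
Proof.
rewrite semicircleE//= -[X in _ = X%:E]semicircle_mean1; congr (_%:E).
by congr semicircle_mean; apply: funext => x; rewrite indicT.
Qed.

HB.instance Definition _ := @Measure_isProbability.Build _ (measurableTypeR R) R semicircle semicircleT.

(** Both sides are positive functionals squeezed by the distribution function of the law, so
    [pos_functional_eq] identifies them. *)
Lemma Rintegral_semicircle f : cont_bounded f -> \int[semicircle]_x f x = semicircle_mean f.
Proof.
pose P : probability (measurableTypeR R) R := semicircle.
have ml (L : R) : measurable (`]-oo, L]%classic : set (measurableTypeR R)) by exact: measurable_itv.
have lin2 g h (a b : R) : cont_bounded g -> cont_bounded h ->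
    semicircle_mean (fun x => a * g x + b * h x) = a * semicircle_mean g + b * semicircle_mean h.
  by move=> [cg _] [ch _]; exact: semicircle_mean_lin.
have J' : pos_functional semicircle_mean.
  split => //; last exact: semicircle_mean1.
  by move=> g h [cg _] [ch _]; exact: semicircle_mean_le.
pose F (b : R) := fine (P `]-oo, b]%classic).
have FE b : F b = semicircle_mean (\1_(`]-oo, b]%classic)) by rewrite /F /= semicircleE.
apply: (pos_functional_eq (F := F) (pos_functional_integral P) J') => //.
- move=> b b' bb; have cr := cont_bounded_ramp b b'; apply/andP; split.
    by apply: itv_le_integral => // [y|y yb]; [exact: ramp_ge0|rewrite ramp1].
  by apply: integral_le_itv => // [y|y yb]; [exact: ramp_le1|rewrite ramp0// ltW].
- move=> b b' bb; rewrite !FE; have [cr _] := cont_bounded_ramp b b'.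
  have int1 c : leb.-integrable `[-2, 2] (EFin \o (fun x : R => \1_(`]-oo, c]%classic) x * semicircle_pdf x)).
    exact: semicircle_indic_integrable.
  apply/andP; split; apply: le_Rintegral => //; try exact/integrable_segment/continuous_mul_pdf.
    move=> y _; rewrite ler_wpM2r ?semicircle_pdf_ge0// indicE.
    case: (boolP (_ \in _)) => [/set_mem|_]; last exact: ramp_ge0.
    by rewrite /= in_itv /= => yb; rewrite ramp1.
  move=> y _; rewrite ler_wpM2r ?semicircle_pdf_ge0// indicE.
  case: (boolP (_ \in _)) => [_|h]; first exact: ramp_le1.
  rewrite ramp0//; apply: ltW; rewrite ltNge; apply: contra h => h.
  by rewrite inE /= in_itv.
- move=> e e0; exists 3 => //; rewrite !FE; split.
    rewrite (_ : semicircle_mean _ = 0) ?ltW//.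
    transitivity (\int[leb]_(x in `[-2, 2]) (0 : R)); last by rewrite Rintegral_cst ?mul0r.
    apply: eq_Rintegral => y; rewrite inE /= in_itv /= => /andP[y2 _].
    rewrite indicE memNset ?mul0r// /= in_itv /= => y3.
    by have := le_trans y2 y3; lra.
  rewrite (_ : semicircle_mean _ = 1); first by lra.
  rewrite -[RHS]semicircle_mean1; apply: eq_Rintegral => y; rewrite inE /= in_itv /= => /andP[_ y2].
  by rewrite indicE mem_set//= in_itv /= (le_trans y2)// ler_nat.
Qed.

Lemma semicircle_approx f (Q K : {poly R}) : cont_bounded f -> (forall x, `|f x - Q.[x]| <= K.[x]) ->
  `|\int[semicircle]_x f x - mom_pairing ballot_moment Q| <= mom_pairing ballot_moment K.
Proof.
move=> cf H; rewrite Rintegral_semicircle// -!semicircle_mean_poly.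
have cp (p : {poly R}) : continuous (horner p) by exact: continuous_horner.
have [cf' _] := cf.
have B : semicircle_mean f - semicircle_mean (horner Q) = semicircle_mean (fun x => 1 * f x + (-1) * Q.[x]).
  by rewrite semicircle_mean_lin// mul1r mulN1r.
have N : - semicircle_mean (horner K) = semicircle_mean (fun x => (-1) * K.[x] + 0 * K.[x]).
  by rewrite semicircle_mean_lin// mul0r addr0 mulN1r.
have c1 (u v : R) g h : continuous g -> continuous h -> continuous (fun x : R => u * g x + v * h x).
  by move=> cg ch x; apply: cvgD; apply: cvgMr; [exact: cg|exact: ch].
rewrite ler_norml B N; apply/andP; split; apply: semicircle_mean_le; try exact: c1; try exact: cp.
  by move=> x; have := H x; rewrite ler_norml; lra.
by move=> x; have := H x; rewrite ler_norml; lra.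
Qed.

End semicircle.

(** * Convergence of the spectral distributions *)

Section spectral_mean.
Local Open Scope classical_set_scope.
Local Open Scope ring_scope.
Variable R : realType.
Implicit Types (f g : R -> R).

Definition spectral_mean n (A : 'M[R]_n) f : R :=
  n%:R^-1 * \sum_(k < n) f (eigenvalues A)`_k.

Lemma averaging_spectral_mean n (A : 'M[R]_n.+1) : averaging (spectral_mean A).
Proof.
split=> [f g a b|f g fg|].
- rewrite /spectral_mean big_split /= -!mulr_sumr; ring.
- by rewrite ler_wpM2l// ler_sum.
- by rewrite /spectral_mean sumr_const card_ord mulVf// pnatr_eq0.
Qed.

Lemma spectral_mean_trace n (A : 'M[R]_n.+1) k : A^T = A ->
  spectral_mean A (fun x => x ^+ k) = n.+1%:R^-1 * \tr (A ^+ k).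
Proof.
move=> /real_spectral[r [cA ->]]; congr (_ * _).
pose s := [seq r 0 i | i : 'I_n.+1].
have pE : perm_eq (eigenvalues A) s.
  by apply: perm_roots_mup; rewrite cA big_map enumT.
(* For a symmetric matrix the list is complete, so [nth] never falls back on its default value 0. *)
have sz : size (eigenvalues A) = n.+1 by rewrite (perm_size pE) size_map size_enum_ord.
transitivity (\sum_(x <- eigenvalues A) x ^+ k).
  by rewrite [RHS](big_nth 0) sz big_mkord.
by rewrite (perm_big _ pE) big_map enumT.
Qed.

Lemma ge0_integral_esd n (A : 'M[R]_n) f : measurable_fun [set: measurableTypeR R] f ->
  (forall x, 0 <= f x) -> (\int[esd A]_x (f x)%:E)%E = (spectral_mean A f)%:E.
Proof.
move=> mf f0; have mf' : measurable_fun [set: measurableTypeR R] (EFin \o f) by exact/measurable_EFinP.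
rewrite /esd ge0_integral_mscale//; last by move=> x _; rewrite lee_fin.
rewrite ge0_integral_measure_sum//; last by move=> x _; rewrite lee_fin.
rewrite /spectral_mean EFinM -sumEFin; congr (_ * _)%E; apply: eq_bigr => k _.
by rewrite integral_dirac//= diracT mul1e.
Qed.

(** The positive and the negative part are treated separately, both having finite integrals against
    a finite sum of point masses. *)
Lemma Rintegral_esd n (A : 'M[R]_n) f : measurable_fun [set: measurableTypeR R] f ->
  \int[esd A]_x f x = spectral_mean A f.
Proof.
move=> mf; rewrite /Rintegral integralE.
pose fp x : R := Num.max (f x) 0; pose fn x : R := Num.max (- f x) 0.
have mp : measurable_fun [set: measurableTypeR R] fp by exact: measurable_funrpos.
have mn : measurable_fun [set: measurableTypeR R] fn by exact: measurable_funrneg.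
have ep : (fun x : measurableTypeR R => (f x)%:E)^\+%E = (fun x => (fp x)%:E).
  by apply: funext => x; rewrite funeposE EFin_max.
have en : (fun x : measurableTypeR R => (f x)%:E)^\-%E = (fun x => (fn x)%:E).
  by apply: funext => x; rewrite funenegE EFin_max.
rewrite ep en !ge0_integral_esd//; try by move=> x; rewrite le_max lexx orbT.
rewrite /= /spectral_mean -mulrBr -sumrB; congr (_ * _); apply: eq_bigr => k _.
rewrite /fp /fn; case: (leP (f _) 0) => h; case: (leP (- f _) 0) => h'; lra.
Qed.

End spectral_mean.

(** * From random hypergraphs to laws on a finite set *)

Section erdos_renyi_law.
Local Open Scope classical_set_scope.
Local Open Scope ring_scope.
Context {R : realType} {d : measure_display} {Omega : measurableType d}.
Variables (P : probability Omega R) (N : nat) (H : Omega -> {set {set 'I_N}}).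
Hypothesis mH : forall e, measurable [set w | e \in H w].

Definition law_of (h : {set {set 'I_N}}) : R := fine (P [set w | H w = h]).

(** The variable [H] has finitely many values, and each event [H w = h] is a finite intersection of
    hyperedge events and their complements. *)
Lemma measurable_law_event (Q : pred {set {set 'I_N}}) : measurable [set w | Q (H w)].
Proof.
have m1 h : measurable [set w | H w = h].
  rewrite (_ : [set w | H w = h] =
    \bigcap_(e in [set: {set 'I_N}]) (if e \in h then [set w | e \in H w] else ~` [set w | e \in H w])).
    apply: fin_bigcap_measurable => [|e _]; first exact: finite_finset.
    by case: ifP => _ //; exact: measurableC.
  apply/seteqP; split => w /= => [<- e _|Hw]; first by case: ifP => // /negbT/negP.
  apply/setP => e; have := Hw e I; case: ifP => // _ /= /negP/negbTE.
  by [].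
rewrite (_ : [set w | Q (H w)] = \bigcup_(h in [set h | Q h]) [set w | H w = h]).
  by apply: fin_bigcup_measurable => //; exact: finite_finset.
by apply/seteqP; split => w /= => [Qw|[h /= Qh ->]//]; exists (H w).
Qed.

Lemma law_ofE h : P [set w | H w = h] = (law_of h)%:E.
Proof.
rewrite /law_of fineK//; apply: fin_num_measure.
by have := measurable_law_event (pred1 h); congr measurable; apply/seteqP; split => w /= /eqP.
Qed.

Let m1 h : measurable [set w | H w = h].
Proof. by have := measurable_law_event (pred1 h); congr measurable; apply/seteqP; split => w /= /eqP. Qed.

Lemma law_of_indicators (g : {set {set 'I_N}} -> R) w :
  g (H w) = \sum_h g h * \1_([set v | H v = h]) w.
Proof.
rewrite (bigD1 (H w))//= indicE mem_set// mulr1 big1 ?addr0// => h hH.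
by rewrite indicE memNset ?mulr0//= => Hw; rewrite Hw eqxx in hH.
Qed.

Lemma integral_law_of (g : {set {set 'I_N}} -> R) :
  (\int[P]_w (g (H w))%:E)%E = (law_mean law_of g)%:E.
Proof.
under eq_integral do rewrite law_of_indicators -sumEFin.
have I1 h : P.-integrable setT (EFin \o (\1_([set v | H v = h]) : Omega -> R)).
  by apply: integrable_indic.
rewrite integral_sum//; last first.
  move=> h; under eq_fun do rewrite EFinM.
  exact: (integrableZl measurableT (g h) (I1 h)).
rewrite /law_mean -sumEFin; apply: eq_bigr => h _.
under eq_integral do rewrite EFinM.
rewrite (integralZl measurableT (I1 h)).
transitivity ((g h)%:E * P [set v | H v = h])%E; last by rewrite law_ofE -EFinM mulrC.
by congr (_ * _)%E; rewrite integral_indic// setIT.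
Qed.

Lemma law_of_event (Q : pred {set {set 'I_N}}) : P [set w | Q (H w)] = (\sum_(h | Q h) law_of h)%:E.
Proof.
have := integral_law_of (fun h => (Q h)%:R).
rewrite (eq_integral (fun w => (\1_[set v | Q (H v)] w)%:E)); last first.
  move=> w _; congr (_%:E); rewrite indicE; case: (boolP (Q (H w))) => h; first by rewrite mem_set.
  by rewrite memNset//=; exact/negP.
rewrite integral_indic//; last exact: measurable_law_event.
rewrite setIT => ->; rewrite /law_mean [in RHS]big_mkcond; congr (_%:E).
by apply: eq_bigr => h _; case: (Q h); rewrite ?mulr1 ?mulr0.
Qed.

Lemma law_of_ge0 h : 0 <= law_of h.
Proof. by rewrite fine_ge0. Qed.

Lemma law_of_neq0 h : law_of h != 0 -> exists w, H w = h.
Proof.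
move=> h0; apply: contrapT => /forallNP N0; move: h0; rewrite /law_of.
rewrite (_ : [set w | H w = h] = set0) ?measure0 ?eqxx//.
by apply/seteqP; split => // w /N0.
Qed.

End erdos_renyi_law.

Section erdos_renyi_matrix.
Local Open Scope classical_set_scope.
Local Open Scope ring_scope.
Context {R : realType} {d : measure_display} {Omega : measurableType d}.
Variables (P : probability Omega R) (n q : nat) (alpha : R) (H : Omega -> {set {set 'I_n.+2}}).
Hypothesis q_gt0 : (0 < q)%N.
Hypothesis HH : is_erdos_renyi P q.+1 alpha H.

Let mH e : measurable [set w | e \in H w].
Proof. by have [_ + _ _] := HH; exact. Qed.

Lemma erdos_renyi_law : hypergraph_law q alpha (law_of P H).
Proof.
have [Hu _ Ha Hi] := HH; split.
- exact: law_of_ge0.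
- by move=> h e /law_of_neq0[w <-]; exact: Hu.
- move=> S Su; apply: EFin_inj.
  rewrite -(law_of_event P mH (fun h => S \subset h)).
  have sub : [set` enum S] `<=` [set e : {set 'I_n.+2} | #|e| = q.+1].
    by move=> e /=; rewrite mem_enum; exact: Su.
  have := Hi _ (enum_uniq S) sub.
  rewrite (_ : \bigcap_(_ in _) _ = [set w | S \subset H w]) => [->|]; last first.
    apply/seteqP; split => w /=.
      by move=> Hw; apply/fintype.subsetP => e eS; apply: Hw; rewrite /= mem_enum.
    by move=> /fintype.subsetP Hw e /=; rewrite mem_enum; exact: Hw.
  rewrite big_enum /= (eq_bigr (fun=> alpha%:E)); last by move=> e eS; rewrite Ha// Su.
  by rewrite prodEFin prodr_const.
Qed.

Lemma pair_adjacency_mean i j :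
  fine 'E_P[fun v => (pair_adjacency (H v) : 'M[R]_n.+2) i j] =
  law_mean (law_of P H) (fun h => (pair_adjacency h : 'M[R]_n.+2) i j).
Proof. by rewrite unlock (integral_law_of P mH (fun h => (pair_adjacency h : 'M[R]_n.+2) i j)). Qed.

(** Positive probability guarantees that all hyperedges of [h] have size [q.+1], so that both
    matrices sum over the same sets. *)
Lemma pair_adjacency_centred h i j : law_of P H h != 0 ->
  (pair_adjacency h : 'M[R]_n.+2) i j - law_mean (law_of P H) (fun h => (pair_adjacency h : 'M[R]_n.+2) i j) =
  centred_adjacency q alpha h i j.
Proof.
have E (g : {set {set 'I_n.+2}}) : law_of P H g != 0 -> (pair_adjacency g : 'M[R]_n.+2) i j =
    (i != j)%:R * \sum_(e : {set 'I_n.+2} | [&& #|e| == q.+1, i \in e & j \in e]) (e \in g)%:R.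
  move=> g0; rewrite !mxE; congr (_ * _).
  rewrite big_mkcond [RHS]big_mkcond; apply: eq_bigr => e _.
  case: (boolP (e \in g)) => eg; last by case: ifP.
  by rewrite (law_uniform erdos_renyi_law g0 eg) eqxx /=; case: ifP.
move=> h0; rewrite E// (law_mean_ext (pr := law_of P H) E) law_meanZ.
rewrite law_mean_sum !mxE -mulrBr -sumrB; congr (_ * _).
by apply: eq_bigr => e /and3P[/eqP ce _ _]; rewrite (law_mean_edge erdos_renyi_law ce).
Qed.

Lemma normalized_pair_adjacencyE w : law_of P H (H w) != 0 ->
  normalized_pair_adjacency P H w =
  (Num.sqrt (n.+2%:R * ('C(n, q.-1)%:R * (alpha * (1 - alpha)))))^-1 *: centred_adjacency q alpha (H w).
Proof.
move=> w0; rewrite /normalized_pair_adjacency; congr ((Num.sqrt (_ * _))^-1 *: _); last first.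
  apply/matrixP => i j; rewrite -(pair_adjacency_centred _ _ w0) mxE [X in _ + X]mxE [X in _ - X]mxE.
  by rewrite pair_adjacency_mean.
rewrite -(@law_mean_centred_sqr R n q alpha (law_of P H) ord0 1 q_gt0 erdos_renyi_law isT).
rewrite /variance unlock pair_adjacency_mean unlock.
set m := law_mean _ _.
have := integral_law_of P mH (fun h => ((pair_adjacency h : 'M[R]_n.+2) ord0 1 - m) ^+ 2).
rewrite /GRing.mul /= => ->; apply: law_mean_ext => h h0.
by rewrite pair_adjacency_centred.
Qed.

End erdos_renyi_matrix.

(** * Asymptotics of the parameters in the two regimes *)

Section parameters.
Local Open Scope classical_set_scope.
Local Open Scope ring_scope.
Variables (R : realType) (q : nat).
Hypothesis q_gt0 : (0 < q)%N.

Lemma expn_le_ffact m k : ((m - k) ^ k <= m ^_ k)%N.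
Proof.
have H j : (j <= k)%N -> ((m - k) ^ j <= m ^_ j)%N.
  elim: j => [//|j IH] jk; rewrite ffactnSr expnSr leq_mul ?IH ?(ltnW jk)//.
  by rewrite leq_sub2l// ltnW.
exact: H.
Qed.

Lemma ffact_le_expn m k : (m ^_ k <= m ^ k)%N.
Proof. by elim: k => [//|k IH]; rewrite ffactnSr expnSr leq_mul// leq_subr. Qed.

Lemma bernoulli_le (x : R) k : 0 <= x <= 1 -> 1 - k%:R * x <= (1 - x) ^+ k.
Proof.
move=> /andP[x0 x1]; elim: k => [|k IH]; first by rewrite mul0r subr0 expr0.
rewrite exprS; apply: (@le_trans _ _ ((1 - x) * (1 - k%:R * x))); last first.
  by rewrite ler_wpM2l// subr_ge0.
by rewrite -natr1; have := ler0n R k; move: (k%:R) => u u0; nra.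
Qed.

(** Each factor is at least [N - v - q], and Bernoulli's inequality linearises the power; if [v + q]
    exceeds [N] the left side is not positive. *)
Lemma ffact_lower (N v : nat) : (0 < N)%N ->
  (1 - (q * (v + q))%:R / N%:R) * N%:R ^+ q <= ((N - v) ^_ q)%:R :> R.
Proof.
move=> N0; have N0' : 0 < N%:R :> R by rewrite ltr0n.
have [vN|vN] := leqP (v + q) N; last first.
  apply: (@le_trans _ _ 0); last exact: ler0n.
  rewrite mulr_le0_ge0 ?exprn_ge0 ?ler0n// subr_le0 ler_pdivlMr// mul1r ler_nat.
  by rewrite (leq_trans (ltnW vN))// leq_pmull.
apply: (@le_trans _ _ (((N - v - q) ^ q)%:R)); last by rewrite ler_nat expn_le_ffact.
rewrite -subnDA natrX natrB//.
have -> : N%:R - (v + q)%:R = (1 - (v + q)%:R / N%:R) * N%:R :> R.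
  by rewrite mulrBl mul1r mulfVK// gt_eqF.
rewrite exprMn ler_wpM2r ?exprn_ge0 ?ler0n// natrM -mulrA; apply: bernoulli_le.
by rewrite divr_ge0 ?ler0n//= ler_pdivrMr// mul1r ler_nat.
Qed.

(** [N = n.+2] times the number of hyperedges through a pair of vertices; multiplied by
    [alpha * (1 - alpha)] it is [N] times the variance of an entry. *)
Definition edge_count (n : nat) : R := n.+2%:R * 'C(n, q.-1)%:R.

Lemma edge_count_fact n : edge_count n * (q.-1)`!%:R = (n.+2 * n ^_ q.-1)%:R.
Proof. by rewrite /edge_count -mulrA -!natrM bin_ffact. Qed.

Lemma edge_count_upper n : edge_count n * (q.-1)`!%:R <= n.+2%:R ^+ q.
Proof.
rewrite edge_count_fact -natrX ler_nat -[in leqRHS](prednK q_gt0) expnS leq_mul2l /=.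
apply: leq_trans (ffact_le_expn _ _) _.
by case: (q.-1) => [|k] //; rewrite leq_exp2r// ltnW// ltnW.
Qed.

Lemma binS_fact m : (q * 'C(m, q) * (q.-1)`! = m ^_ q)%N.
Proof. by rewrite mulnAC -[X in (X * _ * _)%N](prednK q_gt0) -factS prednK// mulnC bin_ffact. Qed.

Lemma edge_count_lower n : (q * 'C(n.+1, q))%:R <= edge_count n.
Proof.
rewrite /edge_count -natrM ler_nat -(prednK q_gt0) -mul_bin_diag /= leq_mul2r.
by rewrite leqnSn orbT.
Qed.

Lemma edge_count_ratio n : (1 - (q * q.+1)%:R / n.+2%:R) * n.+2%:R ^+ q <= edge_count n * (q.-1)`!%:R.
Proof.
rewrite -add1n; apply: le_trans (ffact_lower 1 (isT : (0 < n.+2)%N)) _.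
rewrite subSS subn0 -binS_fact natrM ler_wpM2r ?ler0n//; exact: edge_count_lower.
Qed.

Lemma fresh_edges n v :
  (1 - (q * (v + q))%:R / n.+2%:R) * edge_count n <= (q * 'C(n.+2 - v, q))%:R.
Proof.
have f0 : 0 < (q.-1)`!%:R :> R by rewrite ltr0n fact_gt0.
have e0 : 0 <= edge_count n by rewrite mulr_ge0 ?ler0n.
rewrite -(ler_pM2r f0) -natrM binS_fact.
have [h|h] := leP 0 (1 - (q * (v + q))%:R / n.+2%:R : R).
  apply: le_trans (ffact_lower v (isT : (0 < n.+2)%N)).
  by rewrite -mulrA ler_wpM2l// edge_count_upper.
apply: (@le_trans _ _ 0); last exact: ler0n.
by rewrite -mulrA mulr_le0_ge0 ?(ltW h)// mulr_ge0// ltW.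
Qed.

Definition scale n (alpha : R) := Num.sqrt (edge_count n * (alpha * (1 - alpha))).

(** The [j]-th central moment is [alpha * (1 - alpha)] times (1 - alpha)^(j-1) + (-1)^j alpha^(j-1),
    and Bernoulli's inequality bounds the distance of the last sum to 1. *)
Lemma central_moment_le (alpha : R) j : 0 < alpha < 1 -> (1 < j)%N ->
  `|central_moment alpha j| <= alpha * (1 - alpha) /\
  `|central_moment alpha j - alpha * (1 - alpha)| <= j%:R * alpha * (alpha * (1 - alpha)).
Proof.
move=> /andP[a0 a1]; case: j => [//|[//|j]] _.
have b0 : 0 <= 1 - alpha by rewrite subr_ge0 ltW.
have b1 : 1 - alpha <= 1 by rewrite lerBlDr lerDl ltW.
have s0 : 0 <= alpha * (1 - alpha) by rewrite mulr_ge0// ltW.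
have E : central_moment alpha j.+2 = alpha * (1 - alpha) * ((1 - alpha) ^+ j.+1 + (-1) ^+ j.+2 * alpha ^+ j.+1).
  rewrite /central_moment [(- alpha) ^+ _]exprNn.
  rewrite [(1 - alpha) ^+ j.+2]exprS [alpha ^+ j.+2]exprS.
  by move: (_ ^+ _) (_ ^+ _) (_ ^+ _) => u v w; ring.
have p0 : 0 <= (1 - alpha) ^+ j.+1 by rewrite exprn_ge0.
have p1 : 1 - j.+1%:R * alpha <= (1 - alpha) ^+ j.+1 by apply: bernoulli_le; rewrite !ltW.
have p2 : (1 - alpha) ^+ j.+1 <= 1 - alpha.
  by rewrite exprS ler_piMr// exprn_ile1.
have r0 : 0 <= alpha ^+ j.+1 by rewrite exprn_ge0// ltW.
have r1 : alpha ^+ j.+1 <= alpha by rewrite exprS ler_piMr ?(ltW a0)// exprn_ile1 ?(ltW a0)// ltW.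
have S : `|(-1) ^+ j.+2 * alpha ^+ j.+1| = alpha ^+ j.+1 by rewrite normrM normr_sign mul1r ger0_norm.
have [D DE] : exists D, D = (-1) ^+ j.+2 * alpha ^+ j.+1 by eexists.
rewrite E -DE; move: p0 p1 p2 r0 r1 S; rewrite -DE.
move: ((1 - alpha) ^+ j.+1) (alpha ^+ j.+1) => P r p0 p1 p2 r0 r1 S.
split.
  rewrite normrM (ger0_norm s0) ler_piMr//.
  by rewrite (le_trans (ler_normD _ _))// S ger0_norm//; lra.
rewrite [j.+2%:R * _ * _]mulrC -[X in _ - X]mulr1 -mulrBr normrM (ger0_norm s0) ler_wpM2l//.
have -> : P + D - 1 = (P - 1) + D by ring.
rewrite (le_trans (ler_normD _ _))// S.
have : `|P - 1| <= j.+1%:R * alpha by rewrite ler_norml; apply/andP; split; lra.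
by rewrite -[j.+2%:R]natr1; lra.
Qed.

Lemma walk_params_scale n (alpha K0 eta delta : R) vmax : 0 < alpha < 1 ->
  1 <= K0 * scale n alpha -> (q * (vmax + q))%:R / n.+2%:R <= delta ->
  `|(scale n alpha)^-1 - eta| <= delta -> eta = 0 \/ alpha <= delta ->
  walk_params q K0 eta 'I_n.+2 (alpha * (1 - alpha)) (scale n alpha) delta (central_moment alpha) vmax.
Proof.
move=> a01 HK Hd Heta Hkap; have /andP[a0 a1] := a01.
have s0 : 0 < alpha * (1 - alpha) by rewrite mulr_gt0// subr_gt0.
have e0 : 0 <= edge_count n by rewrite mulr_ge0 ?ler0n.
have rr : scale n alpha ^+ 2 = edge_count n * (alpha * (1 - alpha)).
  by rewrite sqr_sqrtr// mulr_ge0// ltW.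
split => //.
- by rewrite lt_neqAle sqrtr_ge0 andbT eq_sym; apply: contraTneq HK => ->; rewrite mulr0 -ltNge.
- by rewrite (le_trans _ Hd)// divr_ge0 ?ler0n.
- by rewrite card_ord rr ler_wpM2r ?(ltW s0)//=; exact: edge_count_lower.
- by rewrite /central_moment !expr0 !mulr1; ring.
- by rewrite /central_moment !expr1; ring.
- by move=> j j1; have [] := central_moment_le a01 j1.
- case: Hkap => [->|ad]; [left|right].
    by split => //; rewrite /central_moment !expr2; ring.
  move=> j j1; have [_ h] := central_moment_le a01 j1; apply: (le_trans h).
  by rewrite ler_wpM2r ?(ltW s0)// ler_wpM2l.
- move=> v vv; rewrite card_ord rr [_ * (edge_count n * _)]mulrA ler_wpM2r ?(ltW s0)//.
  apply: le_trans (fresh_edges n v); rewrite ler_wpM2r// lerD2l lerN2 (le_trans _ Hd)//.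
  by rewrite ler_wpM2r// ler_nat leq_mul2l leq_add2r vv orbT.
Qed.

Lemma cvg_inv_nat (C : R) : C / n.+2%:R @[n --> \oo] --> (0 : R).
Proof.
rewrite -[X in _ --> X](mulr0 C); apply: cvgMr.
have := @gtr0_cvgV0 R _ \oo _ (fun n => n.+2%:R).
case; first by apply: nearW => n; rewrite ltr0n.
by move=> _; apply; apply/cvgryPge => M; near=> n; rewrite (@le_trans _ _ n%:R)// ?ler_nat;
  [near: n; exact: nbhs_infty_ger|rewrite ltnW// ltnW].
Unshelve. all: by end_near. Qed.

Lemma cvg_edge_count : edge_count n / n.+2%:R ^+ q @[n --> \oo] --> ((q.-1)`!%:R^-1 : R).
Proof.
have f0 : 0 < (q.-1)`!%:R :> R by rewrite ltr0n fact_gt0.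
apply: (@squeeze_cvgr _ _ _ _ (fun n => (1 - (q * q.+1)%:R / n.+2%:R) * (q.-1)`!%:R^-1)
  (fun n => (q.-1)`!%:R^-1)); first apply: nearW => n; last 2 first.
- rewrite -[X in _ --> X]mul1r; apply: cvgMl.
  rewrite -[X in _ --> X]subr0; apply: cvgB; [exact: cvg_cst|exact: cvg_inv_nat].
- exact: cvg_cst.
have N0 : 0 < n.+2%:R ^+ q :> R by rewrite exprn_gt0// ltr0n.
apply/andP; split; first by rewrite ler_pdivlMr// mulrAC ler_pdivrMr// edge_count_ratio.
by rewrite ler_pdivrMr// mulrC ler_pdivlMr// edge_count_upper.
Qed.

Definition good_params (K0 eta : R) (alpha : nat -> R) := forall vmax, exists delta : nat -> R,
  delta n @[n --> \oo] --> (0 : R) /\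
  \forall n \near \oo, walk_params q K0 eta 'I_n.+2 (alpha n * (1 - alpha n)) (scale n (alpha n))
    (delta n) (central_moment (alpha n)) vmax.

Lemma good_params_of (alpha : nat -> R) (K0 eta : R) : (forall n, 0 < alpha n < 1) ->
  (\forall n \near \oo, 1 <= K0 * scale n (alpha n)) ->
  (scale n (alpha n))^-1 @[n --> \oo] --> eta ->
  eta = 0 \/ alpha n @[n --> \oo] --> (0 : R) -> good_params K0 eta alpha.
Proof.
move=> a01 HK Hs Ha vmax.
(* In the dense regime [alpha] need not tend to 0, and its contribution to [delta] is dropped;
   [kap 2] is exact there. *)
pose b n : R := if eta == 0 then 0 else alpha n.
have b0 n : 0 <= b n by rewrite /b; case: ifP => // _; have /andP[/ltW] := a01 n.
have cb : b n @[n --> \oo] --> (0 : R).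
  rewrite /b; case: Ha => [->|]; first by rewrite eqxx; exact: cvg_cst.
  by case: (eta == 0) => // _; exact: cvg_cst.
exists (fun n => (q * (vmax + q))%:R / n.+2%:R + `|(scale n (alpha n))^-1 - eta| + b n); split.
  rewrite -[X in _ --> X]addr0; apply: cvgD => //.
  rewrite -[X in _ --> X]addr0; apply: cvgD; first exact: cvg_inv_nat.
  rewrite -[X in _ --> X](normr0 R); apply: cvg_norm.
  by rewrite -[X in _ --> X](subrr eta); apply: cvgB => //; exact: cvg_cst.
near=> n; have n0 : 0 <= `|(scale n (alpha n))^-1 - eta| by [].
have m0 : 0 <= (q * (vmax + q))%:R / n.+2%:R :> R by rewrite divr_ge0 ?ler0n.
apply: walk_params_scale => //.
- by near: n.
- by rewrite -addrA lerDl addr_ge0.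
- by rewrite addrAC lerDr addr_ge0.
- by rewrite /b; case: eqP => [->|_]; [left|right; rewrite lerDr addr_ge0].
Unshelve. all: by end_near. Qed.

Lemma scale_sqr n (a : R) : 0 < a < 1 ->
  scale n a ^+ 2 = edge_count n / n.+2%:R ^+ q * (n.+2%:R ^+ q * a * (1 - a)).
Proof.
move=> /andP[a0 a1]; have N0 : n.+2%:R ^+ q != 0 :> R by rewrite expf_neq0// pnatr_eq0.
rewrite sqr_sqrtr; first by field.
by rewrite !mulr_ge0 ?ler0n ?subr_ge0 ?(ltW a0)// ltW.
Qed.

Lemma good_params_dense (alpha : nat -> R) : (forall n, 0 < alpha n < 1) ->
  n.+2%:R ^+ q * alpha n @[n --> \oo] --> +oo ->
  n.+2%:R ^+ q * (1 - alpha n) @[n --> \oo] --> +oo -> good_params 1 0 alpha.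
Proof.
move=> a01 ca cb; pose F : R := (q.-1)`!%:R^-1.
have F0 : 0 < F by rewrite invr_gt0 ltr0n fact_gt0.
have key (M : R) : 0 < M -> \forall n \near \oo, M <= scale n (alpha n).
  move=> M0; have F20 : 0 < F / 2 by rewrite divr_gt0.
  have /cvgrPdist_le/(_ _ F20) H1 := cvg_edge_count.
  pose B := 4 * M ^+ 2 / F.
  have B0 : 0 < B by rewrite divr_gt0// mulr_gt0// exprn_gt0.
  have /cvgryPge/(_ B) H2 := ca; have /cvgryPge/(_ B) H3 := cb.
  near=> n; have /andP[an0 an1] := a01 n.
  have h1 : `|F - edge_count n / n.+2%:R ^+ q| <= F / 2 by near: n.
  have h2 : B <= n.+2%:R ^+ q * alpha n by near: n.
  have h3 : B <= n.+2%:R ^+ q * (1 - alpha n) by near: n.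
  rewrite -(ler_pXn2r (n := 2))// ?nnegrE ?sqrtr_ge0 ?(ltW M0)//.
  rewrite scale_sqr//; move: h1; rewrite ler_norml => /andP[_ h1].
  have {}h1 : F / 2 <= edge_count n / n.+2%:R ^+ q by lra.
  have h4 : B / 2 <= n.+2%:R ^+ q * alpha n * (1 - alpha n).
    (* One of [alpha] and [1 - alpha] is at least 1/2, so either of the two divergences bounds the
       product below. *)
    have [h|h] := leP (alpha n) (1 / 2); first by nra.
    rewrite [leRHS]mulrAC; apply: (@le_trans _ _ (n.+2%:R ^+ q * (1 - alpha n) * (1 / 2))).
      by rewrite div1r ler_wpM2r.
    by rewrite ler_wpM2l ?(ltW h)// (le_trans _ h3)// ltW.
  have -> : M ^+ 2 = F / 2 * (B / 2) by rewrite /B; field; rewrite gt_eqF.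
  by apply: ler_pM => //; rewrite divr_ge0// ltW.
apply: good_params_of => //; last by left.
- by near=> n; rewrite mul1r; near: n; exact: key.
- apply/cvgrPdist_le => e e0; near=> n.
  have h : e^-1 <= scale n (alpha n) by near: n; apply: key; rewrite invr_gt0.
  have h0 : 0 < scale n (alpha n) by rewrite (lt_le_trans _ h)// invr_gt0.
  rewrite sub0r normrN gtr0_norm ?invr_gt0//.
  by rewrite -[leRHS]invrK lef_pV2 ?posrE ?invr_gt0.
Unshelve. all: by end_near. Qed.

Lemma good_params_sparse (alpha : nat -> R) (c0 : R) : 0 < c0 -> (forall n, 0 < alpha n < 1) ->
  n.+2%:R ^+ q * alpha n @[n --> \oo] --> c0 ->
  let a := Num.sqrt (c0 / (q.-1)`!%:R) in
  exists2 K0, 1 <= K0 & good_params K0 a^-1 alpha.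
Proof.
move=> c00 a01 ca a.
have f0 : 0 < (q.-1)`!%:R :> R by rewrite ltr0n fact_gt0.
have a0 : 0 < a by rewrite sqrtr_gt0 divr_gt0.
have ca0 : alpha n @[n --> \oo] --> (0 : R).
  rewrite -[X in _ --> X](mulr0 c0).
  have H : (n.+2%:R ^+ q * alpha n) * (n.+2%:R ^+ q)^-1 @[n --> \oo] --> c0 * 0.
    apply: cvgM => //; apply: (@squeeze_cvgr _ _ _ _ (fun=> 0) (fun n => 1 / n.+2%:R));
      first apply: nearW => n; last 2 first.
    - exact: cvg_cst.
    - exact: cvg_inv_nat.
    rewrite invr_ge0 exprn_ge0 ?ler0n//= div1r lef_pV2 ?posrE ?exprn_gt0 ?ltr0n//.
    by rewrite -[leLHS]expr1 ler_eXn2l// ltr1n.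
  apply: cvg_trans H; apply: near_eq_cvg; apply: nearW => n.
  by rewrite mulrAC mulfV ?mul1r// expf_neq0// pnatr_eq0.
have cs : scale n (alpha n) @[n --> \oo] --> a.
  have -> : (fun n => scale n (alpha n)) =
      (fun n => Num.sqrt (edge_count n / n.+2%:R ^+ q * (n.+2%:R ^+ q * alpha n * (1 - alpha n)))).
    by apply: funext => n; rewrite -scale_sqr// sqrtr_sqr ger0_norm// sqrtr_ge0.
  apply: (cvg_comp _ Num.sqrt); last exact: sqrt_continuous.
  rewrite /a [c0 / _]mulrC; apply: cvgM; first exact: cvg_edge_count.
  rewrite -[X in _ --> X]mulr1; apply: cvgM => //.
  by rewrite -[X in _ --> X]subr0; apply: cvgB => //; exact: cvg_cst.
(* Eventually [scale] is at least [a / 2], which makes [K0] times it at least 1. *)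
exists (1 + 2 / a); first by rewrite lerDl divr_ge0// ltW.
apply: good_params_of => //; last by right.
- have a20 : 0 < a / 2 by rewrite divr_gt0.
  have /cvgrPdist_le/(_ _ a20) H := cs; near=> n.
  have : `|a - scale n (alpha n)| <= a / 2 by near: n.
  rewrite ler_norml => /andP[_ h].
  have h2 : a / 2 <= scale n (alpha n) by lra.
  have h3 : 0 < scale n (alpha n) by rewrite (lt_le_trans _ h2).
  rewrite mulrDl mul1r (le_trans _ (_ : 2 / a * (a / 2) <= _))//.
    by rewrite mulrA divfK ?gt_eqF// divff.
  rewrite (@le_trans _ _ (2 / a * scale n (alpha n)))// ?lerDr ?(ltW h3)//.
  by rewrite ler_wpM2l// divr_ge0// ltW.
- by apply: cvgV => //; rewrite gt_eqF.
Unshelve. all: by end_near. Qed.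

End parameters.

(** The limit of [rho ^+ 2] is [q] times the mean of the reproduction law: the relation that turns
    [tree_walks] into [gw_walks]. *)
Lemma sparse_scale (R : realType) q (c0 : R) : (0 < q)%N -> 0 < c0 ->
  Num.sqrt (c0 / (q.-1)`!%:R) ^+ 2 = q%:R * (c0 / q`!%:R).
Proof.
move=> q_gt0 c00; have f0 : 0 < (q.-1)`!%:R :> R by rewrite ltr0n fact_gt0.
rewrite sqr_sqrtr ?divr_ge0 ?(ltW c00)//.
rewrite -[in RHS](prednK q_gt0) factS prednK// natrM; field.
by rewrite gt_eqF//= pnatr_eq0 -lt0n.
Qed.

Section weak_limit.
Local Open Scope classical_set_scope.
Variables (R : realType) (q : nat).
Hypothesis q_gt0 : (0 < q)%N.

Section fixed_parameters.
Variables (K0 eta : R) (alpha : nat -> R).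
Hypotheses (K0_ge1 : 1 <= K0) (gp : good_params q K0 eta alpha).

Definition scaled_adjacency n (h : {set {set 'I_n.+2}}) : 'M[R]_n.+2 :=
  (scale q n (alpha n))^-1 *: centred_adjacency q (alpha n) h.

Lemma spectral_mean_scaled n (h : {set {set 'I_n.+2}}) k :
  spectral_mean (scaled_adjacency h) (fun x => x ^+ k) =
  (n.+2%:R * scale q n (alpha n) ^+ k)^-1 * \tr (centred_adjacency q (alpha n) h ^+ k).
Proof.
rewrite spectral_mean_trace; last first.
  apply/matrixP => i j; rewrite !mxE; congr (_ * (_%:R * _)); first by rewrite eq_sym.
  by apply: eq_bigl => e; rewrite [(j \in e) && _]andbC.
by rewrite /scaled_adjacency exprZn mxtraceZ exprVn invfM mulrA.
Qed.

Variable pr : forall n, {set {set 'I_n.+2}} -> R.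
Hypothesis prl : forall n, hypergraph_law q (alpha n) (@pr n).

Lemma mean_moment_cvg k :
  \sum_(h : {set {set 'I_n.+2}}) pr h * spectral_mean (scaled_adjacency h) (fun x => x ^+ k)
    @[n --> \oo] --> tree_moment q eta k.
Proof.
have [C C0 HC] := trace_approx eta q_gt0 K0_ge1 k.
have [delta [cd Hd]] := gp (k * q).+1.
apply/cvgrPdist_le => e e0.
have cC : delta n * C @[n --> \oo] --> (0 : R) by rewrite -[X in _ --> X](mul0r C); apply: cvgMl.
have /cvgrPdist_le/(_ _ e0) He := cC.
near=> n; have wp : walk_params q K0 eta 'I_n.+2 (alpha n * (1 - alpha n)) (scale q n (alpha n))
    (delta n) (central_moment (alpha n)) (k * q).+1 by near: n.
have he : delta n * C <= e.
  have : `|0 - delta n * C| <= e by near: n.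
  by rewrite sub0r normrN; apply: le_trans; exact: ler_norm.
apply: le_trans he; rewrite distrC.
have r0 := wp_rho wp; have rk : 0 < scale q n (alpha n) ^+ k by rewrite exprn_gt0.
have N0 : 0 < n.+2%:R :> R by rewrite ltr0n.
have := HC _ _ _ _ _ wp; rewrite -(law_mean_trace (prl n)) card_ord.
under eq_bigr do rewrite spectral_mean_scaled mulrCA.
rewrite -mulr_sumr -/(law_mean (@pr n) _).
move: (law_mean _ _) (scale q n (alpha n) ^+ k) rk (tree_moment _ _ _) => W r rk t.
move: (n.+2%:R : R) N0 => Nn N0 h.
have -> : (Nn * r)^-1 * W - t = (Nn * r)^-1 * (W - Nn * r * t).
  by field; rewrite (gt_eqF rk) (gt_eqF N0).
rewrite normrM ger0_norm ?invr_ge0 ?mulr_ge0 ?(ltW rk) ?(ltW N0)//.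
by rewrite ler_pdivrMl ?mulr_gt0// (le_trans h)// le_eqVlt; apply/orP; left; apply/eqP; ring.
Unshelve. all: by end_near. Qed.

Lemma mean_moment_sqr_cvg k :
  \sum_(h : {set {set 'I_n.+2}}) pr h * spectral_mean (scaled_adjacency h) (fun x => x ^+ k) ^+ 2
    @[n --> \oo] --> tree_moment q eta k ^+ 2.
Proof.
have [C C0 HC] := trace_sqr_approx eta q_gt0 K0_ge1 k.
have [delta [cd Hd]] := gp (k * q.+1 + k * q).+1.
apply/cvgrPdist_le => e e0.
have cC : C * (delta n + 1 / n.+2%:R) @[n --> \oo] --> (0 : R).
  rewrite -[X in _ --> X](mulr0 C); apply: cvgMr; rewrite -[X in _ --> X]addr0.
  by apply: cvgD => //; exact: cvg_inv_nat.
have /cvgrPdist_le/(_ _ e0) He := cC.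
near=> n; have wp : walk_params q K0 eta 'I_n.+2 (alpha n * (1 - alpha n)) (scale q n (alpha n))
    (delta n) (central_moment (alpha n)) (k * q.+1 + k * q).+1 by near: n.
have he : C * (delta n + 1 / n.+2%:R) <= e.
  have : `|0 - C * (delta n + 1 / n.+2%:R)| <= e by near: n.
  by rewrite sub0r normrN; apply: le_trans; exact: ler_norm.
apply: le_trans he; rewrite distrC.
have r0 := wp_rho wp; have rk : 0 < scale q n (alpha n) ^+ k by rewrite exprn_gt0.
have N0 : 0 < n.+2%:R :> R by rewrite ltr0n.
have := HC _ _ _ _ _ wp; rewrite -(law_mean_trace_sqr (prl n)) card_ord.
under eq_bigr do rewrite spectral_mean_scaled exprMn mulrCA.
rewrite -mulr_sumr -/(law_mean (@pr n) _).
move: (law_mean _ _) (scale q n (alpha n) ^+ k) rk (tree_moment _ _ _) (delta n) => W r rk t dn.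
move: (n.+2%:R : R) N0 => Nn N0 h.
have -> : (Nn * r)^-1 ^+ 2 * W - t ^+ 2 = ((Nn * r) ^+ 2)^-1 * (W - (Nn * r * t) ^+ 2).
  by field; rewrite (gt_eqF rk) (gt_eqF N0).
have Nr : 0 < (Nn * r) ^+ 2 by rewrite exprn_gt0// mulr_gt0.
rewrite normrM ger0_norm ?invr_ge0 ?(ltW Nr)//.
rewrite ler_pdivrMl// (le_trans h)// le_eqVlt; apply/orP; left; apply/eqP.
by field; rewrite (gt_eqF N0).
Unshelve. all: by end_near. Qed.

End fixed_parameters.

Lemma weak_cvg_of_params (K0 eta : R) (alpha : nat -> R)
    (d : nat -> measure_display) (Omega : forall n, measurableType (d n))
    (P : forall n, probability (Omega n) R)
    (H : forall n, Omega n -> {set {set 'I_n.+2}})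
    (mu : {measure set (measurableTypeR R) -> \bar R}) :
  1 <= K0 -> good_params q K0 eta alpha ->
  (forall n, is_erdos_renyi (P n) q.+1 (alpha n) (H n)) ->
  entire_moments (tree_moment q eta) ->
  (forall f (Q K : {poly R}), cont_bounded f -> (forall x, `|f x - Q.[x]| <= K.[x]) ->
    `|\int[mu]_x f x - mom_pairing (tree_moment q eta) Q| <= mom_pairing (tree_moment q eta) K) ->
  weak_cvg_in_probability P (fun n w => esd (normalized_pair_adjacency (P n) (H n) w)) mu.
Proof.
move=> K1 gp HH em Hmu f cf [M [_ bf]] eps eps0.
have cbf : cont_bounded f.
  by split=> //; exists (M + 1) => x; apply: bf; rewrite ?ltrDl.
pose pr n : {set {set 'I_n.+2}} -> R := law_of (P n) (H n).
have prl n : hypergraph_law q (alpha n) (pr n) := erdos_renyi_law (HH n).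
pose L n (h : {set {set 'I_n.+2}}) := spectral_mean (scaled_adjacency alpha h).
have mH n e : measurable [set w | e \in H n w] by have [_ + _ _] := HH n; exact.
pose I := \int[mu]_x f x.
have C := @concentration R (fun n => {set {set 'I_n.+2}}) pr L (tree_moment q eta)
  (fun n h => law_ge0 (prl n) h) (fun n => law_total (prl n)) (fun n h => averaging_spectral_mean _)
  em (mean_moment_cvg K1 gp prl) (mean_moment_sqr_cvg K1 gp prl) f I cbf
  (fun Q K h => Hmu f Q K cbf h) eps eps0.
have mf : measurable_fun [set: measurableTypeR R] f by exact: continuous_measurable_fun.
have E n : P n [set w | eps < `|\int[esd (normalized_pair_adjacency (P n) (H n) w)]_x f x - I|] =
    (\sum_(h : {set {set 'I_n.+2}} | eps < `|L n h f - I|) pr n h)%:E.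
  pose A (h : {set {set 'I_n.+2}}) : 'M[R]_n.+2 := pair_adjacency h.
  (* The normalised matrix depends on [w] only through [H w]; on configurations of positive
     probability it equals [scaled_adjacency], and the others contribute 0 to both sums. *)
  pose G h : 'M[R]_n.+2 := (Num.sqrt (n.+2%:R * fine 'V_(P n)[fun v => A (H n v) ord0 1]))^-1 *:
    (A h - \matrix_(i, j) fine 'E_(P n)[fun v => A (H n v) i j]).
  rewrite (_ : [set w | _] = [set w | eps < `|spectral_mean (G (H n w)) f - I|]); last first.
    by apply/seteqP; split => w /=; rewrite Rintegral_esd.
  rewrite (law_of_event (P n) (mH n) (fun h => eps < `|spectral_mean (G h) f - I|)).
  apply: (congr1 EFin); rewrite [LHS]big_mkcond [RHS]big_mkcond; apply: eq_bigr => h _.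
  rewrite /pr; have [h0|h0] := eqVneq (law_of (P n) (H n) h) 0.
    have Z b : (if b then law_of (P n) (H n) h else 0) = 0 by case: b.
    exact: (etrans (Z _) (esym (Z _))).
  have [w wE] := law_of_neq0 h0.
  have -> : G h = scaled_adjacency alpha h.
    rewrite /scaled_adjacency /scale /edge_count -mulrA.
    by rewrite -wE -(normalized_pair_adjacencyE q_gt0 (HH n))// wE.
  by [].
under eq_fun do rewrite E.
apply/cvg_EFin; first by near=> n.
exact: C.
Unshelve. all: by end_near. Qed.

Lemma tree_moment_gw (lam a : R) k : 0 < a -> a ^+ 2 = q%:R * lam ->
  tree_moment q a^-1 k = gw_walks (q := q) lam k [::] None / a ^+ k.
Proof.
move=> a0 aE; rewrite -(tree_walks_gw q_gt0 k a0 aE) mulfK//.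
by rewrite expf_neq0// gt_eqF.
Qed.

Lemma entire_gw (lam a : R) : 0 <= lam -> 0 < a -> a ^+ 2 = q%:R * lam ->
  entire_moments (tree_moment q a^-1).
Proof.
move=> l0 a0 aE; apply: (@entire_touchard R lam l0 _ (q.+1%:R / a) 0) => [|k].
  by rewrite divr_ge0// ltW.
rewrite (tree_moment_gw _ a0 aE) divr_ge0 ?gw_walks_ge0 ?exprn_ge0 ?(ltW a0)//=.
rewrite expr_div_n mulrAC ler_wpM2r ?invr_ge0 ?exprn_ge0 ?(ltW a0)//.
exact: gw_walks_le.
Qed.

(** The limit law has to exist before any random hypergraph is given, so an explicit [alpha] in ]0,
    1[ and the product law supply averages whose moments converge. *)
Lemma limit_law_ex (c0 : R) : 0 < c0 ->
  let a := Num.sqrt (c0 / (q.-1)`!%:R) in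
  exists mu : probability (measurableTypeR R) R,
    moments_finite mu /\ forall k, moment mu k = (tree_moment q a^-1 k)%:E.
Proof.
move=> c00 a; have f0 : 0 < (q.-1)`!%:R :> R by rewrite ltr0n fact_gt0.
have a0 : 0 < a by rewrite sqrtr_gt0 divr_gt0.
pose alpha n : R := c0 / (n.+2%:R ^+ q + c0).
have N0 n : 0 < n.+2%:R ^+ q :> R by rewrite exprn_gt0 ?ltr0n.
have a01 n : 0 < alpha n < 1.
  have d0 : 0 < n.+2%:R ^+ q + c0 by rewrite addr_gt0.
  by rewrite divr_gt0//= ltr_pdivrMr// mul1r ltrDr.
have ca : n.+2%:R ^+ q * alpha n @[n --> \oo] --> c0.
  apply: (@squeeze_cvgr _ _ _ _ (fun n => c0 - c0 ^+ 2 / n.+2%:R) (fun=> c0));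
    first apply: nearW => n; last 2 first.
  - by rewrite -[X in _ --> X]subr0; apply: cvgB; [exact: cvg_cst|exact: cvg_inv_nat].
  - exact: cvg_cst.
  have d0 : 0 < n.+2%:R ^+ q + c0 by rewrite addr_gt0.
  have -> : n.+2%:R ^+ q * alpha n = c0 - c0 ^+ 2 / (n.+2%:R ^+ q + c0).
    by rewrite /alpha; field; rewrite gt_eqF.
  apply/andP; split; last by rewrite lerBlDr lerDl divr_ge0 ?sqr_ge0// ltW.
  rewrite lerD2l lerN2 ler_wpM2l ?sqr_ge0// lef_pV2 ?posrE ?ltr0n//.
  rewrite (@le_trans _ _ (n.+2%:R ^+ q)) ?lerDl ?(ltW c00)//.
  by rewrite -[leLHS]expr1 ler_eXn2l// ltr1n.
have [K0 K1 gp] := good_params_sparse q_gt0 c00 a01 ca.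
pose pr n : {set {set 'I_n.+2}} -> R := product_law q (alpha n).
have prl n : hypergraph_law q (alpha n) (pr n).
  by apply: product_law_law; have /andP[/ltW -> /ltW ->] := a01 n.
pose L n f := \sum_(h : {set {set 'I_n.+2}}) pr n h * spectral_mean (scaled_adjacency alpha h) f.
have HL n : averaging (L n).
  split=> [f g u v|f g fg|].
  - rewrite /L !mulr_sumr -big_split; apply: eq_bigr => h _ /=.
    by rewrite (averaging_lin (averaging_spectral_mean _)); ring.
  - apply: ler_sum => h _; rewrite ler_wpM2l//; first exact: (law_ge0 (prl n)).
    exact: (averaging_le (averaging_spectral_mean _)).
  - rewrite /L; under eq_bigr do rewrite (averaging1 (averaging_spectral_mean _)) mulr1.
    exact: (law_total (prl n)).
apply: (moment_existence HL (mean_moment_cvg K1 gp prl)).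
apply: (@entire_gw (c0 / q`!%:R)) => //; first by rewrite divr_ge0// ltW.
exact: sparse_scale.
Qed.

End weak_limit.

(** * Closed walks in the Galton-Watson hypertree *)

Section labels.
Local Open Scope ring_scope.
Variables (R : realType) (q : nat).
Local Notation label := (@label q).
Local Notation edge := (label * nat)%type.
Local Notation vtx := (option (nat * 'I_q)).
Implicit Types (X : label -> nat) (u v : label) (S : seq edge) (T : seq vtx) (x y : vtx).

Definition children u j : seq label := [seq (j, i) :: u | i <- enum 'I_q].

Definition siblings u : seq label :=
  if u is (j, i) :: u' then u' :: [seq (j, i') :: u' | i' <- enum 'I_q & i' != i] else [::].

Definition neighbours X u : seq label :=
  flatten [seq children u j | j <- iota 0 (X u)] ++ siblings u.

Fixpoint root_walks X (k : nat) u : R :=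
  if k is k'.+1 then \sum_(v <- neighbours X u) root_walks X k' v else (u == [::])%:R.

Lemma mem_children u j v : (v \in children u j) = [exists i, v == (j, i) :: u].
Proof.
apply/mapP/existsP => [[i _ ->]|[i /eqP ->]]; first by exists i.
by exists i; rewrite ?mem_enum.
Qed.

Lemma uniq_neighbours X u : uniq (neighbours X u).
Proof.
have sz (v : label) : v \in flatten [seq children u j | j <- iota 0 (X u)] -> size v = (size u).+1.
  by move=> /flatten_mapP[j _]; rewrite mem_children => /existsP[i /eqP ->].
have inj_cons : injective (fun p : nat * 'I_q => p :: u) by move=> a b [].
rewrite cat_uniq; apply/and3P; split.
- rewrite /children -[flatten _]/[seq (j, i) :: u | j <- iota 0 (X u), i <- enum 'I_q].
  apply: allpairs_uniq; rewrite ?iota_uniq ?enum_uniq//.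
  by move=> [j i] [j' i'] _ _ /= [-> ->].
- apply/hasPn => v; apply: contraL => /sz; case: u {inj_cons} sz => [|[j i] u'] //= _ sv.
  rewrite inE negb_or; apply/andP; split.
    by apply/eqP => vE; move: sv; rewrite vE /=; lia.
  by apply/mapP => -[i' _ vE]; move: sv; rewrite vE /=; lia.
- case: u {sz inj_cons} => [|[j i] u'] //=; apply/andP; split.
    by apply/mapP => -[i' _ /(congr1 size) /=]; lia.
  by rewrite map_inj_uniq ?filter_uniq ?enum_uniq -?enumT ?enum_uniq// => a b [].
Qed.

Lemma gw_vertex_neighbours X u v : gw_vertex X u -> v \in neighbours X u -> gw_vertex X v.
Proof.
move=> uX; rewrite mem_cat => /orP[/flatten_mapP[j]|].
  by rewrite mem_iota add0n => /= jX; rewrite mem_children => /existsP[i /eqP ->] /=; rewrite jX.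
case: u uX => [|[j i] u'] //= /andP[jX uX]; rewrite inE => /orP[/eqP -> //|].
by move=> /mapP[i' _ ->] /=; rewrite jX.
Qed.

Local Open Scope classical_set_scope.

(** From a vertex of the hypertree the neighbours form a finite list without repetition, so the
    operator, defined by a sum over a set, becomes a recursion on lists. *)
Lemma clique_adj_neighbours X u : gw_vertex X u ->
  [set v | clique_adj (gw_hyperedges X) u v] = [set` neighbours X u].
Proof.
move=> uX; apply/seteqP; split => v /=.
  move=> [uv [e [w [j [wX jX ->]]] [eu ev]]].
  have mem z : (w |` [set (j, i) :: w | i in [set: 'I_q]]) z -> z = w \/ exists i, z = (j, i) :: w.
    by case=> [-> |[i _ <-]]; [left|right; exists i].
  rewrite mem_cat; have [uE|[i uE]] := mem _ eu; have [vE|[i' vE]] := mem _ ev.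
  - by rewrite uE vE in uv.
  - apply/orP; left; apply/flatten_mapP; exists j; first by rewrite mem_iota uE.
    by rewrite mem_children uE; apply/existsP; exists i'; rewrite vE.
  - by rewrite uE /= vE inE eqxx orbT.
  - rewrite uE /= inE; apply/orP; right; apply/orP; right; apply/mapP; exists i' => //.
    by rewrite mem_filter mem_enum andbT; apply: contra_notN uv => /eqP ii; rewrite uE vE ii.
rewrite mem_cat => /orP[/flatten_mapP[j]|].
  rewrite mem_iota add0n => /= jX; rewrite mem_children => /existsP[i /eqP ->]; split.
    by move=> /(congr1 size) /=; lia.
  exists (u |` [set (j, i) :: u | i in [set: 'I_q]]); first by exists u, j.
  by split; [left|right; exists i].
case: u uX => [|[j i] u'] //= /andP[jX uX]; rewrite inE => /orP[/eqP ->|/mapP[i']].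
  split; first by move=> /(congr1 size) /=; lia.
  exists (u' |` [set (j, i) :: u' | i in [set: 'I_q]]); first by exists u', j.
  by split; [right; exists i|left].
rewrite mem_filter => /andP[ii _] ->; split; first by move=> [] /esym/eqP; rewrite (negbTE ii).
exists (u' |` [set (j, i) :: u' | i in [set: 'I_q]]); first by exists u', j.
by split; right; [exists i|exists i'].
Qed.

Lemma root_moment_walks X k : root_moment R (gw_hyperedges X) [::] k = root_walks X k [::].
Proof.
rewrite /root_moment; suff H u : gw_vertex X u ->
    iter k (adjacency_operator (gw_hyperedges X)) (fun v => (v == [::])%:R) u = root_walks X k u by exact: H.
elim: k u => [//|k IH] u uX; rewrite iterS {1}/adjacency_operator clique_adj_neighbours//.
rewrite -fsbig_seq ?uniq_neighbours//=; rewrite big_seq [RHS]big_seq.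
by apply: eq_bigr => v vu; apply: IH; exact: gw_vertex_neighbours vu.
Qed.

Local Close Scope classical_set_scope.

(* The [l]-th hyperedge of the hypertree is embedded as the offspring hyperedge
   of [e.1] with number [e.2], where [e] is the [l]-th entry of [S]. *)
Definition lab S x : label :=
  if x is Some (l, i) then let e := nth ([::], 0%N) S l in (e.2, i) :: e.1 else [::].

Definition edges_in X S := all (fun e : edge => (e.2 < X e.1)%N) S.

Definition embeds T S := [/\ size S = size T, uniq S &
  forall l, (l < size T)%N -> (nth ([::], 0%N) S l).1 = lab S (nth None T l)].

(** A label determines its offspring hyperedge and its position there, so distinct hyperedges in [S]
    suffice for injectivity. *)
Lemma lab_inj T S x y : embeds T S -> is_vtx (size T) x -> is_vtx (size T) y ->
  lab S x = lab S y -> x = y.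
Proof.
move=> [sz uS _]; rewrite -sz; case: x => [[l i]|]; case: y => [[l' i']|] //= lS l'S [j12 -> u12].
congr (Some (_, _)); apply/eqP; rewrite -(nth_uniq ([::], 0%N) lS l'S uS).
by case: (nth _ S l) (nth _ S l') j12 u12 => [a b] [c d] /= -> ->.
Qed.

Lemma root_walksS X k u : root_walks X k.+1 u =
  \sum_(j < X u) \sum_(i < q) root_walks X k ((val j, i) :: u) + \sum_(v <- siblings u) root_walks X k v.
Proof.
rewrite /= big_cat /= big_flatten /= big_map -{1}(subn0 (X u)) big_mkord; congr (_ + _).
by apply: eq_bigr => j _; rewrite /children big_map big_enum.
Qed.

Lemma sum_edges_at (V : nmodType) X S u (F : nat -> V) : uniq S -> edges_in X S ->
  \sum_(j < X u | (u, val j) \in S) F j = \sum_(e <- S | e.1 == u) F e.2.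
Proof.
move=> uS XS; rewrite -(big_mkord (fun j => (u, j) \in S)) /index_iota subn0.
rewrite -big_filter -[RHS]big_filter -(big_map (pair u) xpredT (fun e => F e.2)) /=.
apply: perm_big; apply: uniq_perm; rewrite ?filter_uniq//.
  by rewrite map_inj_uniq ?filter_uniq ?iota_uniq// => a b [].
move=> [v j]; rewrite mem_filter /=; apply/mapP/andP => [[j' + [-> ->]]|[/eqP -> vS]].
  by rewrite mem_filter => /andP[].
exists j => //; rewrite mem_filter vS mem_iota /= add0n.
by move/allP: XS => /(_ _ vS).
Qed.

(** Moves to the parent or to a sibling stay in the hyperedge of [T] that created [x]; moves to
    children use an offspring hyperedge that is either already in [S] or new. *)
Lemma root_walks_step X k T S x : hypertree T -> embeds T S -> edges_in X S -> is_vtx (size T) x ->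
  root_walks X k.+1 (lab S x) =
  \sum_(j < X (lab S x) | (lab S x, val j) \notin S) \sum_(i < q) root_walks X k ((val j, i) :: lab S x)
  + \sum_(l < size T | x \in hedge T l) \sum_(y <- hedge T l | y != x) root_walks X k (lab S y).
Proof.
move=> hT eS XS xT; have [sz uS Sl] := eS; rewrite root_walksS; set u := lab S x.
rewrite (bigID (fun j : 'I__ => (u, val j) \in S)) /= [X in X + _ = _]addrC -addrA; congr (_ + _).
set F := fun j => \sum_(i < q) root_walks X k ((j, i) :: u).
have nT l : (l < size T)%N -> ((nth ([::], 0%N) S l).1 == u) = (nth None T l == x).
  move=> lT; rewrite Sl//; apply/eqP/eqP => [|->//]; apply: (lab_inj eS) => //.
  exact: is_vtxS (ltnW lT) (hT _ lT).
have -> : \sum_(j < X u | (u, val j) \in S) F j = \sum_(l < size T | nth None T l == x)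
    \sum_(y <- hedge T l | y != x) root_walks X k (lab S y).
  rewrite sum_edges_at// (big_nth ([::], 0%N)) big_mkord sz; apply: eq_big => [l|l]; first exact: nT.
  move=> /= Sx; have Tx := Sx; rewrite nT// in Tx; rewrite /hedge (eqP Tx) big_cons eqxx /=.
  rewrite big_map big_enum_cond /F; apply: eq_big => [i|i _]; last by rewrite /= (eqP Sx).
  apply/esym/eqP => xE; have := hT l (ltn_ord l); rewrite (eqP Tx) -xE /=.
  by rewrite ltnn.
rewrite [RHS](bigID (fun l : 'I__ => nth None T l == x)) /=; congr (_ + _).
  apply: eq_bigl => l; rewrite mem_hedge eq_sym.
  by case: eqVneq => //=; rewrite ?andbF.
case: x => [[l0 i0]|] in xT u F nT *; last first.
  rewrite /= big_nil big_pred0// => l; rewrite mem_hedge orbF eq_sym; exact: andbN.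
rewrite (big_pred1 (Ordinal xT)) => [|l]; last first.
  rewrite mem_hedge /= -[l == _ :> 'I__]val_eqE /= [Some _ == _]eq_sym.
  case: eqVneq => [E|_]; last by rewrite andbT eq_sym.
  rewrite andbF; apply/esym/eqP => lE; have := hT _ (ltn_ord l); rewrite E lE /=.
  by rewrite ltnn.
rewrite /u /hedge /= big_cons -(Sl _ xT) /=; set e := nth _ S l0.
rewrite ifT; last first.
  by apply/eqP => E; have := hT _ xT; rewrite E /= ltnn.
rewrite big_cons; congr (_ + _); rewrite !big_map big_filter.
by rewrite -enumT; apply: eq_bigl => i; congr negb; apply/eqP/eqP => [->//|[]].
Qed.

End labels.

Section embeddings.
Local Open Scope ring_scope.
Variables (R : realType) (q : nat).
Local Notation label := (@label q).
Local Notation edge := (label * nat)%type.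
Local Notation vtx := (option (nat * 'I_q)).
Implicit Types (X : label -> nat) (u v : label) (S : seq edge) (T xs : seq vtx) (x y : vtx).

(* The sum of [G] over the embeddings, in the hypertree of the offspring numbers
   [X], of a hypertree whose first hyperedges are already embedded by [S]. *)
Fixpoint emb_sum X xs S (G : seq edge -> R) : R :=
  if xs is x :: xs' then
    \sum_(j < X (lab S x) | (lab S x, val j) \notin S) emb_sum X xs' (rcons S (lab S x, val j)) G
  else G S.

Lemma lab_rcons S e x : is_vtx (size S) x -> lab (rcons S e) x = lab S x.
Proof. by case: x => [[l i]|] //= lS; rewrite nth_rcons lS. Qed.

Lemma lab_new S u j i : lab (rcons S (u, j)) (Some (size S, i)) = (j, i) :: u.
Proof. by rewrite /= nth_rcons ltnn eqxx. Qed.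

Lemma hypertree_catl T xs : hypertree (T ++ xs) -> hypertree T.
Proof.
move=> h l lT; have := h l; rewrite size_cat nth_cat lT; apply.
exact: leq_trans lT (leq_addr _ _).
Qed.

Lemma hypertree_next T x xs : hypertree (T ++ x :: xs) -> is_vtx (size T) x.
Proof.
by move=> /(_ (size T)); rewrite size_cat nth_cat ltnn subnn /= addnS ltnS leq_addr; apply.
Qed.

Lemma embeds_rcons T S x j : hypertree T -> embeds T S -> is_vtx (size T) x ->
  (lab S x, j) \notin S -> embeds (rcons T x) (rcons S (lab S x, j)).
Proof.
move=> hT [sz uS Sl] xT jS; split; first by rewrite !size_rcons sz.
  by rewrite rcons_uniq jS.
move=> l; rewrite size_rcons ltnS leq_eqVlt !nth_rcons sz => /orP[/eqP ->|lT].
  by rewrite ltnn eqxx lab_rcons// sz.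
rewrite lT Sl// lab_rcons// sz.
exact: is_vtxS (ltnW lT) (hT _ lT).
Qed.

Lemma edges_in_rcons X S u j : edges_in X (rcons S (u, j)) = (j < X u)%N && edges_in X S.
Proof. exact: all_rcons. Qed.

Lemma emb_sum_rcons X xs x S G : emb_sum X (rcons xs x) S G =
  emb_sum X xs S (fun S' => \sum_(j < X (lab S' x) | (lab S' x, val j) \notin S')
                              G (rcons S' (lab S' x, val j))).
Proof. by elim: xs S => [//|y xs IH] S /=; apply: eq_bigr => j _. Qed.

Lemma emb_sum_sum X xs S (I : Type) (r : seq I) (P : pred I) (G : I -> seq edge -> R) :
  emb_sum X xs S (fun S' => \sum_(i <- r | P i) G i S') = \sum_(i <- r | P i) emb_sum X xs S (G i).
Proof.
elim: xs S => [//|x xs IH] S /=.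
by rewrite exchange_big /=; apply: eq_bigr => j _.
Qed.

Lemma emb_sumD X xs S (G G' : seq edge -> R) :
  emb_sum X xs S (fun S' => G S' + G' S') = emb_sum X xs S G + emb_sum X xs S G'.
Proof.
elim: xs S => [//|x xs IH] S /=.
by rewrite -big_split /=; apply: eq_bigr => j _.
Qed.

Lemma eq_emb_sum X xs T S (G G' : seq edge -> R) : hypertree (T ++ xs) ->
  embeds T S -> edges_in X S ->
  (forall S', embeds (T ++ xs) S' -> edges_in X S' -> G S' = G' S') ->
  emb_sum X xs S G = emb_sum X xs S G'.
Proof.
elim: xs T S => [|x xs IH] T S hT eS XS GG' /=; first by apply: GG' => //; rewrite cats0.
apply: eq_bigr => j jS; apply: (IH (rcons T x)).
- by rewrite cat_rcons.
- apply: embeds_rcons => //; first exact: hypertree_catl hT.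
  exact: hypertree_next hT.
- by rewrite edges_in_rcons XS ltn_ord.
- by rewrite cat_rcons.
Qed.

Lemma emb_sum_walks X k T x : hypertree T -> is_vtx (size T) x ->
  emb_sum X T [::] (fun S => root_walks R X k.+1 (lab S x)) =
  \sum_(i < q) emb_sum X (rcons T x) [::] (fun S => root_walks R X k (lab S (Some (size T, i))))
  + \sum_(l < size T | x \in hedge T l) \sum_(y <- hedge T l | y != x)
      emb_sum X T [::] (fun S => root_walks R X k (lab S y)).
Proof.
move=> hT xT.
pose G S := \sum_(i < q) \sum_(j < X (lab S x) | (lab S x, val j) \notin S)
  root_walks R X k ((val j, i) :: lab S x).
pose G' S := \sum_(l < size T | x \in hedge T l) \sum_(y <- hedge T l | y != x) root_walks R X k (lab S y).
rewrite (@eq_emb_sum X T [::] [::] _ (fun S => G S + G' S))//; last first.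
  move=> S eS XS; rewrite (root_walks_step _ _ hT)//; congr (_ + _).
  by rewrite exchange_big.
rewrite emb_sumD /G /G' !emb_sum_sum; congr (_ + _).
  apply: eq_bigr => i _; rewrite emb_sum_rcons; apply: (@eq_emb_sum X T [::] [::]) => // S eS XS.
  apply: eq_bigr => j _; have [sz _ _] := eS.
  by rewrite -sz lab_new.
by apply: eq_bigr => l _; rewrite emb_sum_sum.
Qed.

(* The hypertrees explored by the walks that [gw_walks] counts. *)
Fixpoint walk_trees (k : nat) T x : seq (seq vtx) :=
  if k is k'.+1 then
    flatten [seq walk_trees k' (rcons T x) (Some (size T, i)) | i <- enum 'I_q]
    ++ flatten [seq flatten [seq walk_trees k' T y | y <- hedge T (val l) & y != x]
               | l <- [seq l : 'I_(size T) <- enum 'I_(size T) | x \in hedge T (val l)]]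
  else nseq (x == None) T.

Lemma big_walk_treesS k T x (F : seq vtx -> R) : \sum_(T' <- walk_trees k.+1 T x) F T' =
  \sum_(i < q) \sum_(T' <- walk_trees k (rcons T x) (Some (size T, i))) F T'
  + \sum_(l < size T | x \in hedge T l) \sum_(y <- hedge T l | y != x)
      \sum_(T' <- walk_trees k T y) F T'.
Proof.
rewrite [walk_trees k.+1 T x]/(_ ++ _) big_cat !big_flatten !big_map; congr (_ + _).
rewrite big_filter big_enum_cond; apply: eq_bigr => l xl.
by rewrite big_flatten big_map big_filter.
Qed.

Lemma walk_trees_hypertree k T x : hypertree T -> is_vtx (size T) x ->
  {in walk_trees k T x, forall T', hypertree T'}.
Proof.
elim: k T x => [|k IH] T x hT xT T' /=; first by case: (x == None); rewrite ?inE// => /eqP ->.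
rewrite mem_cat => /orP[/flatten_mapP[i _]|/flatten_mapP[l _ /flatten_mapP[y]]].
  by apply: IH; [exact: hypertree_rcons|rewrite /= size_rcons].
rewrite -[if _ then _ else _]/(seq.filter (fun y => y != x) (hedge T l)) mem_filter => /andP[_ yl].
by apply: IH => //; exact: hedge_vtx yl.
Qed.

(** An identity for each realisation [X]: a walk amounts to the hypertree it explores, together with
    an embedding of it. *)
Lemma emb_sum_root_walks X k T x : hypertree T -> is_vtx (size T) x ->
  emb_sum X T [::] (fun S => root_walks R X k (lab S x)) =
  \sum_(T' <- walk_trees k T x) emb_sum X T' [::] (fun=> 1).
Proof.
elim: k T x => [|k IH] T x hT xT.
  have -> : \sum_(T' <- walk_trees 0 T x) emb_sum X T' [::] (fun=> 1) =
      (x == None)%:R * emb_sum X T [::] (fun=> 1).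
    by rewrite /=; case: (x == None); rewrite ?big_seq1 ?mul1r// big_nil mul0r.
  rewrite -[RHS]/(_ * _).
  rewrite (@eq_emb_sum X T [::] [::] _ (fun=> (x == None)%:R)) => //; last first.
    move=> S eS _ /=; congr (nat_of_bool _)%:R.
    by apply/eqP/eqP => [|-> //]; exact: (@lab_inj _ _ _ x None eS).
  by case: (x == None); rewrite ?mul1r// mul0r; elim: (T) {hT xT} ([::] : seq edge) => [//|y xs IHx] S /=; rewrite big1.
rewrite emb_sum_walks// big_walk_treesS; congr (_ + _).
  by apply: eq_bigr => i _; rewrite IH ?size_rcons//=; exact: hypertree_rcons.
apply: eq_bigr => l xl; rewrite big_seq_cond [RHS]big_seq_cond.
by apply: eq_bigr => y /andP[yl _]; rewrite IH//; exact: hedge_vtx yl.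
Qed.

(** The same enumeration of hypertrees with weight [lam ^+ size T'], so it remains to see that this
    weight is the mean number of embeddings. *)
Lemma gw_walks_trees (lam : R) k T x :
  lam ^+ size T * gw_walks lam k T x = \sum_(T' <- walk_trees k T x) lam ^+ size T'.
Proof.
elim: k T x => [|k IH] T x.
  by rewrite /=; case: (x == None); rewrite ?big_seq1 ?mulr1// big_nil mulr0.
rewrite -[in RHS]/(walk_trees k.+1 T x) big_walk_treesS mulrDr; congr (_ + _).
  rewrite mulrA -exprSr mulr_sumr; apply: eq_bigr => i _.
  by rewrite -IH size_rcons.
rewrite mulr_sumr; apply: eq_bigr => l xl; rewrite mulr_sumr.
by apply: eq_bigr => y _.
Qed.

Lemma root_moment_trees X k : root_moment R (gw_hyperedges X) [::] k =
  \sum_(T <- walk_trees k [::] None) emb_sum X T [::] (fun=> 1).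
Proof. by rewrite root_moment_walks -emb_sum_root_walks. Qed.

End embeddings.

(** * Independent families of integer variables *)

Section discrete_families.
Local Open Scope classical_set_scope.
Local Open Scope ring_scope.

Lemma nneseries_ord (R : realType) (f : nat -> \bar R) n : (forall j, (0 <= f j)%E) ->
  (\sum_(0 <= j <oo) (if (j < n)%N then f j else 0) = \sum_(j < n) f j)%E.
Proof.
move=> f0; rewrite (@nneseries_split _ _ 0%N n) => [|k _]; last by case: ifP.
rewrite add0n eseries0 ?adde0; last by move=> i ni _; rewrite ltnNge ni.
by rewrite big_mkord; apply: eq_bigr => j _; rewrite ltn_ord.
Qed.

Context d (Omega : measurableType d) (R : realType) (P : probability Omega R).

Lemma integral_preimages (Y : {mfun Omega >-> nat}) (D : set Omega) (f : Omega -> \bar R) :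
  measurable D -> measurable_fun setT f -> (forall w, (0 <= f w)%E) ->
  (\int[P]_(w in D) f w = \sum_(0 <= k <oo) \int[P]_(w in D `&` Y @^-1` [set k]) f w)%E.
Proof.
move=> mD mf f0.
have mY k : measurable (Y @^-1` [set k]) by rewrite -[_ @^-1` _]setTI; exact: measurable_funP.
have DE : D = \bigcup_k (D `&` Y @^-1` [set k]).
  by apply/seteqP; split => [w Dw|w [k _ []//]]; exists (Y w).
rewrite {1}DE ge0_integral_bigcup//.
- by move=> k; exact: measurableI.
- rewrite -DE; exact: measurable_funTS.
- by move=> i j _ _ [w [[_ <-] [_ <-]]].
Qed.

Lemma measurable_nat_fun (Y : {mfun Omega >-> nat}) (h : nat -> R) :
  measurable_fun setT (fun w => h (Y w)).
Proof. by apply: measurableT_comp => // _ B _; rewrite setTI. Qed.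

Variables (I : choiceType) (X : I -> {RV P >-> nat}).
Hypothesis indep : forall k : I -> nat, mutually_independent P setT (fun i => X i @^-1` [set k i]).

Definition slice (s : seq I) (k : I -> nat) : set Omega := \bigcap_(i in [set` s]) (X i @^-1` [set k i]).

Lemma measurable_preim v k : measurable (X v @^-1` [set k]).
Proof. by rewrite -[_ @^-1` _]setTI; exact: measurable_funP. Qed.

Lemma measurable_slice s k : measurable (slice s k).
Proof. by apply: fin_bigcap_measurable => // i _; exact: measurable_preim. Qed.

Definition update (k : I -> nat) v m : I -> nat := fun u => if u == v then m else k u.

Lemma slice_cons s k v m : v \notin s ->
  slice s k `&` X v @^-1` [set m] = slice (v :: s) (update k v m).
Proof.
move=> vs; apply/seteqP; split => w.
  move=> [ws wv] u /=; rewrite inE => /orP[/eqP ->|us]; first by rewrite /update eqxx.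
  by rewrite /update ifN; [exact: ws|apply: contraNneq vs => <-].
move=> ws; split => [u us|]; last first.
  by have := ws v; rewrite /= inE eqxx /update eqxx; apply.
have := ws u; rewrite /= inE us orbT /update ifN; first by apply.
by apply: contraNneq vs => <-.
Qed.

Lemma probability_slice s k : uniq s -> P (slice s k) = (\prod_(i <- s) P (X i @^-1` [set k i]))%E.
Proof. by move=> us; apply: (indep k us). Qed.

Lemma probability_slice_cons s k v m : uniq (v :: s) ->
  P (slice (v :: s) (update k v m)) = (P (slice s k) * P (X v @^-1` [set m]))%E.
Proof.
move=> /[dup] uvs /= /andP[vs us]; rewrite !probability_slice// big_cons /update eqxx muleC.
congr (_ * _)%E; apply: eq_big_seq => u us'; rewrite ifN//.
by apply: contraNneq vs => <-.
Qed.

Lemma integral_slice s k v (psi : nat -> R) : uniq (v :: s) -> (forall n, 0 <= psi n) ->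
  (\int[P]_(w in slice s k) (psi (X v w))%:E = P (slice s k) * \int[P]_w (psi (X v w))%:E)%E.
Proof.
move=> uvs psi0.
have mpsi : measurable_fun setT (fun w => (psi (X v w))%:E).
  by apply/measurable_EFinP; exact: measurable_nat_fun.
have cst D m : measurable D -> (\int[P]_(w in D `&` X v @^-1` [set m]) (psi (X v w))%:E =
    (psi m)%:E * P (D `&` X v @^-1` [set m]))%E.
  move=> mD; rewrite -integral_cst; last by apply: measurableI => //; exact: measurable_preim.
  by apply: eq_integral => w; rewrite inE => -[_ /= ->].
rewrite (integral_preimages (X v) (measurable_slice s k) mpsi); last by move=> w; rewrite lee_fin.
rewrite [in RHS](integral_preimages (X v) measurableT mpsi); last by move=> w; rewrite lee_fin.
have Pfin : P (slice s k) = (fine (P (slice s k)))%:E.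
  by rewrite fineK// fin_num_measure//; exact: measurable_slice.
rewrite Pfin -nneseriesZl; last by move=> m _; apply: integral_ge0 => w _; rewrite lee_fin.
apply: eq_eseriesr => m _; rewrite !cst//; last exact: measurable_slice.
have /andP[vs us] := uvs.
by rewrite setTI slice_cons// probability_slice_cons// -Pfin muleCA.
Qed.

Definition depends_on (s : seq I) (Phi : (I -> nat) -> R) :=
  forall k k' : I -> nat, {in s, k =1 k'} -> Phi k = Phi k'.

(** Independence of elementary events is lifted to functions by fixing the variables of [s] one
    after the other: those of [a] are already fixed, and once [s] is empty [Phi] is constant on the
    slice. *)
Lemma integral_slice_indep s a k v (Phi : (I -> nat) -> R) (psi : nat -> R) (e : R) :
  uniq (v :: s ++ a) -> depends_on (s ++ a) Phi ->
  measurable_fun setT (fun w => Phi (X ^~ w)) -> (forall k, 0 <= Phi k) ->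
  (forall n, 0 <= psi n) -> (\int[P]_w (psi (X v w))%:E = e%:E)%E ->
  (\int[P]_(w in slice a k) (Phi (X ^~ w) * psi (X v w))%:E =
   e%:E * \int[P]_(w in slice a k) (Phi (X ^~ w))%:E)%E.
Proof.
move=> us dep mPhi Phi0 psi0 epsi.
elim: s a k us dep => [|u s IH] a k us dep.
  have PhiE w : slice a k w -> Phi (X ^~ w) = Phi k by move=> wa; apply: dep => u ua; exact: wa.
  have -> : (\int[P]_(w in slice a k) (Phi (X ^~ w) * psi (X v w))%:E =
      \int[P]_(w in slice a k) ((Phi k)%:E * (psi (X v w))%:E))%E.
    by apply: eq_integral => w; rewrite inE => /PhiE ->.
  have -> : (\int[P]_(w in slice a k) (Phi (X ^~ w))%:E = \int[P]_(w in slice a k) (cst (Phi k)%:E w))%E.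
    by apply: eq_integral => w; rewrite inE => /PhiE ->.
  rewrite ge0_integralZl_EFin//; first last.
  - by apply/measurable_EFinP; apply: measurable_funTS; exact: measurable_nat_fun.
  - by move=> w _; rewrite lee_fin.
  - exact: measurable_slice.
  rewrite integral_cst; last exact: measurable_slice.
  by rewrite integral_slice// epsi [(P _ * _)%E]muleC muleCA.
have [vus uus] : v \notin u :: s ++ a /\ uniq (u :: s ++ a) by have /andP[] := us.
have ua : u \notin a by move: uus => /= /andP[]; rewrite mem_cat negb_or => /andP[].
have mF : measurable_fun setT (fun w => (Phi (X ^~ w))%:E) by apply/measurable_EFinP.
have mG : measurable_fun setT (fun w => (Phi (X ^~ w) * psi (X v w))%:E).
  by apply/measurable_EFinP; apply: measurable_funM => //; exact: measurable_nat_fun.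
rewrite (integral_preimages (X u) (measurable_slice a k))//; last first.
  by move=> w; rewrite lee_fin mulr_ge0.
rewrite [in RHS](integral_preimages (X u) (measurable_slice a k) mF); last by move=> w; rewrite lee_fin.
rewrite -nneseriesZl; last by move=> m _; apply: integral_ge0 => w _; rewrite lee_fin.
apply: eq_eseriesr => m _; rewrite slice_cons//; apply: IH.
  rewrite (@perm_uniq _ _ (v :: u :: s ++ a))// perm_cons.
  by rewrite -(cat1s u a) -(cat1s u (s ++ a)) perm_catCA.
by move=> k1 k2 kk; apply: dep => z hz; apply: kk; rewrite mem_cat inE orbCA -mem_cat.
Qed.

Lemma integral_indep s v (Phi : (I -> nat) -> R) (psi : nat -> R) (e : R) :
  v \notin s -> depends_on s Phi ->
  measurable_fun setT (fun w => Phi (X ^~ w)) -> (forall k, 0 <= Phi k) ->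
  (forall n, 0 <= psi n) -> (\int[P]_w (psi (X v w))%:E = e%:E)%E ->
  (\int[P]_w (Phi (X ^~ w) * psi (X v w))%:E = e%:E * \int[P]_w (Phi (X ^~ w))%:E)%E.
Proof.
move=> vs dep mPhi Phi0 psi0 epsi.
have E : slice [::] (fun=> 0%N) = setT by apply/seteqP; split => // w _ u.
rewrite -!E; apply: (@integral_slice_indep (undup s)) => //.
  by rewrite cats0 /= undup_uniq mem_undup vs.
by move=> k k' kk; apply: dep => u us; apply: kk; rewrite cats0 mem_undup.
Qed.

Lemma integral_indeps s vs (Phi : (I -> nat) -> R) (psi : I -> nat -> R) (e : I -> R) :
  uniq vs -> {in vs, forall v, v \notin s} -> depends_on s Phi ->
  measurable_fun setT (fun w => Phi (X ^~ w)) -> (forall k, 0 <= Phi k) ->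
  (forall v n, 0 <= psi v n) -> (forall v, \int[P]_w (psi v (X v w))%:E = (e v)%:E)%E ->
  (\int[P]_w (Phi (X ^~ w) * \prod_(v <- vs) psi v (X v w))%:E =
   (\prod_(v <- vs) e v)%:E * \int[P]_w (Phi (X ^~ w))%:E)%E.
Proof.
move=> + + dep mPhi Phi0 psi0 epsi; elim: vs => [|v vs IH] /=.
  by move=> _ _; rewrite big_nil mul1e; apply: eq_integral => w _; rewrite big_nil mulr1.
move=> /andP[vvs uvs] hs.
pose Phi' k := Phi k * \prod_(u <- vs) psi u (k u).
have -> : (\int[P]_w (Phi (X ^~ w) * \prod_(u <- v :: vs) psi u (X u w))%:E =
    \int[P]_w (Phi' (X ^~ w) * psi v (X v w))%:E)%E.
  by apply: eq_integral => w _; rewrite /Phi' big_cons mulrCA mulrC.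
rewrite (@integral_indep (vs ++ s) v Phi' (psi v) (e v))//.
- rewrite IH//; last by move=> u us; apply: hs; rewrite inE us orbT.
  by rewrite muleA -EFinM big_cons.
- by rewrite mem_cat negb_or vvs hs ?mem_head.
- move=> k k' kk; congr (_ * _).
    by apply: dep => u us; apply: kk; rewrite mem_cat us orbT.
  by apply: eq_big_seq => u us; rewrite kk// mem_cat us.
- apply: measurable_funM => //; apply: measurable_prod => u _.
  exact: measurable_nat_fun.
- by move=> k; rewrite mulr_ge0// prodr_ge0.
Qed.

End discrete_families.

Section vertices.
Local Open Scope nat_scope.
Variable q : nat.
Local Notation label := (@label q).
Local Notation edge := (label * nat)%type.
Local Notation vtx := (option (nat * 'I_q)).
Implicit Types (T xs : seq vtx) (S : seq edge) (x v : vtx).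

Definition vtxs m : seq vtx := None :: [seq Some (l, i) | l <- iota 0 m, i <- enum 'I_q].

Lemma mem_vtxs m v : (v \in vtxs m) = is_vtx m v.
Proof.
rewrite inE; case: v => [[l i]|] //=; apply/allpairsP/idP => [[[l' i'] /= [+ _ [-> _]]]|lm].
  by rewrite mem_iota.
by exists (l, i); rewrite /= mem_iota mem_enum.
Qed.

Lemma uniq_vtxs m : uniq (vtxs m).
Proof.
rewrite /=; apply/andP; split; first by apply/allpairsP => -[[l i] /= []].
by apply: allpairs_uniq; rewrite ?iota_uniq ?enum_uniq// => -[l i] [l' i'] _ _ /= [-> ->].
Qed.

Lemma vtxsS m : vtxs m.+1 = vtxs m ++ [seq Some (m, i) | i <- enum 'I_q].
Proof. by rewrite /vtxs -addn1 iotaD map_cat flatten_cat /= cats0. Qed.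

Definition used S (u : label) : nat := count (fun e => e.1 == u) S.

Lemma used_rcons S u j u' : used (rcons S (u, j)) u' = (used S u' + (u == u'))%N.
Proof. by rewrite /used -cats1 count_cat /= addn0. Qed.

Lemma embeds_lab T S e : hypertree T -> embeds T S -> e \in S ->
  e.1 \in [seq lab S v | v <- vtxs (size T)].
Proof.
move=> hT [sz uS Sl] /(nthP ([::], 0%N)) [l lS <-].
rewrite Sl; last by rewrite -sz.
apply: map_f; rewrite mem_vtxs.
by rewrite sz in lS *; apply: is_vtxS (hT _ lS); exact: ltnW.
Qed.

(** The labels of the new vertices differ from all earlier ones, so their offspring numbers are
    independent of what has been explored. *)
Lemma embeds_new T S x j i : hypertree T -> embeds T S -> is_vtx (size T) x ->
  (lab S x, j) \notin S -> (j, i) :: lab S x \notin [seq lab S v | v <- vtxs (size T)].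
Proof.
move=> hT eS xT jS; have [sz _ _] := eS.
apply/mapP => -[v]; rewrite mem_vtxs => vT E.
have eS' := embeds_rcons hT eS xT jS.
suff vE : v = Some (size T, i) by rewrite vE /= ltnn in vT.
apply: (lab_inj eS').
- by rewrite size_rcons; apply: is_vtxS vT.
- by rewrite /= size_rcons.
- by rewrite lab_rcons ?sz// -sz lab_new.
Qed.

Lemma count_new xs m : count (predC (is_vtx m)) xs =
  (count (predC (is_vtx m.+1)) xs + \sum_(i < q) count_mem (Some (m, i)) xs)%N.
Proof.
elim: xs => [|x xs IH] /=; first by rewrite big1.
rewrite IH big_split /= !addnA; congr (_ + _)%N; rewrite addnAC; congr (_ + _)%N.
case: x => [[l i]|] /=; last by rewrite big1.
have [lm|lm|->] := ltngtP l m.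
- by rewrite leqW// big1// => i' _; case: eqVneq => // -[lE]; rewrite lE ltnn in lm.
- by rewrite ltnNge lm /= big1// => i' _; case: eqVneq => // -[lE]; rewrite lE ltnn in lm.
rewrite ltnSn /= (bigD1 i) //= eqxx big1// => i' /negbTE i'i.
by rewrite -[Some _ == _]/((m == m) && (i == i')) eqxx eq_sym i'i.
Qed.

End vertices.

(** * Expected number of embeddings of a hypertree *)

Section expected_embeddings.
Local Open Scope classical_set_scope.
Local Open Scope ring_scope.
Variable q : nat.
Local Notation label := (@label q).
Local Notation edge := (label * nat)%type.
Local Notation vtx := (option (nat * 'I_q)).
Implicit Types (T xs : seq vtx) (S : seq edge) (x v : vtx) (u : label) (k : label -> nat).

Lemma emb_sum_ge0 (R : realType) k xs S (G : seq edge -> R) : (forall S', 0 <= G S') ->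
  0 <= emb_sum k xs S G.
Proof. by move=> G0; elim: xs S => [|x xs IH] S //=; apply: sumr_ge0. Qed.

(** A sum with a random number of terms becomes a series over all [j]: the condition on [j] moves
    into the indicator [edges_in], and integration can be done term by term. *)
Lemma ok_series (R : realType) k S u (B : nat -> R) : (forall j, 0 <= B j) ->
  (((edges_in k S)%:R * \sum_(j < k u | (u, val j) \notin S) B j)%:E =
  \sum_(0 <= j <oo) (((u, j) \notin S)%:R * ((edges_in k (rcons S (u, j)))%:R * B j))%:E)%E.
Proof.
move=> B0; pose f j := (((u, j) \notin S)%:R * ((edges_in k S)%:R * B j))%:E.
have f0 j : (0 <= f j)%E by rewrite lee_fin !mulr_ge0.
transitivity (\sum_(j < k u) f j)%E.
  rewrite mulr_sumr sumEFin; congr EFin; rewrite big_mkcond; apply: eq_bigr => j _.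
  by case: ((u, val j) \in S); rewrite /= ?mul1r ?mul0r.
rewrite -nneseries_ord//; apply: eq_eseriesr => j _; rewrite edges_in_rcons /f.
by case: (j < k u)%N; rewrite //= mul0r mulr0.
Qed.

Lemma free_edges (R : realType) k S u : uniq S -> edges_in k S ->
  \sum_(j < k u | (u, val j) \notin S) 1 = (k u - used S u)%:R :> R.
Proof.
move=> uS kS; have H : (k u = \sum_(j < k u | (u, val j) \in S) 1 + \sum_(j < k u | (u, val j) \notin S) 1)%N.
  rewrite -[in LHS](card_ord (k u)) -sum1_card (bigID (fun j : 'I__ => (u, val j) \in S)) /=.
  by [].
transitivity ((\sum_(j < k u | (u, val j) \notin S) 1)%N%:R : R); first by rewrite natr_sum.
congr (_%:R); have -> : used S u = (\sum_(j < k u | (u, val j) \in S) 1)%N.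
  by rewrite (sum_edges_at u (fun=> 1%N) uS kS) sum1_count.
by rewrite [X in _ = (X - _)%N]H addKn.
Qed.

Context d (Omega : measurableType d) (R : realType) (P : probability Omega R).
Variables (lam : R) (X : label -> {RV P >-> nat}).
Hypotheses (lam_gt0 : 0 < lam) (poissonX : poisson_reproduction lam X).

Let indep : forall k, mutually_independent P setT (fun i => X i @^-1` [set k i]).
Proof. by have [] := poissonX. Qed.

Lemma integral_poisson u (h : nat -> R) : (forall n, 0 <= h n) ->
  (\int[P]_w (h (X u w))%:E = \sum_(0 <= n <oo) (h n * poisson_pmf lam n)%:E)%E.
Proof.
move=> h0; rewrite (integral_preimages P (X u) measurableT); last 2 first.
- by apply/measurable_EFinP; exact: measurable_nat_fun.
- by move=> w; rewrite lee_fin.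
apply: eq_eseriesr => n _; have [PX _] := poissonX; rewrite setTI EFinM -(PX u n) -integral_cst; last exact: measurable_preim.
by apply: eq_integral => w; rewrite inE /= => ->.
Qed.

(** Shifting the summation index by one takes out a factor [lam] and lowers the order of the falling
    factorial by one. *)
Lemma factorial_moment u m : (\int[P]_w ((X u w) ^_ m)%:R%:E = (lam ^+ m)%:E)%E.
Proof.
elim: m => [|m IH].
  under eq_integral do rewrite ffactn0.
  rewrite expr0 -[RHS]mul1e -(@probability_setT _ _ _ P) -integral_cst//.
rewrite (@integral_poisson u (fun n => (n ^_ m.+1)%:R))//.
have pmf0 n : 0 <= poisson_pmf lam n by exact: poisson_pmf_ge0.
rewrite nneseries_recl => [|n _|//]; last by rewrite lee_fin mulr_ge0.
rewrite ffact0n mul0r add0e -[X in (\sum_(X <= _ <oo) _)%E]add0n -nneseries_addn => [|n]; last first.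
  by rewrite lee_fin mulr_ge0.
rewrite exprS EFinM -IH (@integral_poisson u (fun n => (n ^_ m)%:R))// -nneseriesZl; last first.
  by move=> n _; rewrite lee_fin mulr_ge0.
apply: eq_eseriesr => n _; rewrite -EFinM; congr EFin.
rewrite add0n addn1 ffactnS /= natrM /poisson_pmf lam_gt0 factS natrM exprS invfM.
have : n.+1%:R != 0 :> R by rewrite pnatr_eq0.
by move: (n.+1%:R) ((n ^_ m)%:R) (lam ^+ n) ((n`!)%:R^-1) (expR _) => a b c e g a0; field.
Qed.

Lemma measurable_emb_sum xs S :
  measurable_fun setT (fun w => emb_sum (X ^~ w) xs S (fun=> 1) : R).
Proof.
elim: xs S => [|x xs IH] S; first exact: measurable_cst.
have TE : setT = \bigcup_n (X (lab S x) @^-1` [set n]).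
  by apply/seteqP; split => // w _; exists (X (lab S x) w).
rewrite TE; apply/measurable_fun_bigcup => n; first exact: measurable_preim.
apply: (eq_measurable_fun (fun w => \sum_(j < n | (lab S x, val j) \notin S)
    emb_sum (X ^~ w) xs (rcons S (lab S x, val j)) (fun=> 1))).
  by move=> w; rewrite inE /= => <-.
apply: measurable_funTS; under eq_fun do rewrite big_mkcond.
by apply: measurable_sum => j; case: ((lab S x, val j) \notin S) => //; exact: IH.
Qed.

Lemma measurable_edges_in S : measurable_fun setT (fun w => (edges_in (X ^~ w) S)%:R : R).
Proof.
under eq_fun do rewrite /edges_in -big_all.
elim: S => [|e S IH].
  under eq_fun do rewrite big_nil; exact: measurable_cst.
under eq_fun do rewrite big_cons -mulnb natrM.
apply: measurable_funM => //.
exact: (measurable_nat_fun (X e.1) (fun n => (e.2 < n)%N%:R)).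
Qed.

Lemma measurable_ffact_prod S (c m : vtx -> nat) (r : seq vtx) :
  measurable_fun setT (fun w => \prod_(v <- r) ((X (lab S v) w - c v) ^_ (m v))%:R : R).
Proof.
apply: measurable_prod => v _.
exact: (measurable_nat_fun (X (lab S v)) (fun n => ((n - c v) ^_ (m v))%:R)).
Qed.

(** Hyperedges of [xs] attached to vertices still to be created contribute [lam] each; those
    attached to vertices of [T] contribute falling factorials of the offspring hyperedges not yet
    used. Keeping these inside the integral is what makes the peeling inductive. *)
Lemma integral_emb_sum T S xs : hypertree (T ++ xs) -> embeds T S ->
  (\int[P]_w ((edges_in (X ^~ w) S)%:R * emb_sum (X ^~ w) xs S (fun=> 1))%:E =
   (lam ^+ count (predC (is_vtx (size T))) xs)%:E *
   \int[P]_w ((edges_in (X ^~ w) S)%:R *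
     \prod_(v <- vtxs q (size T)) ((X (lab S v) w - used S (lab S v)) ^_ (count_mem v xs))%:R)%:E)%E.
Proof.
elim: xs T S => [|x xs IH] T S hTxs eS.
  rewrite expr0 mul1e; apply: eq_integral => w _; congr (_ * _)%:E.
  by rewrite big1// => v _; rewrite ffactn0.
have hT := hypertree_catl hTxs; have xT := hypertree_next hTxs; have [sz uS _] := eS.
set u := lab S x.
have uL : u \in [seq lab S v | v <- vtxs q (size T)] by apply: map_f; rewrite mem_vtxs.
pose S_ j := rcons S (u, j).
pose C w : R := \prod_(v <- vtxs q (size T))
  ((X (lab S v) w - (used S (lab S v) + (x == v))) ^_ (count_mem v xs))%:R.
pose F j w : \bar R := (((u, j) \notin S)%:R * ((edges_in (X ^~ w) (S_ j))%:R *
  emb_sum (X ^~ w) xs (S_ j) (fun=> 1)))%:E.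
pose G j w : \bar R := (((u, j) \notin S)%:R * ((edges_in (X ^~ w) (S_ j))%:R * C w))%:E.
have C0 w : 0 <= C w by apply: prodr_ge0 => v _; exact: ler0n.
have mC : measurable_fun setT C by exact: measurable_ffact_prod.
have E0 w j : 0 <= emb_sum (X ^~ w) xs (S_ j) (fun=> 1) :> R by apply: emb_sum_ge0.
have mF j : measurable_fun setT (F j).
  apply/measurable_EFinP; apply: measurable_funM => //; apply: measurable_funM.
    exact: measurable_edges_in.
  exact: measurable_emb_sum.
have mG j : measurable_fun setT (G j).
  apply/measurable_EFinP; apply: measurable_funM => //; apply: measurable_funM => //.
  exact: measurable_edges_in.
have F0 j w : (0 <= F j w)%E by rewrite lee_fin !mulr_ge0.
have G0 j w : (0 <= G j w)%E by rewrite lee_fin !mulr_ge0.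
transitivity (\int[P]_w \sum_(0 <= j <oo) F j w)%E.
  by apply: eq_integral => w _; exact: ok_series.
transitivity ((lam ^+ count (predC (is_vtx (size T))) xs)%:E * \int[P]_w \sum_(0 <= j <oo) G j w)%E; last first.
  rewrite [count _ (x :: xs)]/= xT add0n; congr (_ * _)%E; apply: eq_integral => w _.
  (* [C w] does not depend on [j], so the sum counts the free offspring hyperedges of [u]: the
     leading factor of the falling factorial of one order higher. *)
  rewrite /G -(@ok_series R (X ^~ w) S u (fun=> C w))//; congr EFin.
  case: (boolP (edges_in (X ^~ w) S)) => wS; last by rewrite !mul0r.
  have FE := @free_edges R (X ^~ w) S u uS wS; rewrite /= in FE.
  rewrite !mul1r -[X in \sum_(_ < _ | _) X]mul1r -mulr_suml FE /C.
  rewrite !(bigD1_seq x) ?mem_vtxs ?uniq_vtxs//= eqxx mulrA -natrM addn1 subnS add1n ffactnS -/u.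
  congr (_ * _); apply: eq_bigr => v vx.
  by rewrite [x == v]eq_sym (negbTE vx) addn0.
rewrite !integral_nneseries// -nneseriesZl => [|j _]; last exact: integral_ge0.
apply: eq_eseriesr => j _; rewrite /F /G; case: (boolP ((u, j) \in S)) => jS.
  by under eq_integral do rewrite mul0r; under [in RHS]eq_integral do rewrite mul0r; rewrite !integral0 mule0.
under eq_integral do rewrite mul1r; under [in RHS]eq_integral do rewrite mul1r.
have eS' := embeds_rcons hT eS xT jS.
rewrite (IH (rcons T x))//; last by rewrite cat_rcons.
rewrite size_rcons vtxsS [in RHS](count_new xs (size T)) exprD EFinM -muleA; congr (_ * _)%E.
pose cnt i := count_mem (Some (size T, i)) xs.
pose psi (v : label) n : R := if v is (_, i) :: _ then (n ^_ (cnt i))%:R else 1.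
pose e (v : label) : R := if v is (_, i) :: _ then lam ^+ cnt i else 1.
pose Phi (k : label -> nat) : R := (edges_in k (S_ j))%:R *
  \prod_(v <- vtxs q (size T)) ((k (lab S v) - (used S (lab S v) + (x == v))) ^_ (count_mem v xs))%:R.
(* The offspring numbers of the [q] new vertices are integrated out, each giving a factorial moment
   of the Poisson law. *)
have := @integral_indeps _ Omega R P _ X indep [seq lab S v | v <- vtxs q (size T)]
  (children u j) Phi psi e.
have -> : \prod_(v <- children u j) e v = lam ^+ (\sum_(i < q) cnt i)%N.
  by rewrite /children big_map big_enum /= expr_sum.
move=> <-.
- apply: eq_integral => w _; rewrite big_cat /= mulrA; congr (_ * _ * _)%:E.
    rewrite big_seq [RHS]big_seq; apply: eq_bigr => v; rewrite mem_vtxs => vT.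
    rewrite lab_rcons ?sz// used_rcons; congr ((_ - (_ + nat_of_bool _)) ^_ _)%:R.
    by rewrite /u; apply/eqP/eqP => [|->//]; exact: (lab_inj eS).
  rewrite /children !big_map; apply: eq_bigr => i _; rewrite -sz lab_new /psi.
  rewrite (_ : used _ _ = 0%N) ?subn0 ?sz//; apply/eqP; rewrite -leqn0 leqNgt -has_count.
  apply/hasPn => e' e'S; apply: contraNneq (embeds_new i hT eS xT jS) => <-.
  move: e'S; rewrite mem_rcons inE => /orP[/eqP ->|]; last exact: embeds_lab.
  exact: uL.
- by rewrite map_inj_uniq ?enum_uniq// => a b [].
- by move=> v; rewrite mem_children => /existsP[i /eqP ->]; exact: embeds_new eS xT jS.
- move=> k k' kk; congr (_%:R * _).
    rewrite /edges_in /S_ !all_rcons [_.1]/= kk//; congr (_ && _).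
    by apply: eq_in_all => e' /(embeds_lab hT eS) /kk ->.
  by apply: eq_big_seq => v vT; rewrite kk ?map_f.
- apply: measurable_funM => //; exact: measurable_edges_in.
- by move=> k; rewrite mulr_ge0// prodr_ge0.
- by move=> [|[? i] ?] n; rewrite ?ler01.
- case=> [|[? i] ?]; last exact: factorial_moment.
  exact: (factorial_moment [::] 0).
Qed.

Lemma expected_emb_sum T : hypertree T ->
  (\int[P]_w (emb_sum (X ^~ w) T [::] (fun=> 1))%:E = (lam ^+ size T)%:E)%E.
Proof.
move=> hT; transitivity (\int[P]_w ((edges_in (X ^~ w) [::])%:R * emb_sum (X ^~ w) T [::] (fun=> 1))%:E)%E.
  by apply: eq_integral => w _; rewrite mul1r.
rewrite (@integral_emb_sum [::] [::] T)//.
have -> : (\int[P]_w ((edges_in (X ^~ w) [::])%:R * \prod_(v <- vtxs q (size ([::] : seq vtx)))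
    ((X (lab [::] v) w - used [::] (lab [::] v)) ^_ (count_mem v T))%:R)%:E =
    \int[P]_w ((X [::] w) ^_ (count_mem None T))%:R%:E)%E.
  by apply: eq_integral => w _; rewrite mul1r /vtxs big_seq1 subn0.
rewrite factorial_moment -EFinM -exprD -[in RHS](count_predC (is_vtx 0) T) addnC.
by congr (lam ^+ (_ + _))%:E; apply: eq_count => -[[l i]|].
Qed.

Lemma expected_root_moment (n : nat) :
  'E_P[fun w => root_moment R (gw_hyperedges (X ^~ w)) [::] n]%E = (gw_walks lam n ([::] : seq vtx) None)%:E.
Proof.
have := gw_walks_trees lam n ([::] : seq vtx) None; rewrite expr0 mul1r => ->.
rewrite unlock; under eq_integral do rewrite root_moment_trees -sumEFin.
rewrite ge0_integral_sum//.
- rewrite -sumEFin big_seq [RHS]big_seq; apply: eq_bigr => T hT.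
  by apply: expected_emb_sum; exact: walk_trees_hypertree hT.
- by move=> T; apply/measurable_EFinP; exact: measurable_emb_sum.
- by move=> T w _; rewrite lee_fin emb_sum_ge0.
Qed.

End expected_embeddings.

Local Open Scope classical_set_scope.

(** * The theorem *)

Lemma dilate_moments (R : realType) (a : R) (mu : probability (measurableTypeR R) R) (m : nat -> R) :
  moments_finite mu -> (forall k, moment mu k = (m k)%:E) ->
  moments_finite (dilate a mu) /\ forall k, moment (dilate a mu) k = (a ^+ k * m k)%:E.
Proof.
move=> mf mm.
have mX k : measurable_fun setT (fun x : measurableTypeR R => (x ^+ k)%:E : \bar R).
  by have /integrableP[] := mf k.
have aE k : ((fun x : R => (x ^+ k)%:E) \o dilation a) = (fun x : R => (a ^+ k)%:E * (x ^+ k)%:E)%E.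
  by apply/funext => x /=; rewrite /dilation exprMn EFinM.
have ai k : mu.-integrable setT ((fun x : R => (x ^+ k)%:E) \o dilation a).
  by rewrite aE; apply: integrableZl => //; exact: mf.
split=> k.
  by apply: integrable_pushforward; rewrite ?preimage_setT.
rewrite /moment integral_distribution// aE (integralZl measurableT (mf k)).
by rewrite EFinM -mm.
Qed.

Theorem theorem1p7 (R : realType) (p : nat) (hp : (2 <= p)%N) :
  exists mu_ : R -> probability (measurableTypeR R) R,
    (forall (d : nat -> measure_display) (Omega : forall n, measurableType (d n))
        (P : forall n, probability (Omega n) R)
        (H : forall n, Omega n -> {set {set 'I_n.+2}}) (c : nat -> R),
      let alpha (N : nat) := c N / N%:R ^+ p.-1 in
      let mu (n : nat) (w : Omega n) :=
        esd (normalized_pair_adjacency (P n) (H n) w) in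
      (forall n, 0 < alpha n.+2 < 1) ->
      (forall n, is_erdos_renyi (P n) p (alpha n.+2) (H n)) ->
      (c N @[N --> \oo] --> +oo ->
       N%:R ^+ p.-1 * (1 - alpha N) @[N --> \oo] --> +oo ->
       weak_cvg_in_probability P mu semicircle) /\
      (forall c0 : R, 0 < c0 -> c N @[N --> \oo] --> c0 ->
       weak_cvg_in_probability P mu (mu_ c0))) /\
    (forall c0 : R, 0 < c0 ->
      [/\ moment_determinate (mu_ c0),
          ~ bounded_set (measure_support (mu_ c0))
        & exists2 a : R, 0 < a &
          forall (d : measure_display) (Omega : measurableType d)
            (P : probability Omega R) (X : @label p.-1 -> {RV P >-> nat}),
          poisson_reproduction (c0 / (p.-1)`!%:R) X ->
          is_expected_spectral_measure P
            (fun w => gw_hyperedges (fun v => X v w)) [::]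
            (dilate a (mu_ c0))]).
Proof.
case: p hp => [//|q] hp; have q_gt0 : (0 < q)%N by [].
(* The limit of [rho], hence also the dilation that links the limit law to the hypertree. *)
pose a c0 : R := Num.sqrt (c0 / (q.-1)`!%:R).
have a0 (c0 : R) : 0 < c0 -> 0 < a c0.
  by move=> c00; rewrite sqrtr_gt0 divr_gt0// ltr0n fact_gt0.
have aE (c0 : R) : 0 < c0 -> a c0 ^+ 2 = q%:R * (c0 / q`!%:R) by exact: sparse_scale.
have l0 (c0 : R) : 0 < c0 -> 0 < c0 / q`!%:R :> R by move=> c00; rewrite divr_gt0// ltr0n fact_gt0.
have [mu_ Hmu] : exists mu_ : R -> probability (measurableTypeR R) R, forall c0 : R, 0 < c0 ->
    moments_finite (mu_ c0) /\ forall k, moment (mu_ c0) k = (tree_moment q (a c0)^-1 k)%:E.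
  have H (c0 : R) : exists mu : probability (measurableTypeR R) R, 0 < c0 ->
      moments_finite mu /\ forall k, moment mu k = (tree_moment q (a c0)^-1 k)%:E.
    (* For [c0 <= 0] nothing is claimed, and the law for the value 1 serves as a default. *)
    have [c00|c00] := boolP (0 < c0).
      by have [mu mu1] := limit_law_ex q_gt0 c00; exists mu.
    by have [mu _] := limit_law_ex q_gt0 (@ltr01 R); exists mu.
  by have [mu_ Hmu] := choice H; exists mu_.
have em (c0 : R) : 0 < c0 -> entire_moments (tree_moment q (a c0)^-1).
  by move=> c00; apply: (entire_gw q_gt0 (ltW (l0 _ c00)) (a0 _ c00)); exact: aE.
exists mu_; split => [d Omega P H c alpha mu a01 HH|c0 c00].
  (* The parameter for [N = n.+2] vertices; limits in [N] are used along this shift. *)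
  pose beta n := alpha n.+2.
  have bc n : n.+2%:R ^+ q * beta n = c n.+2.
    by rewrite /beta /alpha mulrC divfK// expf_neq0// pnatr_eq0.
  split=> [cy ay|c0 c00 cc].
    have gp : good_params q 1 0 beta.
      apply: good_params_dense => //.
        by under eq_fun do rewrite bc; have := cvg_comp (addn 2) c (cvg_addnl 2) cy.
      have := cvg_comp (addn 2) _ (cvg_addnl 2) ay.
      exact.
    have tm : tree_moment q 0 = ballot_moment R by apply/funext => k; exact: tree_walks0.
    apply: (weak_cvg_of_params q_gt0 (lexx 1) gp HH).
      by rewrite tm; exact: entire_ballot.
    by move=> f Q K cf QK; rewrite tm; exact: semicircle_approx.
  have bc0 : n.+2%:R ^+ q * beta n @[n --> \oo] --> c0.
    by under eq_fun do rewrite bc; have := cvg_comp (addn 2) c (cvg_addnl 2) cc.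
  have [K0 K1 gp] := good_params_sparse q_gt0 c00 a01 bc0.
  have [mf mm] := Hmu _ c00.
  apply: (weak_cvg_of_params q_gt0 K1 gp HH (em _ c00)) => f Q K cf QK.
  exact: Rintegral_approx.
have [mf mm] := Hmu _ c00; split.
- exact: entire_moment_determinate (em _ c00).
- apply: (unbounded_support mf mm) => B B0.
  have [k Bk] := gw_walks_unbounded q_gt0 (l0 _ c00) (a0 _ c00) B0; exists k.
  by rewrite (tree_moment_gw q_gt0 _ (a0 _ c00) (aE _ c00)).
exists (a c0); first exact: a0.
move=> d Omega P X pX; have [df dm] := dilate_moments (a c0) mf mm.
(* The dilation by [a c0] cancels the normalisation and leaves the expected numbers of closed
   walks. *)
have E k : a c0 ^+ k * tree_moment q (a c0)^-1 k = gw_walks (q := q) (c0 / q`!%:R) k [::] None.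
  rewrite (tree_moment_gw q_gt0 _ (a0 _ c00) (aE _ c00)) mulrC divfK//.
  by rewrite expf_neq0// gt_eqF ?a0.
split; last by move=> k; rewrite dm E -(expected_root_moment (l0 _ c00) pX).
apply: (entire_moment_determinate df dm).
apply: (@entire_touchard R (c0 / q`!%:R) (ltW (l0 _ c00)) _ q.+1%:R 0) => // k.
rewrite E gw_walks_ge0 ?(ltW (l0 _ c00))//=.
by apply: gw_walks_le; exact: ltW (l0 _ c00).
Qed.
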